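(* Let $\mathfrak{A}$ be a finite abelian group, let $\Gamma$ be a metric graph or a tropical curve, and let $D$ be an $\mathfrak{A}$-dilation datum on $\Gamma$. Then there is a natural bijection between the sheaf cohomology group $H^1(\Gamma,\mathfrak{A}_D)$ of the codilation sheaf $\mathfrak{A}_D$ and the set of isomorphism classes of harmonic $\mathfrak{A}$-covers $\phi:\Gamma'\to\Gamma$ whose associated $\mathfrak{A}$-dilation datum is $D$; explicitly, the bijection is the assignment $\phi\mapsto[(g^e)_e]$ described in the context.
   Context: **Graphs.** A graph (with legs) $G$ consists of a finite set $X(G)$, an idempotent root map $r:X(G)\to X(G)$, and an involution $\iota:X(G)\to X(G)$ whose fixed set contains the image of $r$. Put $V(G)=r(X(G))$ (vertices) and $H(G)=X(G)\setminus V(G)$ (half-edges). The $\iota$-orbits in $H(G)$ of size 2 are the edges, forming the set $E(G)$, and those of size 1 are the legs, forming the set $L(G)$. A half-edge $h$ is rooted at $r(h)$; a leg has a root vertex but no vertex at its free end. Put $T_vG=\{h\in H(G): r(h)=v\}$. A loop is an edge whose two root vertices coincide; a graph is simple if it has no loops and no multiple edges. An orientation is an ordering $(h,h')$ of each edge $e=\{h,h'\}$, and then $s(e)=r(h)$, $t(e)=r(h')$. A morphism of graphs $f:G'\to G$ is a map $X(G')\to X(G)$ commuting with $r$ and $\iota$ and sending vertices to vertices, edges to edges, legs to legs. A harmonic morphism is a morphism $f$ together with a degree (dilation factor) function $d_f:X(G')\to\mathbb{Z}_{>0}$ that agrees on the two half-edges of each edge, such that $d_f(v')=\sum_{h'\in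 T_{v'}G'\cap f^{-1}(h)}d_f(h')$ for every $v'\in V(G')$ and every $h\in T_{f(v')}G$. Its global degree is $\sum_{x'\in f^{-1}(x)}d_f(x')$, for any $x\in X(G)$. **Metric graphs.** A model $(G,\ell)$, with $\ell:E(G)\to\mathbb{R}_{>0}$, determines a metric graph $\Gamma$ by gluing a segment $[0,\ell(e)]$ for each edge $e$ and a half-line $[0,\infty)$ for each leg according to $G$, with the shortest-path metric. A tropical curve is a metric graph $\Gamma$ with a finitely supported function $g:\Gamma\to\mathbb{Z}_{\ge0}$; its points of positive genus are required to be vertices in any model, and a harmonic morphism of tropical curves is a harmonic morphism of the underlying metric graphs. A harmonic morphism $\phi:\Gamma'\to\Gamma$ is a continuous piecewise-linear map induced, for some models, by a harmonic morphism of graphs $f:G'\to G$ with $\ell(f(e'))=d_f(e')\,\ell(e')$ for all $e'\in E(G')$, where $\phi$ is linear with slope $d_f(e')$ (resp. $d_f(l')$) on each edge $e'$ (resp. leg $l'$). Such an $f$ is called a model for $\phi$. **Harmonic $\mathfrak{A}$-covers.** A harmonic $\mathfrak{A}$-cover of $\Gamma$ is a harmonic morphism $\phi:\Gamma'\to\Gamma$ of degree $|\mathfrak{A}|$ together with an action of $\mathfrak{A}$ on $\Gamma'$ by invertible isometries such that $\phi(a(p'))=\phi(p')$ for all $a\in\mathfrak{A}$, $p'\in\Gamma'$, and $\mathfrak{A}$ acts transitively on every fiber $\phi^{-1}(p)$. (Then the dilation factor of $\phi$ at $p'$ is the order of the stabilizer of $p'$.) An isomorphism of two harmonic $\mathfrak{A}$-covers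 of $\Gamma$ is an $\mathfrak{A}$-equivariant isometry commuting with the maps to $\Gamma$. Since $\mathfrak{A}$ is abelian, all points of $\phi^{-1}(p)$ have the same stabilizer $D(p)\subseteq\mathfrak{A}$; the family $(D(p))_{p\in\Gamma}$ is the $\mathfrak{A}$-dilation datum associated to $\phi$. **Dilation data.** An $\mathfrak{A}$-dilation datum $D$ on a graph $G$ is a choice of subgroups $D(v)\subseteq\mathfrak{A}$ for $v\in V(G)$ and $D(h)\subseteq\mathfrak{A}$ for $h\in H(G)$ such that $D(h)\subseteq D(r(h))$ and $D(h)=D(h')=:D(e)$ for every edge $e=\{h,h'\}$. An $\mathfrak{A}$-dilation datum on a metric graph $\Gamma$ is an $\mathfrak{A}$-dilation datum on some model $G$ of $\Gamma$; it defines a subgroup $D(p)\subseteq\mathfrak{A}$ for every $p\in\Gamma$ (the group of the vertex, or of the open edge or leg, containing $p$). **Codilation sheaf.** Choose a simple oriented model $G$ of $\Gamma$ on which $D$ is defined. Put $C(v)=D(v)$ for a vertex $v$, $C(l)=D(r(l))$ for a leg $l$, and $C(e)=D(v)+D(w)$ for an edge $e$ with root vertices $v,w$. Let $U_v\subset\Gamma$ be the union of $v$ and the interiors of all edges and legs at $v$, $U_l$ the interior of the leg $l$, and $U_e=U_v\cap U_w$ the interior of the edge $e$ with root vertices $v,w$. The codilation sheaf $\mathfrak{A}_D$ is the sheaf of abelian groups on $\Gamma$ with $\mathfrak{A}_D(U)=\mathfrak{A}/C(v)$ for connected open $U$ with $v\in U\subseteq U_v$, $\mathfrak{A}_D(U)=\mathfrak{A}/C(e)$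 for nonempty connected open $U\subseteq U_e$, and $\mathfrak{A}_D(U)=\mathfrak{A}/C(l)$ for nonempty connected open $U\subseteq U_l$, with restriction maps the natural quotient maps; sections over other open sets are determined by the sheaf axioms. The sheaf depends on the chosen model, but $H^1(\Gamma,\mathfrak{A}_D)$ does not. The cover $\{U_v\}\cup\{U_l\}$ is acyclic for $\mathfrak{A}_D$, so $H^1(\Gamma,\mathfrak{A}_D)$ is the set of tuples $(g^e)_{e\in E(G)}$ with $g^e\in\mathfrak{A}/C(e)$, modulo the relation $(\tilde g^e)\sim(g^e)$ if there are $g^v\in\mathfrak{A}/C(v)$ with $\tilde g^e-g^e=g^{t(e)}-g^{s(e)}$ in $\mathfrak{A}/C(e)$ for all $e$. **The assignment.** Let $\phi$ be a harmonic $\mathfrak{A}$-cover of $\Gamma$ with dilation datum $D$, and let $f:G'\to G$ be a model for $\phi$ over $G$. Choose $v_0\in f^{-1}(v)$ for each vertex $v$ and $e_0\in f^{-1}(e)$ for each edge $e$. For each edge $e$, the root vertices of $e_0$ lying over $s(e)$ and $t(e)$ are $a_e\cdot s(e)_0$ and $b_e\cdot t(e)_0$ for some $a_e,b_e\in\mathfrak{A}$. Put $g^e=b_e-a_e\in\mathfrak{A}/C(e)$. *)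

(* Defs.v *)
From HB Require Import structures.
From mathcomp Require Import all_boot all_order all_algebra all_fingroup.
From mathcomp Require Import all_classical all_reals ereal.

Set Implicit Arguments.
Unset Strict Implicit.
Unset Printing Implicit Defensive.

Import Order.TTheory GRing.Theory Num.Theory.

Local Open Scope classical_set_scope.
Local Open Scope ring_scope.

(** * Graphs with legs *)

Record graph := Graph {
  cells :> finType;
  root_of : cells -> cells;
  flip_of : cells -> cells;
  rootK : forall x, root_of (root_of x) = root_of x;
  flipK : involutive flip_of;
  flip_root : forall x, flip_of (root_of x) = root_of x
}.

Section GraphNotions.
Variable G : graph.
Implicit Types (x h k : G) (o : {set G}).

Definition is_vertex x : bool := root_of x == x.
Definition is_leg x : bool := ~~ is_vertex x && (flip_of x == x).
Definition is_edge_half x : bool := ~~ is_vertex x && (flip_of x != x).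

Definition simple_graph : Prop :=
  (forall h, is_edge_half h -> root_of h <> root_of (flip_of h)) /\
  (forall h k, is_edge_half h -> is_edge_half k ->
     root_of h = root_of k -> root_of (flip_of h) = root_of (flip_of k) -> h = k).

(* [o] contains the first half-edge of each edge.  An oriented edge is
   represented by that half-edge [h]: its source is [root_of h] and its target
   is [root_of (flip_of h)]. *)
Definition orientation o : Prop :=
  (forall h, h \in o -> is_edge_half h) /\
  (forall h, is_edge_half h -> (h \in o) (+) (flip_of h \in o)).

Definition graph_dilation_datum (gT : finGroupType) (D : G -> {group gT}) :=
  (forall h, D h \subset D (root_of h)) /\ (forall h, D (flip_of h) = D h).
End GraphNotions.

Section GraphMorphisms.
Variables (G' G : graph).
Implicit Types (f : G' -> G) (d : G' -> nat).

Definition graph_morphism f : Prop :=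
  [/\ forall x, f (root_of x) = root_of (f x),
      forall x, f (flip_of x) = flip_of (f x),
      forall x, is_edge_half x -> is_edge_half (f x) &
      forall x, is_leg x -> is_leg (f x)].

Definition harmonic_graph_morphism f d : Prop :=
  [/\ graph_morphism f,
      forall x, (0 < d x)%N,
      forall x, d (flip_of x) = d x &
      forall v' h, is_vertex v' -> ~~ is_vertex h -> root_of h = f v' ->
        d v' = (\sum_(h' : G' | [&& ~~ is_vertex h', root_of h' == v' & f h' == h])
                  d h')%N].

(* The fiber sum is required to be [n] over every cell, so that the notion
   also makes sense over a disconnected graph. *)
Definition global_degree f d (n : nat) : Prop :=
  forall x : G, (\sum_(x' : G' | f x' == x) d x')%N = n.
End GraphMorphisms.

(** * Metric graphs *)

Section Charts.
Variables (R : realType) (G : graph) (len : G -> R).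
Variables (T : Type) (par : G -> R -> T).

(* The closed parameter domain of a cell and its interior: a vertex is the
   point [0], an edge is [0, len] and a leg is [0, +oo[. *)
Definition closed_dom (x : G) (t : R) : Prop :=
  if is_vertex x then t = 0 else
  if is_leg x then 0 <= t else 0 <= t <= len x.

Definition inner_dom (x : G) (t : R) : Prop :=
  if is_vertex x then t = 0 else
  if is_leg x then 0 < t else 0 < t < len x.

(* [walk p q L]: a path of length [L] from [p] to [q], each step of which
   runs along a single closed edge or leg. *)
Inductive walk (p : T) : T -> R -> Prop :=
| walk_nil : walk p p 0
| walk_step x s t L : walk p (par x s) L ->
    closed_dom x s -> closed_dom x t -> walk p (par x t) (L + `|t - s|).

Definition path_dist (p q : T) : \bar R :=
  ereal_inf [set L%:E | L in walk p q].

End Charts.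

(* A model of the (extended) metric space [(T, gdist)].  Each half-edge [h]
   parametrizes its edge or leg from [root_of h]; [par] has no meaning outside
   [closed_dom].  The axioms say that [T] is the space glued from points,
   segments and half-lines according to the graph.  Distances between
   different connected components are [+oo]. *)
Record model (R : realType) (T : Type) (gdist : T -> T -> \bar R) := Model {
  mgraph :> graph;
  len : mgraph -> R;
  par : mgraph -> R -> T;
  len_flip : forall h, len (flip_of h) = len h;
  len_gt0 : forall h, is_edge_half h -> 0 < len h;
  par_root : forall h, par h 0 = par (root_of h) 0;
  par_flip : forall h t, is_edge_half h -> 0 <= t <= len h ->
    par (flip_of h) (len h - t) = par h t;
  par_surj : forall p, exists x t, inner_dom len x t /\ par x t = p;
  par_inj : forall x t y u, inner_dom len x t -> inner_dom len y u ->
    par x t = par y u ->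
    (x = y /\ t = u) \/ [/\ is_edge_half x, y = flip_of x & u = len x - t];
  par_dist : forall p q, gdist p q = path_dist len par p q
}.

Record metricGraph (R : realType) := MetricGraph {
  carrier :> Type;
  gdist : carrier -> carrier -> \bar R;
  has_model : inhabited (model gdist)
}.

Notation modelOf Γ := (model (@gdist _ Γ)).

Section MetricGraphNotions.
Variable R : realType.

(* The cell containing [p] in its interior; for a point inside an edge this
   is one of its two half-edges. *)
Definition cell_at (Γ : metricGraph R) (M : modelOf Γ) (p : Γ) : M :=
  sval (cid (par_surj M p)).

Definition metric_open (Γ : metricGraph R) (U : set Γ) : Prop :=
  forall p, U p -> exists2 e : R, 0 < e &
    forall q, (gdist p q < e%:E)%E -> U q.

(* [(f, d)] is a model for [phi]. *)
Definition morphism_model (Γ' Γ : metricGraph R) (M' : modelOf Γ')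
    (M : modelOf Γ) (f : M' -> M) (d : M' -> nat) (phi : Γ' -> Γ) : Prop :=
  [/\ harmonic_graph_morphism f d,
      forall h, is_edge_half h -> len (f h) = (d h)%:R * len h &
      forall x t, closed_dom (@len _ _ _ M') x t ->
        phi (par x t) = par (f x) ((d x)%:R * t)].

Definition harmonic_of_degree (Γ' Γ : metricGraph R) (n : nat)
    (phi : Γ' -> Γ) : Prop :=
  exists (M' : modelOf Γ') (M : modelOf Γ) (f : M' -> M) (d : M' -> nat),
    morphism_model f d phi /\ global_degree f d n.

(** * Metric graphs or tropical curves *)

Record tropicalCurve := TropicalCurve {
  tgraph : metricGraph R;
  genus : tgraph -> nat;
  genus_finite : finite_set [set p | (0 < genus p)%N]
}.

Inductive curve :=
| Metric of metricGraph R
| Tropical of tropicalCurve.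

Definition is_tropical (Γ : curve) : bool :=
  if Γ is Tropical _ then true else false.

Definition underlying (Γ : curve) : metricGraph R :=
  match Γ with Metric Γ => Γ | Tropical Γ => tgraph Γ end.

Definition positive_genus (Γ : curve) : set (underlying Γ) :=
  match Γ return set (underlying Γ) with
  | Metric _ => set0
  | Tropical Γ => [set p | (0 < @genus Γ p)%N]
  end.

End MetricGraphNotions.

Coercion underlying : curve >-> metricGraph.

Definition curve_model (R : realType) (Γ : curve R) (M : modelOf Γ) : Prop :=
  forall p, positive_genus p -> is_vertex (cell_at M p).

(** * Dilation data *)

Definition defined_on (R : realType) (gT : finGroupType) (Γ : curve R)
    (M : modelOf Γ) (D : Γ -> {group gT}) : Prop :=
  exists2 DG : M -> {group gT}, graph_dilation_datum DG &
    forall x t, inner_dom (@len _ _ _ M) x t -> D (par x t) = DG x.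

Record dilationDatum (R : realType) (gT : finGroupType) (Γ : curve R) :=
  DilationDatum {
    dil :> Γ -> {group gT};
    dil_model : exists2 M : modelOf Γ, curve_model M & defined_on M dil
  }.

(** * Harmonic covers *)

Section Covers.
Variables (R : realType) (gT : finGroupType).

(* [gT] is meant to be abelian, so that the right actions of the library are
   the same as left actions. *)
Record harmonicCover (Γ : curve R) := HarmonicCover {
  source : curve R;
  cproj : source -> Γ;
  cact : {action gT &-> source};
  source_kind : is_tropical source = is_tropical Γ;
  cproj_harmonic : harmonic_of_degree #|gT| cproj;
  cact_isometry : forall a p q, gdist (cact p a) (cact q a) = gdist p q;
  cact_proj : forall a p, cproj (cact p a) = cproj p;
  cact_transitive : forall p q, cproj p = cproj q -> exists a, cact p a = q
}.

Variable Γ : curve R.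
Implicit Types phi psi : harmonicCover Γ.

Definition cover_iso phi psi : Prop :=
  exists F : source phi -> source psi,
    [/\ bijective F,
        forall p q, gdist (F p) (F q) = gdist p q,
        forall a p, F (cact phi p a) = cact psi (F p) a &
        forall p, cproj (F p) = cproj p].

Definition has_dilation (D : Γ -> {group gT}) phi : Prop :=
  forall (p : source phi) (a : gT), cact phi p a = p <-> a \in D (cproj p).

(* [Theta] induces a bijection from the set of isomorphism classes of the
   covers with dilation datum [D] to [H].  This is not phrased with sets of
   covers because these would force the carriers of metric graphs into a
   universe strictly below the one of the finite types of the library. *)
Definition bijective_on_classes (D : Γ -> {group gT}) (T : Type) (H : set T)
    (Theta : harmonicCover Γ -> T) : Prop :=
  [/\ forall phi, has_dilation D phi -> H (Theta phi),
      forall phi psi, has_dilation D phi -> has_dilation D psi ->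
        (Theta phi = Theta psi <-> cover_iso phi psi) &
      forall K, H K -> exists2 phi, has_dilation D phi & Theta phi = K].

End Covers.

(** * Sheaf cohomology *)

(* All the sheaves considered below are sheaves of functions on [Γ] with
   values in [{set gT}], more precisely in the cosets of a subgroup that
   depends on the point; cosets are multiplied and inverted setwise.  [F U]
   is the set of sections over the open set [U]; two sections over [U] are
   the same when they agree on [U], the values outside of [U] being
   irrelevant.  The first cohomology group is defined as the direct limit of
   the Cech groups over all open covers, which in degree 1 is the derived
   functor cohomology on any topological space.  As usual (Godement, II.5.8),
   the limit is taken over the cofinal system of the covers [(U_p)] indexed by
   the points, with [p] in [U_p], where [(W_p)] refines [(U_p)] if [W_p] is
   contained in [U_p] for all [p]. *)
Section Cech.
Variables (R : realType) (gT : finGroupType) (Γ : metricGraph R).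
Variable F : set Γ -> set (Γ -> {set gT}).
Local Open Scope group_scope.

Record cochain := Cochain {
  open_of : Γ -> set Γ;
  value : Γ -> Γ -> Γ -> {set gT}
}.

Definition open_cover (U : Γ -> set Γ) : Prop :=
  forall x, metric_open (U x) /\ U x x.

Definition cocycle (z : cochain) : Prop :=
  [/\ open_cover (open_of z),
      forall x y, F (open_of z x `&` open_of z y) (value z x y) &
      forall x y t p, open_of z x p -> open_of z y p -> open_of z t p ->
        value z x y p * value z y t p = value z x t p].

(* The restrictions of the two cocycles to some common refinement [W] differ
   by the coboundary of [u]. *)
Definition cohomologous (z w : cochain) : Prop :=
  exists (W : Γ -> set Γ) (u : Γ -> Γ -> {set gT}),
    [/\ open_cover W,
        forall x, W x `<=` open_of z x `&` open_of w x,
        forall x, F (W x) (u x) &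
        forall x y p, W x p -> W y p ->
          value w x y p = value z x y p * (u y p * (u x p)^-1)].

Definition cohomology_class (z : cochain) : set cochain :=
  [set w | cocycle w /\ cohomologous z w].

Definition cech_H1 : set (set cochain) :=
  [set K | exists2 z, cocycle z & K = cohomology_class z].

End Cech.

(** * The codilation sheaf *)

Section Codilation.
Variables (R : realType) (gT : finGroupType) (Γ : metricGraph R).
Variables (M : modelOf Γ) (D : Γ -> {group gT}).
Local Open Scope group_scope.

Definition root_dil (x : M) : {group gT} := D (par (root_of x) 0%R).

Definition codil (x : M) : {group gT} :=
  if is_edge_half x then (root_dil x <*> root_dil (flip_of x))%G else root_dil x.

(* A section assigns to each point [p] of [U] an element of the stalk, the
   quotient by [codil (cell_at M p)], and is locally the class of a constant.
   Hence the sections over a connected neighbourhood of a vertex [v] within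
   the star of [v] form the quotient by [codil v], and those over a nonempty
   connected open subset of an open edge or leg [x] the quotient by
   [codil x]; the restriction maps are the quotient maps. *)
Definition codilation_sheaf (U : set Γ) : set (Γ -> {set gT}) :=
  [set s | forall p, U p -> exists (W : set Γ) (a : gT),
     [/\ metric_open W, W p &
         forall q, W q -> U q -> s q = a *: codil (cell_at M q)]].

(* The open star [U_v] of a vertex and the interior [U_l] of a leg.  The two
   disjuncts are for the two half-edges of an edge. *)
Definition open_star (i : M) : set Γ :=
  [set p | if is_vertex i
           then root_of (cell_at M p) = i \/ root_of (flip_of (cell_at M p)) = i
           else cell_at M p = i].

Variables (o : {set M}) (g : M -> gT).

(* The value on the cell [x] of the cocycle given by the tuple [g], on the
   overlap of the stars of [i] and [j]: it is [g e] if [e] is an edge from [i]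
   to [j], its inverse if [e] goes from [j] to [i], and trivial on legs. *)
Definition tuple_value (i j x : M) : gT :=
  if is_edge_half x then
    let e := if x \in o then x else flip_of x in
    if (root_of e == i) && (root_of (flip_of e) == j) then g e
    else if (root_of e == j) && (root_of (flip_of e) == i) then (g e)^-1
    else 1
  else 1.

(* The cover by the sets [U_v] and [U_l], indexed by the points of [Γ]: a
   point of a leg [l] is assigned [U_l], a vertex [v] is assigned [U_v], and
   a point inside an edge is assigned one of the two stars containing it. *)
Definition star_index (p : Γ) : M :=
  if is_leg (cell_at M p) then cell_at M p else root_of (cell_at M p).

Definition tuple_cochain : cochain gT Γ :=
  Cochain (fun x => open_star (star_index x))
    (fun x y p =>
       tuple_value (star_index x) (star_index y) (cell_at M p)
         *: codil (cell_at M p)).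

Definition tuple_class : set (cochain gT Γ) :=
  cohomology_class codilation_sheaf tuple_cochain.

End Codilation.

(** * The assignment *)

(* [assigned phi o g]: the tuple [(g h)], indexed by the oriented edges [h] of
   the model [M], represents the tuple obtained from [phi] for some model
   [f] of [phi] over [M] and some choices of [v0], [e0], [a], [b]; the edge
   [e0] over [h] is represented by its half-edge lying over [h].  A harmonic
   morphism of tropical curves being one of the underlying metric graphs, [M']
   is a model of the metric graph underlying [source phi]. *)
Definition assigned (R : realType) (gT : finGroupType) (Γ : curve R)
    (M : modelOf Γ) (phi : harmonicCover gT Γ) (o : {set M}) (g : M -> gT) : Prop :=
  exists (M' : modelOf (source phi)) (f : M' -> M) (d : M' -> nat)
         (v0 e0 : M -> M') (a b : M -> gT),
    [/\ morphism_model f d (@cproj _ _ _ phi),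
        forall v, is_vertex v -> f (v0 v) = v,
        forall h, h \in o -> f (e0 h) = h,
        forall h, h \in o ->
          cact phi (par (v0 (root_of h)) 0) (a h) = par (root_of (e0 h)) 0 /\
          cact phi (par (v0 (root_of (flip_of h))) 0) (b h) =
            par (root_of (flip_of (e0 h))) 0 &
        forall h, h \in o -> g h = (b h * (a h)^-1)%g].

(* Main.v *)
Require Import Defs.
From mathcomp Require Import all_boot all_order all_algebra all_fingroup.
From mathcomp Require Import all_classical all_reals ereal.
From mathcomp Require Import lra.

(** Let [M] be the given model.  A cover with dilation datum [D] can be cut over
    [M]: each closed edge or leg lifts to the cover, all its lifts are
    translates of one of them, and the cover is recovered by gluing these lifts
    at the vertices.  A [framing] is a choice of lifts of the vertices, edges
    and legs; it yields gluing elements [eta h], the position of the end of the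
    lift of a half-edge [h] with respect to the chosen vertex.  The quotient of
    the gluing elements of the two halves of an edge is the element of the
    tuple assigned to the cover.  Hence the classification has four parts.

    - Every cover has a framing ([framing_exists]), and covers with the same
      gluing elements are isomorphic ([framing_iso]).
    - Changing the framing of a cover changes the tuple exactly by the relation
      [tuple_equiv] that defines the cohomology group in terms of tuples
      ([framings_equiv], [framing_change]).
    - All gluing elements occur ([standard_cover]): the points of the cover are
      the pairs of a point [p] and a coset of [D p], and the gluing elements
      define its metric.
    - The Cech cohomology of the codilation sheaf is the group of tuples modulo
      [tuple_equiv]: equivalent tuples and only they give cohomologous cochains
      ([tuple_equiv_cohomologous], [cohomologous_tuple_equiv]), and every
      cocycle is cohomologous to the cochain of a tuple, because the torsor it
      defines is trivial over the star of each vertex ([cocycle_tuple]).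

    The definition of a cover involves a model of the projection which need not
    be related to [M].  The proof extracts from it only two local facts, in
    which the model no longer appears: the projection multiplies small distances
    from a point by the order of the stabilizer of the other point
    ([cover_slope]), and nearby points lift without increasing the distance
    ([cover_lift]).  The first one holds because the global degree is the order
    of the group.  Together with the fact that distances are lengths of paths
    they show that a continuous equivariant map over the base is an isometry
    ([equivariant_iso]), and that paths lift ([cell_lift_exists]).  Path lifting
    and the triviality of torsors on open cells are both instances of one
    patching lemma for locally constant torsors on an interval
    ([global_section]). *)

Set Implicit Arguments.
Unset Strict Implicit.
Unset Printing Implicit Defensive.

Import Order.TTheory GRing.Theory Num.Theory.
Local Open Scope classical_set_scope.
Local Open Scope ring_scope.

(** * Continuous induction *)

(** Continuous induction: a property of subintervals which is additive and
    holds for all short intervals at each point holds for the whole interval,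
    because the supremum of the points reached from [a] is reached and cannot
    lie before [b].  It replaces compactness in all local-to-global arguments
    below. *)
Lemma interval_ind (R : realType) (P : R -> R -> Prop) (a b : R) :
  a <= b ->
  (forall s t u, a <= s -> s <= t -> t <= u -> u <= b ->
     P s t -> P t u -> P s u) ->
  (forall t, a <= t <= b -> exists2 e : R, 0 < e &
     forall s, a <= s <= b -> `|s - t| < e ->
       (s <= t -> P s t) /\ (t <= s -> P t s)) ->
  P a b.
Proof.
move=> ab Padd Ploc.
pose S := [set s | a <= s <= b /\ P a s].
have Sa : S a.
  have [|e e0 he] := Ploc a; first by rewrite lexx.
  split; first by rewrite lexx.
  by have [||/(_ (lexx a))//] := he a; rewrite ?lexx ?subrr ?normr0.
have hS : has_sup S.
  by split; [exists a | exists b => s [/andP[]]].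
have ac : a <= sup S by exact: ub_le_sup hS.2 _ Sa.
have cb : sup S <= b by apply: ge_sup; [exists a | move=> s [/andP[]]].
have [|e e0 he] := Ploc (sup S); first by rewrite ac.
have [s [/andP[as_ sb] Pas] cs] := sup_adherent e0 hS.
have sc : s <= sup S by apply: ub_le_sup hS.2 _ _; split=> //; rewrite as_.
have Pac : P a (sup S).
  have [||/(_ sc) Psc _] := he s; first by rewrite as_.
    by rewrite distrC ger0_norm ?subr_ge0//; lra.
  exact: Padd Pas Psc.
have [bc|cb'] := leP b (sup S).
  by have -> : b = sup S by apply/eqP; rewrite eq_le bc cb.
pose s' := Num.min b (sup S + e / 2).
have s'b : s' <= b by rewrite ge_min lexx.
have cs' : sup S < s' by rewrite lt_min cb' /=; lra.
have s'e : s' <= sup S + e / 2 by rewrite ge_min lexx orbT.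
have [||_ /(_ (ltW cs')) Pcs'] := he s'.
- by rewrite s'b andbT; lra.
- by rewrite ger0_norm ?subr_ge0 ?ltW//; lra.
have : s' <= sup S.
  apply: ub_le_sup hS.2 _ _; split; first by rewrite s'b andbT; lra.
  by apply: Padd Pac Pcs' => //; lra.
by lra.
Qed.

Lemma finite_radius (R : realType) (T : finType) (P : T -> R -> Prop) :
  (forall i e e', 0 < e' -> e' <= e -> P i e -> P i e') ->
  (forall i, exists2 e : R, 0 < e & P i e) ->
  exists2 e : R, 0 < e & forall i, P i e.
Proof.
move=> Pmono Pex.
suff [e e0 he] : exists2 e : R, 0 < e & forall i, i \in enum T -> P i e.
  by exists e => // i; apply: he; rewrite mem_enum.
elim: (enum T) => [|i s [e e0 he]]; first by exists 1.
have [e' e'0 he'] := Pex i.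
have m0 : 0 < Num.min e e' by rewrite lt_min e0.
exists (Num.min e e') => // j; rewrite inE => /orP[/eqP->|/he].
  by apply: Pmono he' => //; rewrite ge_min lexx orbT.
by apply: Pmono => //; rewrite ge_min lexx.
Qed.

(** * Short walks in a model *)

Section Cells.
Variable G : graph.
Implicit Types x h v : G.

Lemma vertex_root x : is_vertex (root_of x).
Proof. by rewrite /is_vertex rootK. Qed.

Lemma root_vertex v : is_vertex v -> root_of v = v.
Proof. by move/eqP. Qed.

Lemma flip_vertex v : is_vertex v -> flip_of v = v.
Proof. by move/eqP <-; rewrite flip_root. Qed.

Lemma is_vertex_flip x : is_vertex (flip_of x) = is_vertex x.
Proof.
by apply/idP/idP => vx; have := flip_vertex vx; rewrite ?flipK => e;
   [rewrite e | rewrite e].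
Qed.

Lemma is_edge_half_flip x : is_edge_half (flip_of x) = is_edge_half x.
Proof.
by rewrite /is_edge_half is_vertex_flip flipK eq_sym.
Qed.

Lemma is_leg_flip x : is_leg x -> flip_of x = x.
Proof. by case/andP => _ /eqP. Qed.

Lemma edge_nvertex x : is_edge_half x -> is_vertex x = false.
Proof. by case/andP => /negbTE. Qed.

Lemma edge_nleg x : is_edge_half x -> is_leg x = false.
Proof. by case/andP => + /negbTE h; rewrite /is_leg h andbF. Qed.

Lemma leg_nvertex x : is_leg x -> is_vertex x = false.
Proof. by case/andP => /negbTE. Qed.

Lemma leg_nedge x : is_leg x -> is_edge_half x = false.
Proof. by case/andP => + h; rewrite /is_edge_half h andbF. Qed.

Lemma nvertexE x : ~~ is_vertex x -> is_edge_half x \/ is_leg x.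
Proof.
by rewrite /is_edge_half /is_leg => ->; case: eqP; [right | left].
Qed.

Lemma edge_flip_neq x : is_edge_half x -> x = flip_of x -> False.
Proof. by case/andP => _ /eqP h e; apply: h. Qed.

Section Orientation.
Variable o : {set G}.
Hypothesis oo : orientation o.

Lemma edge_orient h : is_edge_half h -> (h \in o) = ~~ (flip_of h \in o).
Proof. by case: oo => _ /(_ h) + eh => /(_ eh); case: (h \in o); case: (_ \in o). Qed.

Lemma orient_edge h : h \in o -> is_edge_half h.
Proof. by case: oo => + _; apply. Qed.
End Orientation.
End Cells.

Section Walks.
Variables (R : realType) (T : Type) (gd : T -> T -> \bar R) (M : model gd).
Implicit Types (x y h v : M) (p q : T) (s t L : R).
Local Notation cdom := (closed_dom (@len _ _ _ M)).
Local Notation idom := (inner_dom (@len _ _ _ M)).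
Local Notation walk := (walk (@len _ _ _ M) (@par _ _ _ M)).

Lemma cdom_vertex v t : is_vertex v -> cdom v t <-> t = 0.
Proof. by rewrite /closed_dom => ->. Qed.

Lemma cdom_edge h t : is_edge_half h -> cdom h t <-> 0 <= t <= len h.
Proof. by move=> e; rewrite /closed_dom edge_nvertex// edge_nleg. Qed.

Lemma cdom_leg h t : is_leg h -> cdom h t <-> 0 <= t.
Proof. by move=> e; rewrite /closed_dom leg_nvertex// e. Qed.

Lemma idom_vertex v t : is_vertex v -> idom v t <-> t = 0.
Proof. by rewrite /inner_dom => ->. Qed.

Lemma idom_edge h t : is_edge_half h -> idom h t <-> 0 < t < len h.
Proof. by move=> e; rewrite /inner_dom edge_nvertex// edge_nleg. Qed.

Lemma idom_leg h t : is_leg h -> idom h t <-> 0 < t.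
Proof. by move=> e; rewrite /inner_dom leg_nvertex// e. Qed.

Lemma idom_cdom x t : idom x t -> cdom x t.
Proof.
rewrite /closed_dom /inner_dom; case: ifP => // _; case: ifP => _; first exact: ltW.
by case/andP => /ltW-> /ltW->.
Qed.

Lemma cdom_ge0 x t : cdom x t -> 0 <= t.
Proof.
by rewrite /closed_dom; case: ifP => [_ ->//|_]; case: ifP => // _ /andP[].
Qed.

Lemma cdom0 x : cdom x 0.
Proof.
have [v|/nvertexE[e|l]] := boolP (is_vertex x).
- exact/cdom_vertex.
- by apply/cdom_edge => //; rewrite lexx ltW// len_gt0.
- exact/cdom_leg.
Qed.

Lemma idom_gt0 x t : ~~ is_vertex x -> idom x t -> 0 < t.
Proof.
by rewrite /inner_dom => /negbTE->; case: ifP => // _ /andP[].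
Qed.

Lemma cdom_convex x s t u : cdom x s -> cdom x t -> s <= u <= t -> cdom x u.
Proof.
move=> + + /andP[]; rewrite /closed_dom; case: ifP => [_ -> ->|_].
  by move=> ? ?; apply/eqP; rewrite eq_le; apply/andP.
case: ifP => _; first by move=> *; lra.
by move=> /andP[? ?] /andP[? ?] ? ?; apply/andP; split; lra.
Qed.

Lemma idom_convex x s t u : idom x s -> idom x t -> s <= u <= t -> idom x u.
Proof.
move=> + + /andP[]; rewrite /inner_dom; case: ifP => [_ -> ->|_].
  by move=> ? ?; apply/eqP; rewrite eq_le; apply/andP.
case: ifP => _; first by move=> *; lra.
by move=> /andP[? ?] /andP[? ?] ? ?; apply/andP; split; lra.
Qed.

Lemma idom_open x t : ~~ is_vertex x -> idom x t ->
  exists2 e : R, 0 < e & forall s, `|s - t| < e -> idom x s.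
Proof.
case/nvertexE => [e|l].
  rewrite idom_edge// => /andP[t0 tl].
  exists (Num.min t (len x - t)); first by rewrite lt_min t0; lra.
  move=> s; rewrite lt_min ltr_norml ltr_norml => /andP[/andP[? ?] /andP[? ?]].
  by rewrite idom_edge//; apply/andP; split; lra.
rewrite idom_leg// => t0; exists t => // s; rewrite ltr_norml => /andP[? ?].
by rewrite idom_leg//; lra.
Qed.

Lemma cdom_flip h t : is_edge_half h -> cdom h t -> cdom (flip_of h) (len h - t).
Proof.
move=> e; rewrite !cdom_edge ?is_edge_half_flip// len_flip => /andP[? ?].
by apply/andP; split; lra.
Qed.

Lemma idom_flip h t : is_edge_half h -> idom h t -> idom (flip_of h) (len h - t).
Proof.
move=> e; rewrite !idom_edge ?is_edge_half_flip// len_flip => /andP[? ?].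
by apply/andP; split; lra.
Qed.

Lemma par_flip_closed h t : is_edge_half h -> cdom h t ->
  par (flip_of h) (len h - t) = par h t.
Proof. by move=> e /cdom_edge -/(_ e); exact: par_flip. Qed.

Lemma cdomP x t : cdom x t ->
  [\/ idom x t, ~~ is_vertex x /\ t = 0 | is_edge_half x /\ t = len x].
Proof.
have [v|/nvertexE[e|l]] := boolP (is_vertex x).
- by rewrite cdom_vertex// => ?; apply: Or31; apply/idom_vertex.
- rewrite cdom_edge// => /andP[t0 tl].
  have [->|tn0] := eqVneq t 0; first exact: Or32.
  have [->|tnl] := eqVneq t (len x); first by apply: Or33.
  by apply: Or31; apply/idom_edge => //; rewrite !lt_neqAle t0 tl tnl eq_sym tn0.
- rewrite cdom_leg// => t0; have [->|tn0] := eqVneq t 0.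
    exact: Or32.
  by apply: Or31; apply/idom_leg => //; rewrite lt_neqAle t0 eq_sym tn0.
Qed.

Lemma par_end h : is_edge_half h -> par h (len h) = par (root_of (flip_of h)) 0.
Proof.
move=> e; rewrite -par_root -(par_flip_closed e) ?subrr//.
by apply/cdom_edge; rewrite // lexx andbT ltW// len_gt0.
Qed.

Lemma par_vertex_inj v w : is_vertex v -> is_vertex w ->
  par v 0 = par w 0 -> v = w.
Proof.
move=> vv vw /par_inj; case; try exact/idom_vertex; first by case.
  case=> e.
by rewrite edge_nvertex in vv.
Qed.

Lemma par_vertex_eq x s v : cdom x s -> is_vertex v -> par x s = par v 0 ->
  (root_of x = v /\ s = 0) \/ [/\ is_edge_half x, root_of (flip_of x) = v & s = len x].
Proof.
move=> cs vv pv; case: (cdomP cs) => [ix|[_ sE]|[ex sE]].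
- have [|[xv sE]|[ex + _]] := par_inj ix _ pv; first exact/idom_vertex.
    by left; rewrite xv root_vertex.
  by move=> vE; rewrite vE is_vertex_flip edge_nvertex in vv.
- left; split=> //; apply: par_vertex_inj => //; first exact: vertex_root.
  by rewrite -par_root -pv sE.
- right; split=> //; apply: par_vertex_inj => //; first exact: vertex_root.
  by rewrite -par_end// -sE.
Qed.

Lemma par_inner_eq x s h t : cdom x s -> ~~ is_vertex h -> idom h t ->
  par x s = par h t ->
  (x = h /\ s = t) \/ [/\ is_edge_half x, h = flip_of x & t = len x - s].
Proof.
move=> cs nh ih e.
have nv v : is_vertex v -> par v 0 = par h t -> False.
  move=> vv /esym e0; have [|[hv]|[eh vE _]] := par_inj ih _ e0; first exact/idom_vertex.
    by rewrite hv vv in nh.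
  by rewrite vE is_vertex_flip edge_nvertex in vv.
case: (cdomP cs) => [ix|[_ sE]|[ex sE]]; first exact: par_inj ix ih e.
- by case: (nv (root_of x) (vertex_root x)); rewrite -par_root -e sE.
- by case: (nv _ (vertex_root (flip_of x))); rewrite -e sE par_end.
Qed.

Lemma walk_cat p q r L L' : walk p q L -> walk q r L' -> walk p r (L + L').
Proof.
move=> pq; elim=> [|x s t {}L' _ IH cs ct]; first by rewrite addr0.
by rewrite addrA; apply: walk_step.
Qed.

Lemma walk1 x s t : cdom x s -> cdom x t -> walk (par x s) (par x t) `|t - s|.
Proof. by move=> ? ?; rewrite -[`|_|]add0r; apply: walk_step => //; apply: walk_nil. Qed.

Lemma walk_sym p q L : walk p q L -> walk q p L.
Proof.
elim=> [|x s t L' _ IH cs ct]; first exact: walk_nil.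
by rewrite addrC; apply: walk_cat IH; rewrite distrC; exact: walk1.
Qed.

Lemma walk_ge0 p q L : walk p q L -> 0 <= L.
Proof. by elim=> // *; rewrite addr_ge0. Qed.

Lemma gd_le p q L : walk p q L -> (gd p q <= L%:E)%E.
Proof.
by move=> w; rewrite (par_dist M); apply: ereal_inf_lbound; exists L.
Qed.

Lemma gd_lt p q e : (gd p q < e)%E -> exists2 L, walk p q L & (L%:E < e)%E.
Proof.
rewrite (par_dist M) => /ereal_inf_lt[_ [L w <-] lt].
by exists L.
Qed.

Lemma gd_ge p q e : (forall L, walk p q L -> (e <= L%:E)%E) -> (e <= gd p q)%E.
Proof.
by move=> h; rewrite (par_dist M); apply: le_ereal_inf_tmp => _ [L /h + <-].
Qed.

Lemma gd_ge0 p q : (0 <= gd p q)%E.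
Proof. by apply: gd_ge => L /walk_ge0; rewrite lee_fin. Qed.

Lemma gd_refl p : gd p p = 0%E.
Proof.
apply/eqP; rewrite eq_le gd_ge0 andbT; apply: gd_le; exact: walk_nil.
Qed.

Lemma gd_sym p q : gd p q = gd q p.
Proof.
by apply/eqP; rewrite eq_le; apply/andP; split; apply: gd_ge => L /walk_sym;
  exact: gd_le.
Qed.

Lemma gd_triangle p q r : (gd p r <= gd p q + gd q r)%E.
Proof.
have [pq|] := ltP (gd p q) +oo%E; last first.
  by rewrite leye_eq => /eqP ->; rewrite addye ?leey// gt_eqF// (lt_le_trans _ (gd_ge0 _ _))// ltNy0.
rewrite -leeBlDl ?fin_numElt; last by rewrite pq (lt_le_trans _ (gd_ge0 _ _))// ltNy0.
apply: gd_ge => L wL; rewrite leeBlDr ?fin_numElt; last first.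
  by rewrite pq (lt_le_trans _ (gd_ge0 _ _))// ltNy0.
rewrite -leeBlDl//; apply: gd_ge => L' wL'; rewrite leeBlDl// addeC -EFinD.
by apply: gd_le; apply: walk_cat wL' wL.
Qed.

Lemma gd_cell x s t : cdom x s -> cdom x t ->
  (gd (par x s) (par x t) <= `|t - s|%:E)%E.
Proof. by move=> ? ?; apply: gd_le; exact: walk1. Qed.

Lemma mesh : exists2 r : R, 0 < r & forall h, is_edge_half h -> 2 * r <= len h.
Proof.
apply: (@finite_radius _ M (fun h r => is_edge_half h -> 2 * r <= len h)).
  by move=> i e e' ? ? + h => /(_ h); lra.
move=> h; have [e|] := boolP (is_edge_half h); last by exists 1.
by exists (len h / 2) => [|_]; [rewrite divr_gt0// len_gt0 | lra].
Qed.

(** Below half of the shortest edge length, a walk that leaves [v] has not yet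
    had the length to traverse an edge, so it can only change cells by coming
    back to [v]. *)
Lemma walk_vertex r v q L : (forall h, is_edge_half h -> 2 * r <= len h) ->
  is_vertex v -> walk (par v 0) q L -> L < r ->
  exists h s, [/\ root_of h = v, cdom h s, s <= L & q = par h s].
Proof.
move=> hr vv w; elim: w => [|x s t L' w IH cs ct] Lr.
  by exists v, 0; split; rewrite ?root_vertex//; exact: cdom0.
have L'0 := walk_ge0 w.
have [|h [s0 [rh ch s0L e]]] := IH; first by have := normr_ge0 (t - s); lra.
have s00 := cdom_ge0 ch.
(* up to reversing [x], the step starts on [h] at [s0] or leaves from [v] *)
suff step y s' t' : cdom y s' -> cdom y t' -> `|t' - s'| = `|t - s| ->
    par y t' = par x t -> (y = h /\ s' = s0) \/ (root_of y = v /\ s' = 0) ->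
    exists h s1, [/\ root_of h = v, cdom h s1, s1 <= L' + `|t - s| & par x t = par h s1].
  have step_flip : is_edge_half x ->
      (flip_of x = h /\ len x - s = s0) \/ (root_of (flip_of x) = v /\ len x - s = 0) ->
      exists h s1, [/\ root_of h = v, cdom h s1, s1 <= L' + `|t - s| & par x t = par h s1].
    move=> ex; apply: (step _ _ (len x - t)); try exact: cdom_flip.
      by rewrite (_ : len x - t - _ = s - t) 1?distrC//; lra.
    exact: par_flip_closed.
  have at_v : par x s = par v 0 -> exists h s1,
      [/\ root_of h = v, cdom h s1, s1 <= L' + `|t - s| & par x t = par h s1].
    case/(par_vertex_eq cs vv) => [[rx sE]|[ex rx sE]].
      by apply: (step x s t) => //; right.
    by apply: step_flip => //; right; split=> //; lra.
  case: (cdomP ch) => [ih|[nv s0e]|[eh s0e]]; last first.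
  - by have := hr _ eh; have := normr_ge0 (t - s); lra.
  - by apply: at_v; rewrite e s0e par_root rh.
  have [vh|nh] := boolP (is_vertex h).
    by apply: at_v; rewrite e (iffLR (idom_vertex _ vh) ih) -rh root_vertex.
  have [[xh sE]|[ex hE sE]] := par_inner_eq cs nh ih e.
    by apply: (step x s t) => //; left.
  by apply: step_flip => //; left.
move=> cs' ct' nE pE H; exists y, t'; split=> //.
  by case: H => [[->]|[]].
by have := ler_norm (t' - s'); case: H => -[_ ?]; lra.
Qed.

Lemma walk_inner r x t q L : ~~ is_vertex x -> idom x t ->
  (forall s, `|s - t| < r -> idom x s) ->
  walk (par x t) q L -> L < r -> exists2 s, `|s - t| <= L & q = par x s.
Proof.
move=> nx ix hr w; elim: w => [|y s u L' w IH cs cu] Lr.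
  by exists t; rewrite ?subrr ?normr0.
have us := normr_ge0 (u - s).
have [|s0 s0L e] := IH; first by lra.
have is0 : idom x s0 by apply: hr; lra.
have [[yx sE]|[ey xE s0E]] := par_inner_eq cs nx is0 e.
  exists u; last by rewrite yx.
  by rewrite -sE in s0L; have := ler_distD s u t; lra.
exists (len y - u); last by rewrite xE par_flip_closed.
have -> : len y - u - t = (s - u) + (s0 - t) by lra.
by have := ler_normD (s - u) (s0 - t); rewrite (distrC s u); lra.
Qed.

(* A point of a loop is reached from both ends; the factor 2 makes the way from
   the nearer end the one of length [s]. *)
Lemma vertex_dist r h s : (forall h, is_edge_half h -> 2 * r <= len h) ->
  cdom h s -> s < r -> gd (par (root_of h) 0) (par h s) = s%:E.
Proof.
move=> hr ch sr; have s0 := cdom_ge0 ch.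
apply/eqP; rewrite eq_le; apply/andP; split.
  by rewrite -par_root (le_trans (gd_cell (cdom0 h) ch))// subr0 ger0_norm.
apply: gd_ge => L w; rewrite lee_fin leNgt; apply/negP => Ls.
have [|h' [s' [rh' ch' s'L e]]] := walk_vertex hr (vertex_root h) w; first by lra.
have s'0 := cdom_ge0 ch'.
have [vh|nh] := boolP (is_vertex h).
  by have := iffLR (cdom_vertex _ vh) ch; have := walk_ge0 w; lra.
case: (cdomP ch) => [ih|[_ ?]|[eh ?]]; last 2 first.
- by have := walk_ge0 w; lra.
- by have := hr _ eh; lra.
have [[_ ?]|[eh' _ ?]] := par_inner_eq ch' nh ih (esym e); first by lra.
by have := hr _ eh'; lra.
Qed.

Lemma vertex_ball r v q : (forall h, is_edge_half h -> 2 * r <= len h) ->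
  is_vertex v -> (gd (par v 0) q < r%:E)%E ->
  exists h s, [/\ root_of h = v, cdom h s, s < r, q = par h s & gd (par v 0) q = s%:E].
Proof.
move=> hr vv /gd_lt[L w]; rewrite lte_fin => Lr.
have [h [s [rh ch sL e]]] := walk_vertex hr vv w Lr.
exists h, s; split=> //; first by lra.
by rewrite e -rh; apply: vertex_dist hr ch _; lra.
Qed.

Lemma inner_dist r x t s : ~~ is_vertex x -> idom x t ->
  (forall s, `|s - t| < r -> idom x s) ->
  `|s - t| < r -> gd (par x t) (par x s) = `|s - t|%:E.
Proof.
move=> nx ix hr sr; have is_ := hr _ sr.
apply/eqP; rewrite eq_le; apply/andP; split.
  by apply: gd_cell; exact: idom_cdom.
apply: gd_ge => L w; rewrite lee_fin leNgt; apply/negP => Ls.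
have [|s' s'L e] := walk_inner nx ix hr w; first by lra.
have is' : idom x s' by apply: hr; lra.
have [[_ E]|[ex xE _]] := par_inj is_ is' e; first by rewrite E in Ls; lra.
exact: edge_flip_neq xE.
Qed.

Lemma inner_ball r x t q : ~~ is_vertex x -> idom x t ->
  (forall s, `|s - t| < r -> idom x s) ->
  (gd (par x t) q < r%:E)%E ->
  exists s, [/\ `|s - t| < r, q = par x s & gd (par x t) q = `|s - t|%:E].
Proof.
move=> nx ix hr /gd_lt[L w]; rewrite lte_fin => Lr.
have [s sL e] := walk_inner nx ix hr w Lr.
by exists s; split=> //; [lra | rewrite e; apply: inner_dist hr _ => //; lra].
Qed.

Lemma pointP p : (exists2 v : M, is_vertex v & p = par v 0) \/
  (exists (x : M) t, [/\ ~~ is_vertex x, idom x t & p = par x t]).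
Proof.
have [x [t [ix <-]]] := par_surj M p.
have [vx|nx] := boolP (is_vertex x); last by right; exists x, t.
by left; exists x; rewrite ?(iffLR (idom_vertex _ vx) ix).
Qed.

Lemma gd_eq0 p q : gd p q = 0%E -> p = q.
Proof.
case: (pointP p) => [[v vv ->]|[x [t [nx ix ->]]]] d0.
  have [r r0 hr] := mesh.
  have [|h [s [rh ch sr qE ds]]] := vertex_ball (q := q) hr vv.
    by rewrite d0 lte_fin.
  by rewrite d0 in ds; case: ds => s0; rewrite qE -s0 -rh -par_root.
have [r r0 hr] := idom_open nx ix.
have [|s [sr qE ds]] := inner_ball (q := q) nx ix hr.
  by rewrite d0 lte_fin.
by rewrite d0 in ds; case: ds => /esym/eqP; rewrite normr_eq0 subr_eq0 qE => /eqP ->.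
Qed.

End Walks.

(** * The path distance as a length distance *)

Section MetricSpace.
Variables (R : realType) (X : metricGraph R).
Implicit Types p q r : X.

Lemma gdist_ge0 p q : (0 <= gdist p q)%E.
Proof. by have [M] := has_model X; exact: gd_ge0 M p q. Qed.

Lemma gdist_refl p : gdist p p = 0%E.
Proof. by have [M] := has_model X; exact: gd_refl M p. Qed.

Lemma gdist_sym p q : gdist p q = gdist q p.
Proof. by have [M] := has_model X; exact: gd_sym M p q. Qed.

Lemma gdist_eq0 p q : gdist p q = 0%E -> p = q.
Proof. by have [M] := has_model X; exact: gd_eq0 M p q. Qed.

Lemma gdist_triangle p q r : (gdist p r <= gdist p q + gdist q r)%E.
Proof. by have [M] := has_model X; exact: gd_triangle M p q r. Qed.

Lemma gdist_le_trans p q r (a b c : R) : a + b <= c ->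
  (gdist p q <= a%:E)%E -> (gdist q r <= b%:E)%E -> (gdist p r <= c%:E)%E.
Proof.
move=> abc pq qr; apply: le_trans (gdist_triangle p q r) _.
by apply: (le_trans (leeD pq qr)); rewrite lee_fin.
Qed.

Lemma gdist_lt_trans p q r (a b c : R) : a + b <= c ->
  (gdist p q < a%:E)%E -> (gdist q r < b%:E)%E -> (gdist p r < c%:E)%E.
Proof.
move=> abc pq qr; apply: le_lt_trans (gdist_triangle p q r) _.
by apply: (lt_le_trans (lteD pq qr)); rewrite lee_fin.
Qed.

Lemma gdist_neq p q : p <> q -> exists2 e : R, 0 < e & (e%:E <= gdist p q)%E.
Proof.
move=> pq; have := gdist_ge0 p q; have := @gdist_eq0 p q.
case: (gdist p q) => [d| |] // d0 dge0.
  exists d => //; rewrite lt_neqAle eq_sym andbC -lee_fin dge0 /=.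
  by apply/eqP => dE; apply: pq; apply: d0; rewrite dE.
by exists 1; rewrite ?leey.
Qed.

Lemma gdist_sep (I : finType) (u : I -> X) p : exists2 e : R, 0 < e &
  forall i, (gdist p (u i) < e%:E)%E -> u i = p.
Proof.
apply: (@finite_radius R I (fun i e => (gdist p (u i) < e%:E)%E -> u i = p)).
  by move=> i e e' _ ee + pu; apply; apply: lt_le_trans pu _; rewrite lee_fin.
move=> i; have [->|/gdist_neq[e e0 pe]] := pselect (p = u i).
  by exists 1.
by exists e => // pe'; have := lt_le_trans pe' pe; rewrite ltxx.
Qed.

Lemma lipschitz_curve (c : R -> X) (a b : R) : a <= b ->
  (forall t, a <= t <= b -> exists2 e : R, 0 < e & forall s, a <= s <= b ->
     `|s - t| < e -> (gdist (c t) (c s) <= `|s - t|%:E)%E) ->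
  (gdist (c a) (c b) <= (b - a)%:E)%E.
Proof.
move=> ab loc; pose P s t := (gdist (c s) (c t) <= (t - s)%:E)%E.
apply: (@interval_ind R P) => //.
  by move=> s t u _ _ _ _; apply: gdist_le_trans; lra.
move=> t /loc[e e0 he]; exists e => // s sab st.
split=> le; have := he s sab st; last by rewrite ger0_norm ?subr_ge0.
by rewrite gdist_sym ler0_norm ?subr_le0// opprB.
Qed.

End MetricSpace.

(** Being 1-Lipschitz can be checked near each point, since distances are
    infima of lengths of walks and each step of a walk is an interval.  This is
    how local statements about covers become statements about the path
    distance without any comparison of models. *)
Lemma locally_lipschitz (R : realType) (X Y : metricGraph R) (F : X -> Y) :
  (forall p, exists2 e : R, 0 < e & forall q, (gdist p q < e%:E)%E ->
     (gdist (F p) (F q) <= gdist p q)%E) ->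
  forall p q, (gdist (F p) (F q) <= gdist p q)%E.
Proof.
move=> loc p q; have [M] := has_model X.
apply: (gd_ge (M := M)) => L; elim=> [|x s t {}L _ IH cs ct]; first by rewrite gdist_refl.
apply: gdist_le_trans (lexx _) IH _.
wlog st : s t cs ct / s <= t.
  move=> W; have [/W|/ltW/W] := leP s t; first exact.
  by rewrite gdist_sym distrC; apply.
rewrite ger0_norm ?subr_ge0//.
apply: (@lipschitz_curve _ _ (fun u => F (par x u))) => // u ust.
have cu := cdom_convex cs ct ust.
have [e e0 he] := loc (par x u); exists e => // w wst wu.
have le := gd_cell cu (cdom_convex cs ct wst).
apply: (le_trans (he _ _) le); apply: (le_lt_trans le).
by rewrite lte_fin.
Qed.

(** * Local form of a harmonic morphism *)

Section MorphismModel.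
Variables (R : realType) (Γ' Γ : metricGraph R) (phi : Γ' -> Γ).
Variables (M' : modelOf Γ') (M : modelOf Γ) (f : M' -> M) (d : M' -> nat).
Hypothesis mm : morphism_model f d phi.
Implicit Types x h v : M'.
Local Notation cdom' := (closed_dom (@len _ _ _ M')).
Local Notation cdom := (closed_dom (@len _ _ _ M)).
Local Notation idom' := (inner_dom (@len _ _ _ M')).
Local Notation idom := (inner_dom (@len _ _ _ M)).

Lemma deg_gt0 x : (0 : R) < (d x)%:R.
Proof. by case: mm => -[_ d0 _ _] _ _; rewrite ltr0n. Qed.

Lemma mor_root x : f (root_of x) = root_of (f x).
Proof. by case: mm => -[[]]. Qed.

Lemma mor_flip x : f (flip_of x) = flip_of (f x).
Proof. by case: mm => -[[]]. Qed.

Lemma deg_flip x : d (flip_of x) = d x.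
Proof. by case: mm => -[]. Qed.

Lemma mor_par x t : cdom' x t -> phi (par x t) = par (f x) ((d x)%:R * t).
Proof. by case: mm => _ _; exact. Qed.

Lemma mor_edge x : is_edge_half (f x) = is_edge_half x.
Proof.
case: mm => -[[fr ff fe fl] _ _ _] _ _.
have [vx|/nvertexE[ex|lx]] := boolP (is_vertex x).
- have vf : is_vertex (f x) by rewrite /is_vertex -fr (root_vertex vx).
  by rewrite /is_edge_half vf vx.
- by rewrite ex fe.
- by rewrite leg_nedge ?fl// leg_nedge.
Qed.

Lemma mor_leg x : is_leg (f x) = is_leg x.
Proof.
case: mm => -[[fr ff fe fl] _ _ _] _ _.
have [vx|/nvertexE[ex|lx]] := boolP (is_vertex x).
- have vf : is_vertex (f x) by rewrite /is_vertex -fr (root_vertex vx).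
  by rewrite /is_leg vf vx.
- by rewrite edge_nleg ?fe// edge_nleg.
- by rewrite lx fl.
Qed.

Lemma mor_vertex x : is_vertex (f x) = is_vertex x.
Proof.
have [vx|/nvertexE[ex|lx]] := boolP (is_vertex x).
- by rewrite /is_vertex -mor_root (root_vertex vx) eqxx.
- by rewrite edge_nvertex ?mor_edge// edge_nvertex.
- by rewrite leg_nvertex ?mor_leg// leg_nvertex.
Qed.

Lemma mor_len x : is_edge_half x -> len (f x) = (d x)%:R * len x.
Proof. by case: mm => _ + _; exact. Qed.

Lemma mor_idom x t : idom (f x) t <-> idom' x (t / (d x)%:R).
Proof.
have d0 := deg_gt0 x.
rewrite /inner_dom mor_vertex mor_leg; case: ifP => vx.
  split=> [->|/eqP]; first by rewrite mul0r.
  by rewrite mulf_eq0 invr_eq0 (gt_eqF d0) orbF => /eqP.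
case: ifP => lx; first by rewrite pmulr_lgt0 ?invr_gt0.
have ex : is_edge_half x.
  by case: (@nvertexE _ x) => [|//|]; rewrite ?vx// lx.
by rewrite mor_len// ltr_pdivrMr// (mulrC (len x)) pmulr_lgt0 ?invr_gt0.
Qed.

Lemma mor_cdom x t : cdom (f x) t <-> cdom' x (t / (d x)%:R).
Proof.
have d0 := deg_gt0 x.
rewrite /closed_dom mor_vertex mor_leg; case: ifP => vx.
  split=> [->|/eqP]; first by rewrite mul0r.
  by rewrite mulf_eq0 invr_eq0 (gt_eqF d0) orbF => /eqP.
case: ifP => lx; first by rewrite pmulr_lge0 ?invr_gt0.
have ex : is_edge_half x.
  by case: (@nvertexE _ x) => [|//|]; rewrite ?vx// lx.
by rewrite mor_len// ler_pdivrMr// (mulrC (len x)) pmulr_lge0 ?invr_gt0.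
Qed.

Lemma degK x (t : R) : (d x)%:R * t / (d x)%:R = t.
Proof. by rewrite mulrAC divff ?mul1r// gt_eqF// deg_gt0. Qed.

Lemma mor_par_div x t : cdom (f x) t -> phi (par x (t / (d x)%:R)) = par (f x) t.
Proof.
by move/mor_cdom/mor_par => ->; rewrite mulrC divfK// gt_eqF// deg_gt0.
Qed.

Lemma mor_fiber y t p' : idom y t -> phi p' = par y t ->
  exists2 x, f x = y & p' = par x (t / (d x)%:R).
Proof.
move=> iy pE; have [x [s [ix pE']]] := par_surj M' p'.
have i1 : idom (f x) ((d x)%:R * s) by apply/mor_idom; rewrite degK.
rewrite -pE' mor_par in pE; last exact: idom_cdom.
have [[xy st]|[ex yE tE]] := par_inj i1 iy pE.
  by exists x => //; rewrite -st degK.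
rewrite mor_edge in ex.
exists (flip_of x); first by rewrite mor_flip.
rewrite deg_flip tE mor_len// -mulrBr degK par_flip_closed //; exact: idom_cdom.
Qed.

Lemma inner_slope x t : ~~ is_vertex x -> idom' x t ->
  exists2 e : R, 0 < e & forall q', (gdist (par x t) q' < e%:E)%E -> exists s,
    [/\ q' = par x s, idom' x s, gdist (par x t) q' = `|s - t|%:E &
        gdist (phi (par x t)) (phi q') = ((d x)%:R * `|s - t|)%:E].
Proof.
move=> nx ix; have d0 := deg_gt0 x.
have [e1 e10 he1] := idom_open nx ix.
have nfx : ~~ is_vertex (f x) by rewrite mor_vertex.
have ifx : idom (f x) ((d x)%:R * t) by apply/mor_idom; rewrite degK.
have [e2 e20 he2] := idom_open nfx ifx.
exists (Num.min e1 (e2 / (d x)%:R)); first by rewrite lt_min e10 divr_gt0.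
move=> q' pq; have [|s [st -> ->]] := inner_ball nx ix (r := Num.min e1 (e2 / (d x)%:R)) _ pq.
  by move=> s st; apply: he1; apply: lt_le_trans st _; rewrite ge_min lexx.
have is' : idom' x s by apply: he1; apply: lt_le_trans st _; rewrite ge_min lexx.
exists s; split=> //; rewrite !mor_par; try exact: idom_cdom.
have e : `|(d x)%:R * s - (d x)%:R * t| = (d x)%:R * `|s - t|.
  by rewrite -mulrBr normrM (gtr0_norm d0).
rewrite -e; apply: inner_dist he2 _ => //.
by rewrite e mulrC -ltr_pdivlMr//; apply: lt_le_trans st _; rewrite ge_min lexx orbT.
Qed.

(* The radius is chosen so small that distances to a vertex are parameters of
   half-edges both in the source and, after multiplication by the degree, in
   the target. *)
Lemma vertex_slope : exists2 e : R, 0 < e & forall v, is_vertex v -> forall q',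
  (gdist (par v 0) q' < e%:E)%E -> exists h s,
    [/\ root_of h = v, s = 0 \/ idom' h s, q' = par h s, gdist (par v 0) q' = s%:E &
        gdist (phi (par v 0)) (phi q') = ((d h)%:R * s)%:E].
Proof.
have [r' r'0 hr'] := mesh M'; have [r r0 hr] := mesh M.
have [e e0 he] : exists2 e : R, 0 < e & forall h, (d h)%:R * e <= r.
  apply: (@finite_radius R M' (fun h e => (d h)%:R * e <= r)).
    by move=> h e e' _ ee; apply: le_trans; rewrite ler_pM2l// deg_gt0.
  move=> h; exists (r / (d h)%:R); first by rewrite divr_gt0// deg_gt0.
  by rewrite mulrC divfK// gt_eqF// deg_gt0.
exists (Num.min r' e); first by rewrite lt_min r'0.
move=> v vv q' vq.
have vq1 : (gdist (par v 0) q' < r'%:E)%E.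
  by apply: lt_le_trans vq _; rewrite lee_fin ge_min lexx.
have [h [s [rh ch sr qE ds]]] := vertex_ball hr' vv vq1.
exists h, s; split=> //.
  case: (cdomP ch) => [|[]|[eh sE]]; [by right | by left |].
  by move: vq1; rewrite ds lte_fin; have := hr' _ eh; lra.
rewrite qE -rh !mor_par//; last exact: cdom0.
have sd : (d h)%:R * s < r.
  apply: lt_le_trans (he h); rewrite ltr_pM2l ?deg_gt0//.
  by move: vq; rewrite ds lte_fin lt_min => /andP[].
rewrite mulr0 mor_root; apply: vertex_dist hr _ sd.
by apply/mor_cdom; rewrite degK.
Qed.

(** Openness: at a vertex, harmonicity provides a half-edge over each half-edge
    of the target because the degree of the vertex is positive; degrees are at
    least 1, so lifting does not increase distances. *)
Lemma mor_lift p' : exists2 e : R, 0 < e & forall q, (gdist (phi p') q < e%:E)%E ->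
  exists q', phi q' = q /\ (gdist p' q' <= gdist (phi p') q)%E.
Proof.
have shrink x (u : R) : 0 <= u -> u / (d x)%:R <= u.
  move=> u0; rewrite ler_pdivrMr ?deg_gt0// ler_peMr// ler1n.
  by have := deg_gt0 x; rewrite ltr0n.
case: (pointP M' p') => [[v' vv ->]|[x [t [nx ix ->]]]].
  have [r r0 hr] := mesh M; exists r => // q.
  rewrite mor_par; last exact: cdom0.
  rewrite mulr0 => vq; have vfv : is_vertex (f v') by rewrite mor_vertex.
  have [h [s [rh ch sr -> ->]]] := vertex_ball hr vfv vq.
  have s0 := cdom_ge0 ch.
  have [vh|nh] := boolP (is_vertex h).
    exists (par v' 0); rewrite mor_par; last exact: cdom0.
    by rewrite gdist_refl lee_fin s0 mulr0 (iffLR (cdom_vertex _ vh) ch) -rh root_vertex.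
  have [h' /and3P[nh' /eqP rh' /eqP fh']] :
      exists h', [&& ~~ is_vertex h', root_of h' == v' & f h' == h].
    case: mm => -[_ _ _ /(_ v' h vv nh rh) dE] _ _.
    apply/existsP; apply: contraT; rewrite negb_exists => /forallP none.
    have := deg_gt0 v'; rewrite ltr0n dE big1 // => i.
    by move=> Pi; have := none i; rewrite Pi.
  have ch' : cdom' h' (s / (d h')%:R) by apply/mor_cdom; rewrite fh'.
  exists (par h' (s / (d h')%:R)); rewrite mor_par_div fh'//; split=> //.
  rewrite -rh' -par_root; apply: le_trans (gd_cell (cdom0 h') ch') _.
  by rewrite lee_fin subr0 ger0_norm ?shrink// divr_ge0// ltW// deg_gt0.
have ifx : idom (f x) ((d x)%:R * t) by apply/mor_idom; rewrite degK.
have nfx : ~~ is_vertex (f x) by rewrite mor_vertex.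
have [e e0 he] := idom_open nfx ifx; exists e => // q.
rewrite mor_par; last exact: idom_cdom.
move=> pq; have [s [st -> ->]] := inner_ball nfx ifx he pq.
have cs : cdom' x (s / (d x)%:R) by apply/mor_cdom/idom_cdom/he.
exists (par x (s / (d x)%:R)); rewrite mor_par_div; last exact/idom_cdom/he.
split=> //; apply: le_trans (gd_cell (idom_cdom ix) cs) _; rewrite lee_fin.
have -> : s / (d x)%:R - t = (s - (d x)%:R * t) / (d x)%:R.
  by rewrite mulrBl degK.
by rewrite normrM normfV (gtr0_norm (deg_gt0 x)) shrink.
Qed.

End MorphismModel.

(** * Slopes of a cover *)

Section TotalAction.
Variables (gT : finGroupType) (T : Type) (to : {action gT &-> T}).
Implicit Types (x : T) (a b : gT).

Lemma tactM x a b : to x (a * b)%g = to (to x a) b.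
Proof. by case: to => f [_ +] /=; apply; rewrite inE. Qed.

Lemma tact1 x : to x 1%g = x.
Proof.
suff : injective (to^~ 1%g) by apply; rewrite -tactM mulg1.
by case: to => f [inj _] /=; exact: inj.
Qed.

Lemma tactK a : cancel (to^~ a) (to^~ a^-1%g).
Proof. by move=> x; rewrite -tactM mulgV tact1. Qed.

Lemma tactKV a : cancel (to^~ a^-1%g) (to^~ a).
Proof. by move=> x; rewrite -tactM mulVg tact1. Qed.
End TotalAction.

Section Cover.
Variables (R : realType) (gT : finGroupType) (Γ : curve R) (D : Γ -> {group gT}).
Variable (phi : harmonicCover gT Γ).
Hypothesis dilD : has_dilation D phi.
Local Notation Γ' := (source phi).
Local Notation act := (cact phi).
Local Notation proj := (@cproj _ _ _ phi).
Implicit Types p q r : Γ'.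

Lemma cover_surj (q : Γ) : exists p : Γ', proj p = q.
Proof.
have [M' [M [f [d [mm gdeg]]]]] := cproj_harmonic phi.
have [y [t [iy yE]]] := par_surj M q.
have [x fx] : exists x, f x = y.
  apply: contrapT => none; have := gdeg y; rewrite big1 => [E|x /eqP fx].
    by have := cardG_gt0 [group of [set: gT]]; rewrite cardsT -E.
  by case: none; exists x.
exists (par x (t / (d x)%:R)); rewrite -yE -fx; apply: mor_par_div mm _ _ _.
by rewrite fx; exact: idom_cdom.
Qed.

(** The group acts by isometries, so the slope is the same at all points of the
    fiber of an inner point.  The fiber has as many points as the stabilizer has
    cosets, and the global degree counts each of them with this slope; hence
    the slope is the order of the stabilizer. *)
Lemma deg_dil (M' : modelOf Γ') (M : modelOf Γ) (f : M' -> M) (d : M' -> nat)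
    (mm : morphism_model f d proj) (gdeg : global_degree f d #|gT|) x t :
  ~~ is_vertex x -> inner_dom (@len _ _ _ M') x t ->
  d x = #|D (proj (par x t))|.
Proof.
move=> nx ix; set p := par x t.
have slope_eq y u : ~~ is_vertex y -> inner_dom (@len _ _ _ M') y u ->
    proj (par y u) = proj p -> d y = d x.
  move=> ny iy pE.
  have [a apE] := cact_transitive (esym pE).
  have [e1 e10 h1] := inner_slope mm nx ix.
  have [e2 e20 h2] := inner_slope mm ny iy.
  have [e e0 he] := idom_open nx ix.
  pose m := Num.min e (Num.min e1 e2) / 2.
  have m0 : 0 < m by rewrite divr_gt0// !lt_min e0 e10.
  have /and3P[me me1 me2] : [&& m < e, m < e1 & m < e2].
    have : m < Num.min e (Num.min e1 e2).
      by rewrite ltr_pdivrMr// ltr_pMr ?ltr1n// !lt_min e0 e10.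
    by rewrite !lt_min.
  have nt : `|t + m - t| = m by rewrite addrC addKr gtr0_norm.
  have is' : inner_dom (@len _ _ _ M') x (t + m) by apply: he; rewrite nt.
  have dm : gdist p (par x (t + m)) = m%:E.
    by have := inner_dist nx ix he (s := t + m); rewrite nt; apply.
  have [|s [qE _ + ]] := h1 (par x (t + m)); first by rewrite dm lte_fin.
  rewrite dm => -[<-] D1.
  have dm2 : gdist (par y u) (act (par x (t + m)) a) = m%:E.
    by rewrite -apE cact_isometry.
  have [|s' [_ _ + ]] := h2 (act (par x (t + m)) a); first by rewrite dm2 lte_fin.
  rewrite dm2 => -[<-]; rewrite pE cact_proj D1 => -[].
  move/(mulIf (lt0r_neq0 m0)) => /eqP; rewrite eqr_nat => /eqP ->//.
pose y := f x.
have pE : proj p = par y ((d x)%:R * t) by apply: mor_par mm _ _ _; exact: idom_cdom.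
have iy : inner_dom (@len _ _ _ M) y ((d x)%:R * t).
  by apply/(mor_idom mm); rewrite (degK mm).
pose P x' := par x' ((d x)%:R * t / (d x')%:R).
have Pinner x' : f x' = y -> inner_dom (@len _ _ _ M') x' ((d x)%:R * t / (d x')%:R).
  by move=> fx'; apply/(mor_idom mm); rewrite fx'.
have Pproj x' : f x' = y -> proj (P x') = proj p.
  by move=> fx'; rewrite (mor_par_div mm) fx'//; exact: idom_cdom.
have Pnv x' : f x' = y -> ~~ is_vertex x'.
  by move=> fx'; rewrite -(mor_vertex mm) fx' (mor_vertex mm).
have Pd x' : f x' = y -> d x' = d x.
  by move=> fx'; apply: slope_eq (Pnv _ fx') (Pinner _ fx') (Pproj _ fx').
have [k kE] : {k : gT -> M' & forall a, f (k a) = y /\ act p a = P (k a)}.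
  apply: (@choice _ _ (fun a x' => f x' = y /\ act p a = P x')) => a.
  have [|x' fx' e] := mor_fiber mm iy (p' := act p a); first by rewrite cact_proj.
  by exists x'.
have kinj a b : k a = k b <-> act p a = act p b.
  split=> [kab|ab]; first by rewrite (kE a).2 (kE b).2 kab.
  rewrite (kE a).2 (kE b).2 in ab.
  have [[]//|[ek kk _]] := par_inj (Pinner _ (kE a).1) (Pinner _ (kE b).1) ab.
  have := (kE b).1; rewrite kk (mor_flip mm) (kE a).1 => /esym yy.
  by case: (edge_flip_neq (x := y) _ yy); rewrite -(kE a).1 (mor_edge mm).
have fibcard x' : f x' = y -> #|[pred a | k a == x']| = #|D (proj p)|.
  move=> fx'; have [b bE] := cact_transitive (esym (Pproj _ fx')).
  have kb : k b = x'.
    rewrite (kE b).2 in bE.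
    have [[]//|[ek kk _]] := par_inj (Pinner _ (kE b).1) (Pinner _ fx') bE.
    have := fx'; rewrite kk (mor_flip mm) (kE b).1 => /esym yy.
    by case: (edge_flip_neq (x := y) _ yy); rewrite -(kE b).1 (mor_edge mm).
  rewrite -[RHS](card_rcoset _ b); apply: eq_card => a.
  rewrite !inE mem_rcoset; apply/eqP/idP => [|abD].
    rewrite -kb => /kinj abE; apply/dilD; by rewrite tactM abE tactK.
  rewrite -kb; apply/kinj; rewrite -[a](mulgKV b) tactM; congr (act _ b).
  exact/dilD.
have sum1 : (\sum_(x' | f x' == y) #|[pred a | k a == x']| = #|gT|)%N.
  rewrite -[RHS]sum1_card (partition_big k (fun x' => f x' == y)) /=.
    by apply: eq_bigr => x' _; rewrite -sum1_card; apply: eq_bigl => a; rewrite inE.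
  by move=> a _; rewrite (kE a).1.
have := gdeg y; rewrite -sum1.
under eq_bigr => x' /eqP fx' do rewrite Pd//.
under [in X in _ = X]eq_bigr => x' /eqP fx' do rewrite fibcard//.
rewrite !sum_nat_const => /eqP; rewrite eqn_pmul2l => [/eqP //|].
by apply/card_gt0P; exists x; exact: eqxx.
Qed.

(** The local metric of a cover is determined by the stabilizers alone, with no
    reference to a model of the projection.  At a vertex the factor depends on
    the direction, whence the stabilizer at [q] rather than at [p]. *)
Lemma cover_slope p : exists2 e : R, 0 < e & forall q, (gdist p q < e%:E)%E ->
  gdist (proj p) (proj q) = (#|D (proj q)|%:R%:E * gdist p q)%E.
Proof.
have [M' [M [f [d [mm gdeg]]]]] := cproj_harmonic phi.
case: (pointP M' p) => [[v' vv ->]|[x [t [nx ix ->]]]].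
  have [e e0 he] := vertex_slope mm; exists e => // q /(he _ vv).
  move=> [h [s [rh ch -> -> ->]]]; rewrite EFinM.
  case: ch => [->|ih]; first by rewrite !mule0.
  have [vh|nh] := boolP (is_vertex h).
    by rewrite (iffLR (idom_vertex _ vh) ih) !mule0.
  by rewrite (deg_dil mm gdeg nh ih).
have [e e0 he] := inner_slope mm nx ix; exists e => // q /he.
move=> [s [-> is' -> ->]]; rewrite EFinM.
by rewrite (deg_dil mm gdeg nx is').
Qed.

Lemma cover_lift p : exists2 e : R, 0 < e & forall q : Γ, (gdist (proj p) q < e%:E)%E ->
  exists q' : Γ', proj q' = q /\ (gdist p q' <= gdist (proj p) q)%E.
Proof.
have [M' [M [f [d [mm gdeg]]]]] := cproj_harmonic phi; exact: mor_lift mm p.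
Qed.
End Cover.

(** * Patching local sections over an interval *)

(** [S u t] says that [t] is a section near the parameter [u] of a torsor over
    the interval [I] under the constant group [gT / K].  It is used for the
    lifts of an edge to a cover and for the torsor of a cocycle of the
    codilation sheaf. *)
Section Patching.
Variables (R : realType) (gT : finGroupType) (T : Type) (to : {action gT &-> T}).
Variables (I : R -> Prop) (S : R -> (R -> T) -> Prop) (K : {set gT}).
Implicit Types (t : R -> T) (a b c : gT) (u v w r : R).

Hypothesis I_convex : forall u v w, I u -> I v -> u <= w <= v -> I w.
Hypothesis I_open : forall u, I u ->
  exists2 e : R, 0 < e & forall v, `|v - u| < e -> I v.
Hypothesis S_stab : forall u t, I u -> S u t ->
  forall a, to (t u) a = t u <-> a \in K.
Hypothesis S_torsor : forall u t t', I u -> S u t -> S u t' ->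
  exists c, exists2 e : R, 0 < e & forall v, `|v - u| < e -> t' v = to (t v) c.
Hypothesis S_move : forall u t t' c (e : R), I u -> 0 < e -> S u t ->
  (forall v, `|v - u| < e -> t' v = to (t v) c) -> S u t'.
Hypothesis S_exists : forall u, I u ->
  exists t, exists2 e : R, 0 < e & forall v, `|v - u| < e -> S v t.

Definition section_on u v t := forall w, u <= w <= v -> S w t.

(** Whether two sections differ by a given translation is decided near each
    point by the class of a single element modulo [K], hence is locally
    constant. *)
Lemma section_unique u v t t' : I u -> I v ->
  section_on u v t -> section_on u v t' ->
  forall r r' c, u <= r <= v -> u <= r' <= v ->
  t' r = to (t r) c -> t' r' = to (t r') c.
Proof.
move=> Iu Iv st st' r r' c ruv ruv'.
pose P w w' := t' w = to (t w) c <-> t' w' = to (t w') c.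
suff PP : forall w w', u <= w -> w <= w' -> w' <= v -> P w w'.
  move: ruv ruv' => /andP[ur rv] /andP[ur' rv'].
  by case: (leP r r') => [rr|/ltW rr]; have [] := PP _ _ _ rr _.
move=> w w' uw ww wv; apply: (@interval_ind R P) => //.
  by move=> s x y _ _ _ _; exact: iff_trans.
move=> x /andP[wx xw].
have Ix : I x by apply: I_convex Iu Iv _; apply/andP; split; lra.
have xuv : u <= x <= v by apply/andP; split; lra.
have [c0 [e e0 he]] := S_torsor Ix (st _ xuv) (st' _ xuv).
have key y : u <= y <= v -> `|y - x| < e ->
    t' y = to (t y) c <-> (c0 * c^-1)%g \in K.
  move=> yuv yx; have Iy : I y by apply: I_convex Iu Iv _.
  rewrite -(S_stab Iy (st _ yuv)) (he _ yx) tactM.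
  by split=> [->|{2}<-]; rewrite ?tactK ?tactKV.
exists e => // y /andP[wy yw] yx.
have ky : P y x.
  rewrite /P (key x) ?subrr ?normr0// (key y)//; apply/andP; split; lra.
by split=> _ //; exact: iff_sym.
Qed.

Lemma section_exists u v : I u -> I v -> u <= v -> exists t, section_on u v t.
Proof.
move=> Iu Iv uv; apply: (@interval_ind R (fun u v => exists t, section_on u v t)) => //.
  move=> x y z ux xy yz zv [t1 s1] [t2 s2].
  have Iy : I y by apply: I_convex Iu Iv _; apply/andP; split; lra.
  have [||c [e e0 he]] := S_torsor Iy (s2 y _) (s1 y _); try by rewrite lexx ?xy ?yz.
  (* glue at [y], after translating [t2] so that it agrees with [t1] there *)
  exists (fun r => if r <= y then t1 r else to (t2 r) c) => w /andP[xw wz].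
  have Iw : I w by apply: I_convex Iu Iv _; apply/andP; split; lra.
  have [wy|yw|wy] := ltgtP w y.
  - apply: (@S_move w t1 _ 1%g (y - w)) => //; first by rewrite subr_gt0.
      by apply: s1; rewrite xw ltW.
    by move=> r; rewrite tact1 ltr_norml => /andP[_ ?]; rewrite ifT//; lra.
  - apply: (@S_move w t2 _ c (w - y)) => //; first by rewrite subr_gt0.
      by apply: s2; rewrite wz ltW.
    move=> r; rewrite ltr_norml => /andP[? _]; rewrite ifF//.
    by apply/negbTE; rewrite -ltNge; lra.
  - apply: (@S_move w t1 _ 1%g e) => //; first by apply: s1; rewrite xw wy lexx.
    by move=> r; rewrite wy tact1 => ry; case: ifP => // _; rewrite he.
move=> y /andP[uy yv].
have Iy : I y by apply: I_convex Iu Iv _; apply/andP.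
have [t [e e0 he]] := S_exists Iy.
exists e => // x _ xy; split=> le; exists t => w /andP[? ?]; apply: he.
  by move: xy; rewrite !ltr_norml => /andP[? ?]; apply/andP; split; lra.
by move: xy; rewrite !ltr_norml => /andP[? ?]; apply/andP; split; lra.
Qed.

(** On an open interval the sections over the compact subintervals through
    [u0], normalized at [u0], are unique; so the value at [u] of the one that
    reaches [u] defines a global section. *)
Lemma global_section u0 : I u0 -> exists t, forall u, I u -> S u t.
Proof.
move=> Iu0; have [t0 [e e0 /(_ u0)]] := S_exists Iu0.
rewrite subrr normr0 => /(_ e0) S0.
pose lo u := Num.min u0 u; pose hi u := Num.max u0 u.
have Ilo u : I u -> I (lo u) by move=> Iu; rewrite /lo minElt; case: ifP.
have Ihi u : I u -> I (hi u) by move=> Iu; rewrite /hi maxElt; case: ifP.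
have lohi u : lo u <= u0 <= hi u /\ lo u <= u <= hi u.
  by rewrite /lo /hi !ge_min !le_max !lexx !orbT.
have sec_ex u : I u -> exists t, section_on (lo u) (hi u) t /\ t u0 = t0 u0.
  move=> Iu; have [|t st] := @section_exists (lo u) (hi u) (Ilo _ Iu) (Ihi _ Iu).
    by have [/andP[? ?] _] := lohi u; lra.
  have [c [d d0 hd]] := S_torsor Iu0 (st _ (lohi u).1) S0.
  exists (fun r => to (t r) c); split.
    move=> w wu; apply: (@S_move w t _ c 1) => //; last exact: st.
    by apply: I_convex wu; [exact: Ilo | exact: Ihi].
  by rewrite hd// subrr normr0.
have [t tE] : exists t : R -> R -> T, forall u, I u ->
    section_on (lo u) (hi u) (t u) /\ t u u0 = t0 u0.
  have [t tE] := @choice _ _ (fun u t => I u ->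
    section_on (lo u) (hi u) t /\ t u0 = t0 u0) (fun u =>
      match pselect (I u) with
      | left Iu => let: ex_intro t h := sec_ex u Iu in ex_intro _ t (fun=> h)
      | right nI => ex_intro _ t0 (fun Iu => match nI Iu with end)
      end).
  by exists t.
exists (fun u => t u u) => u Iu.
have [e1 e10 h1] := I_open Iu; have [e2 e20 h2] := I_open Iu0.
pose a := Num.min (u - e1 / 2) (u0 - e2 / 2).
pose b := Num.max (u + e1 / 2) (u0 + e2 / 2).
have Ia : I a.
  rewrite /a minElt; case: ifP => _; [apply: h1 | apply: h2];
    rewrite ltr_norml; apply/andP; split; lra.
have Ib : I b.
  rewrite /b maxElt; case: ifP => _; [apply: h2 | apply: h1];
    rewrite ltr_norml; apply/andP; split; lra.
have [au au0 bu bu0] : [/\ a <= u - e1 / 2, a <= u0 - e2 / 2,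
    u + e1 / 2 <= b & u0 + e2 / 2 <= b].
  by rewrite /a /b !ge_min !le_max !lexx !orbT.
have [|tt stt] := @section_exists a b Ia Ib; first by lra.
have u0ab : a <= u0 <= b by apply/andP; split; lra.
have [c [d d0 hd]] := S_torsor Iu0 (stt _ u0ab) S0.
have uab : a <= u <= b by apply/andP; split; lra.
apply: (@S_move u tt _ c (e1 / 2)) => //; [by lra | exact: stt |].
move=> v; rewrite ltr_norml => /andP[? ?].
have vab : a <= v <= b by apply/andP; split; lra.
have Iv : I v by apply: I_convex Ia Ib vab.
have [sv tv0] := tE v Iv.
have [l0 lv] := lohi v.
apply: (@section_unique (lo v) (hi v) tt (t v) (Ilo _ Iv) (Ihi _ Iv) _ sv u0 v c) => //.
  move=> w /andP[? ?]; apply: stt; move: u0ab vab => /andP[? ?] /andP[? ?].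
  have [? ?] : a <= lo v /\ hi v <= b by rewrite /lo /hi le_min ge_max; split; apply/andP.
  by apply/andP; split; lra.
by rewrite tv0 hd// subrr normr0.
Qed.
End Patching.

(** * Isomorphisms from continuous equivariant maps *)

Section CoverTopology.
Variables (R : realType) (gT : finGroupType) (Γ : curve R) (D : Γ -> {group gT}).

(** A translation that moves some point near [p] to a point near [p] moves [p]
    by little, and the orbit of [p] is finite. *)
Lemma cover_separation (phi : harmonicCover gT Γ) (p : source phi) :
  exists2 e : R, 0 < e & forall q q' : source phi,
    (gdist p q < e%:E)%E -> (gdist p q' < e%:E)%E -> cproj q = cproj q' ->
    exists2 a, cact phi p a = p & cact phi q a = q'.
Proof.
have [e e0 he] := gdist_sep (fun a => cact phi p a) p.
exists (e / 2) => [|q q' pq pq' /cact_transitive[a qa]]; first by rewrite divr_gt0.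
exists a => //; apply: he; apply: (gdist_lt_trans (b := e / 2) _ pq'); first by rewrite -splitr.
by rewrite -qa cact_isometry gdist_sym.
Qed.

Lemma cover_near (phi : harmonicCover gT Γ) (p : source phi) (e : R) :
  has_dilation D phi -> 0 < e -> exists2 e' : R, 0 < e' & forall q,
    (gdist p q < e'%:E)%E -> (gdist (cproj p) (cproj q) < e%:E)%E.
Proof.
move=> dil e0; have [e1 e10 h1] := cover_slope dil p.
have N0 : (0 : R) < #|gT|%:R by rewrite ltr0n; apply/card_gt0P; exists 1%g.
exists (Num.min e1 (e / #|gT|%:R)) => [|q pq].
  by rewrite lt_min e10 divr_gt0.
rewrite h1; last by apply: lt_le_trans pq _; rewrite lee_fin ge_min lexx.
have : (gdist p q < (e / #|gT|%:R)%:E)%E.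
  by apply: lt_le_trans pq _; rewrite lee_fin ge_min lexx orbT.
have := gdist_ge0 p q; case: (gdist p q) => // d; rewrite lee_fin -EFinM !lte_fin.
move=> d0; rewrite ltr_pdivlMr// mulrC; apply: le_lt_trans.
by rewrite ler_wpM2r// ler_nat max_card.
Qed.

Definition continuous_at (X Y : metricGraph R) (F : X -> Y) (p : X) :=
  forall e : R, 0 < e -> exists2 e' : R, 0 < e' &
    forall q, (gdist p q < e'%:E)%E -> (gdist (F p) (F q) < e%:E)%E.

Variables phi psi : harmonicCover gT Γ.
Hypotheses (dphi : has_dilation D phi) (dpsi : has_dilation D psi).
Variable F : source phi -> source psi.
Hypothesis F_act : forall a p, F (cact phi p a) = cact psi (F p) a.
Hypothesis F_proj : forall p, cproj (F p) = cproj p.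
Hypothesis F_cont : forall p, continuous_at F p.

Lemma equivariant_inj : injective F.
Proof.
move=> p q pq; have [a aE] : exists a, cact phi p a = q.
  by apply: cact_transitive; rewrite -!F_proj pq.
rewrite -aE; apply/esym/dphi; rewrite -F_proj; apply/dpsi.
by rewrite -F_act aE.
Qed.

Lemma equivariant_surj q : exists p, F p = q.
Proof.
have [p pq] := cover_surj phi (cproj q).
have [a aE] : exists a, cact psi (F p) a = q.
  by apply: cact_transitive; rewrite F_proj.
by exists (cact phi p a); rewrite F_act.
Qed.

(** A point [q'] near [q] has the same image in the base as some [F y] with [y]
    near [G q]; it differs from [F y] by an element that fixes [q]. *)
Lemma equivariant_inverse_cont (G : source psi -> source phi) :
  cancel F G -> cancel G F -> forall q, continuous_at G q.
Proof.
move=> FK GK q e e0; pose p := G q.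
have G_act a r : G (cact psi r a) = cact phi (G r) a.
  by apply: equivariant_inj; rewrite F_act !GK.
have [e1 e10 lift] := cover_lift p.
have [e2 e20 sep] := cover_separation q.
have [e3 e30 Fc] := F_cont p e20.
have m0 : 0 < Num.min e1 (Num.min e e3) by rewrite !lt_min e10 e0.
have [e4 e40 near] := cover_near q dpsi m0.
exists (Num.min e2 e4) => [|q' qq']; first by rewrite lt_min e20.
have [qq2 qq4] : (gdist q q' < e2%:E)%E /\ (gdist q q' < e4%:E)%E.
  by split; apply: lt_le_trans qq' _; rewrite lee_fin ge_min lexx ?orbT.
have pq' := near _ qq4; rewrite -(GK q) F_proj -/p in pq'.
have [pq1 pqe pq3] : [/\ (gdist (cproj p) (cproj q') < e1%:E)%E,
    (gdist (cproj p) (cproj q') < e%:E)%E & (gdist (cproj p) (cproj q') < e3%:E)%E].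
  by split; apply: lt_le_trans pq' _; rewrite lee_fin !ge_min lexx ?orbT.
have [y [yq py]] := lift _ pq1.
have [||a qa ya] := sep (F y) q' _ qq2.
- by rewrite -{1}(GK q); apply: Fc; exact: le_lt_trans py pq3.
- by rewrite F_proj.
have pa : cact phi p a = p by rewrite -G_act qa.
have -> : G q' = cact phi y a by rewrite -ya G_act FK.
move: py; rewrite -(cact_isometry a p y) pa => py.
exact: (le_lt_trans py pqe).
Qed.

(** Only continuity has to be checked: both covers stretch small distances by
    the same factor, the order of the stabilizer, so an equivariant map over the
    base is a local isometry, and the distances are length distances. *)
Lemma equivariant_iso : cover_iso phi psi.
Proof.
have [G GK] : {G : source psi -> source phi & cancel G F}.
  by apply: (@choice _ _ (fun q p => F p = q)); exact: equivariant_surj.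
have FK : cancel F G by move=> p; apply: equivariant_inj; rewrite GK.
have local_isometry p : exists2 e : R, 0 < e & forall q, (gdist p q < e%:E)%E ->
    (gdist (F p) (F q) < e%:E)%E -> gdist (F p) (F q) = gdist p q.
  have [e1 e10 h1] := cover_slope dphi p; have [e2 e20 h2] := cover_slope dpsi (F p).
  exists (Num.min e1 e2) => [|q pq Fpq]; first by rewrite lt_min e10.
  have [pq1 Fpq2] : (gdist p q < e1%:E)%E /\ (gdist (F p) (F q) < e2%:E)%E.
    by split; [apply: lt_le_trans pq _ | apply: lt_le_trans Fpq _];
      rewrite lee_fin ge_min lexx ?orbT.
  have := h1 _ pq1; rewrite -F_proj -(F_proj q) (h2 _ Fpq2).
  have := gdist_ge0 p q; have := gdist_ge0 (F p) (F q).
  case: (gdist p q) pq1 => // d _; case: (gdist (F p) (F q)) Fpq2 => // d' _ _ _.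
  rewrite -!EFinM => -[/mulfI ->//].
  by rewrite pnatr_eq0 -lt0n cardG_gt0.
exists F; split=> //; first by exists G.
move=> p q; apply/eqP; rewrite eq_le; apply/andP; split.
  apply: locally_lipschitz => {}p; have [e e0 he] := local_isometry p.
  have [e' e'0 Fc] := F_cont p e0.
  exists (Num.min e e') => [|{}q pq]; first by rewrite lt_min e0.
  rewrite he//; first by apply: lt_le_trans pq _; rewrite lee_fin ge_min lexx.
  by apply: Fc; apply: lt_le_trans pq _; rewrite lee_fin ge_min lexx orbT.
rewrite -{1}(FK p) -{1}(FK q).
apply: locally_lipschitz => {}p; have [e e0 he] := local_isometry (G p).
have [e' e'0 Gc] := equivariant_inverse_cont FK GK p e0.
exists (Num.min e e') => [|{}q pq]; first by rewrite lt_min e0.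
rewrite -[in leRHS](GK p) -[in leRHS](GK q) he//.
  by apply: Gc; apply: lt_le_trans pq _; rewrite lee_fin ge_min lexx orbT.
by rewrite !GK; apply: lt_le_trans pq _; rewrite lee_fin ge_min lexx.
Qed.
End CoverTopology.

(** * Path lifting *)

Section LocalCells.
Variables (R : realType) (X : metricGraph R) (M : modelOf X).
Local Notation cdom := (closed_dom (@len _ _ _ M)).
Local Notation idom := (inner_dom (@len _ _ _ M)).

(* Closed cells allow vertices and inner points to be treated alike. *)
Lemma local_cell (p : X) : exists2 e : R, 0 < e & forall q, (gdist p q < e%:E)%E ->
  exists (x : M) s t, [/\ cdom x s, cdom x t, p = par x t, q = par x s &
    gdist p q = `|s - t|%:E].
Proof.
case: (pointP M p) => [[v vv ->]|[x [t [nx ix ->]]]].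
  have [r r0 hr] := mesh M; exists r => // q vq.
  have [h [s [rh ch sr qE ds]]] := vertex_ball hr vv vq.
  exists h, s, 0; split=> //; first exact: cdom0; first by rewrite -rh -par_root.
  by rewrite ds subr0 ger0_norm// (cdom_ge0 ch).
have [e e0 he] := idom_open nx ix; exists e => // q pq.
have [s [st qE ds]] := inner_ball nx ix he pq.
by exists x, s, t; split=> //; apply: idom_cdom => //; exact: he.
Qed.
End LocalCells.

Section Lifts.
Variables (R : realType) (gT : finGroupType) (Γ : curve R) (D : Γ -> {group gT}).
Variables (M : modelOf Γ) (DG : M -> {group gT}).
Hypothesis D_par : forall x t, inner_dom (@len _ _ _ M) x t -> D (par x t) = DG x.
Variable phi : harmonicCover gT Γ.
Hypothesis dphi : has_dilation D phi.
Local Notation act := (cact phi).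
Local Notation proj := (@cproj _ _ _ phi).
Local Notation cdom := (closed_dom (@len _ _ _ M)).
Local Notation idom := (inner_dom (@len _ _ _ M)).

Definition cell_lift (x : M) (c : R -> source phi) : Prop :=
  (forall t, cdom x t -> proj (c t) = par x t) /\
  (forall s t, cdom x s -> cdom x t -> (gdist (c s) (c t) <= `|t - s|%:E)%E).

(** Only distances to [c t] are controlled, which makes the notion easy to
    verify; continuous induction recovers the Lipschitz property. *)
Definition germ_lift (x : M) (t : R) (c : R -> source phi) : Prop :=
  exists2 e : R, 0 < e & forall s, `|s - t| < e ->
    proj (c s) = par x s /\ (gdist (c t) (c s) <= `|s - t|%:E)%E.

Lemma germ_liftE x t c : germ_lift x t c -> proj (c t) = par x t.
Proof. by case=> e e0 /(_ t); rewrite subrr normr0 => /(_ e0)[]. Qed.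

Section Inner.
Variables (x : M).
Hypothesis nx : ~~ is_vertex x.

(** Near [p] the points of a fiber differ by the stabilizer of [p], which also
    fixes them because stabilizers are constant over an open cell. *)
Lemma lift_unique (p : source phi) t : idom x t -> proj p = par x t ->
  exists2 e : R, 0 < e & forall s q q', idom x s -> proj q = par x s ->
    proj q' = par x s -> (gdist p q < e%:E)%E -> (gdist p q' < e%:E)%E -> q = q'.
Proof.
move=> ix pE; have [e e0 sep] := cover_separation p.
exists e => // s q q' is_ qE q'E pq pq'.
have [|a /dphi pa <-] := sep q q' pq pq'; first by rewrite qE.
by apply/esym/dphi; rewrite qE D_par// -(D_par ix) -pE.
Qed.

Lemma par_near t (e : R) : idom x t -> 0 < e -> exists2 e' : R, 0 < e' &
  forall s, `|s - t| < e' -> [/\ idom x s, `|s - t| < e &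
    (gdist (par x t) (par x s) <= `|s - t|%:E)%E].
Proof.
move=> ix e0; have [e1 e10 h1] := idom_open nx ix.
exists (Num.min e e1) => [|s]; first by rewrite lt_min e0.
rewrite lt_min => /andP[? /h1 is_]; split=> //.
by apply: gd_cell; exact: idom_cdom.
Qed.

Lemma germ_lift_torsor t c c' : idom x t -> germ_lift x t c -> germ_lift x t c' ->
  exists a, exists2 e : R, 0 < e & forall s, `|s - t| < e -> c' s = act (c s) a.
Proof.
move=> ix gc gc'; have [a aE] : exists a, act (c t) a = c' t.
  by apply: cact_transitive; rewrite (germ_liftE gc) (germ_liftE gc').
have [e1 e10 h1] := gc; have [e2 e20 h2] := gc'.
have [e3 e30 h3] := lift_unique ix (germ_liftE gc').
have m0 : 0 < Num.min e1 (Num.min e2 e3) by rewrite !lt_min e10 e20.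
have [e e0 he] := par_near ix m0.
exists a, e => // s /he[is_ + _]; rewrite !lt_min => /and3P[s1 s2 s3].
have [cE cd] := h1 s s1; have [cE' cd'] := h2 s s2.
apply: (h3 s) => //; first by rewrite cact_proj.
- by apply: le_lt_trans cd' _; rewrite lte_fin.
- by rewrite -aE cact_isometry; apply: le_lt_trans cd _; rewrite lte_fin.
Qed.

Lemma germ_lift_move t c c' a (e : R) : 0 < e -> germ_lift x t c ->
  (forall s, `|s - t| < e -> c' s = act (c s) a) -> germ_lift x t c'.
Proof.
move=> e0 [e1 e10 h1] cc'; exists (Num.min e e1) => [|s]; first by rewrite lt_min e0.
rewrite lt_min => /andP[se se1]; have [cE cd] := h1 s se1.
by rewrite !cc' ?subrr ?normr0// cact_proj cact_isometry.
Qed.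

(** The point near [p] over [par x s] is unique, so choosing one for each [s]
    already gives a continuous lift. *)
Lemma germ_lift_exists t : idom x t ->
  exists c, exists2 e : R, 0 < e & forall s, `|s - t| < e -> germ_lift x s c.
Proof.
move=> ix; have [p pE] := cover_surj phi (par x t).
have [e1 e10 h1] := cover_lift p; rewrite pE in h1.
have [e2 e20 h2] := lift_unique ix pE.
have [c cE] : {c : R -> source phi & forall s, idom x s -> `|s - t| < e1 ->
    proj (c s) = par x s /\ (gdist p (c s) <= `|s - t|%:E)%E}.
  apply: (@choice _ _ (fun s q => idom x s -> `|s - t| < e1 ->
    proj q = par x s /\ (gdist p q <= `|s - t|%:E)%E)) => s.
  have [[is_ st]|no] := pselect (idom x s /\ `|s - t| < e1); last first.
    by exists p => is_ st; case: no.
  have le : (gdist (par x t) (par x s) <= `|s - t|%:E)%E.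
    by apply: gd_cell; exact: idom_cdom.
  have [|q [qE pq]] := h1 (par x s); first by apply: le_lt_trans le _; rewrite lte_fin.
  by exists q => _ _; split=> //; exact: le_trans pq le.
have m0 : 0 < Num.min e1 e2 by rewrite lt_min e10.
have [e e0 he] := par_near ix m0.
have near r : `|r - t| < e -> [/\ idom x r, proj (c r) = par x r &
    (gdist p (c r) < e2%:E)%E].
  move=> /he[ir + _]; rewrite lt_min => /andP[r1 r2].
  have [? pr] := cE r ir r1; split=> //.
  by apply: le_lt_trans pr _; rewrite lte_fin.
exists c, e => // s st; have [is_ sE ps] := near s st.
have [e3 e30 h3] := cover_lift (c s); rewrite sE in h3.
have [d d0 dps] : exists2 d : R, 0 < d & forall q, (gdist (c s) q < d%:E)%E ->
    (gdist p q < e2%:E)%E.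
  have := ps; have := gdist_ge0 p (c s).
  case E : (gdist p (c s)) => [u| |] // _; rewrite lte_fin => ue.
  exists ((e2 - u) / 2); first by lra.
  move=> q sq; apply: (gdist_lt_trans _ (_ : (gdist p (c s) < ((e2 + u) / 2)%:E)%E) sq).
    by lra.
  by rewrite E lte_fin; lra.
have m1 : 0 < Num.min e3 (Num.min d (e - `|s - t|)) by rewrite !lt_min e30 d0 subr_gt0.
have [e4 e40 h4] := par_near is_ m1.
exists e4 => // r /h4[ir + sr]; rewrite !lt_min => /and3P[r3 rd re].
have [|_ rE pr] := near r; first by have := ler_distD s r t; lra.
have [|q [qE sq]] := h3 (par x r); first by apply: le_lt_trans sr _; rewrite lte_fin.
have sq' := le_trans sq sr.
split=> //; suff -> : c r = q by [].
apply: (h2 r) => //; apply: dps.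
by apply: le_lt_trans sq' _; rewrite lte_fin.
Qed.

Lemma inner_lift_exists : exists c, forall t, idom x t -> germ_lift x t c.
Proof.
have [t0 it0] : exists t0, idom x t0.
  case/nvertexE: nx => [ex|lx].
    exists (len x / 2); apply/idom_edge => //; have := len_gt0 ex.
    by move=> ?; apply/andP; split; lra.
  by exists 1; apply/idom_leg.
apply: (@global_section _ _ _ act (idom x) (germ_lift x) (DG x)) it0.
- by move=> u v w; exact: idom_convex.
- by move=> u; exact: idom_open.
- by move=> u t iu /germ_liftE tE a; rewrite -(D_par iu) -tE; exact: dphi.
- exact: germ_lift_torsor.
- by move=> u t t' c e _; exact: germ_lift_move.
- exact: germ_lift_exists.
Qed.

Lemma inner_lipschitz c : (forall t, idom x t -> germ_lift x t c) ->
  forall s t, idom x s -> idom x t -> (gdist (c s) (c t) <= `|t - s|%:E)%E.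
Proof.
move=> gc s t is_ it; wlog st : s t is_ it / s <= t.
  move=> W; have [/W|/ltW/W] := leP s t; first exact.
  by rewrite gdist_sym distrC; apply.
rewrite ger0_norm ?subr_ge0//; apply: lipschitz_curve => // u ust.
have [e e0 he] := gc u (idom_convex is_ it ust).
by exists e => // r _ /he[].
Qed.

(** Take any [p] over the end.  By openness some translate of [c t] is close to
    [p]; by separation of the orbit of [p] the same translate works for all
    small [t], so [c] converges to a translate of [p]. *)
Lemma lift_end c : (forall t, idom x t -> proj (c t) = par x t) ->
  (forall s t, idom x s -> idom x t -> (gdist (c s) (c t) <= `|t - s|%:E)%E) ->
  exists2 p, proj p = par x 0 & forall t, idom x t -> (gdist p (c t) <= t%:E)%E.
Proof.
move=> cE clip; have [p pE] := cover_surj phi (par x 0).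
have [e1 e10 h1] := cover_lift p; rewrite pE in h1.
have [e2 e20 h2] := gdist_sep (act p) p.
have [r r0 hr] := mesh M.
pose t1 := Num.min (Num.min e1 e2) r / 3.
have t10 : 0 < t1 by rewrite divr_gt0// !lt_min e10 e20.
have [t1e1 t1e2 t1r] : [/\ t1 * 3 <= e1, t1 * 3 <= e2 & t1 * 3 <= r].
  by rewrite divfK//; split; rewrite !ge_min lexx ?orbT.
have small t : 0 < t -> t <= t1 -> idom x t.
  move=> t0 tt; case/nvertexE: nx => [ex|lx]; last exact/idom_leg.
  by apply/idom_edge => //; have := hr _ ex; move=> ?; apply/andP; split; lra.
have lift t : 0 < t -> t <= t1 -> exists a, (gdist p (act (c t) a) <= t%:E)%E.
  move=> t0 tt; have it := small t t0 tt.
  have le : (gdist (par x 0) (par x t) <= t%:E)%E.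
    by apply: le_trans (gd_cell (cdom0 x) (idom_cdom it)) _; rewrite subr0 gtr0_norm.
  have [|q [qE pq]] := h1 (par x t).
    by apply: le_lt_trans le _; rewrite lte_fin; lra.
  have [a aE] : exists a, act (c t) a = q by apply: cact_transitive; rewrite cE.
  by exists a; rewrite aE; exact: le_trans pq le.
have [a1 ha1] := lift t1 t10 (lexx _).
(* the translate used at [t1] works at all smaller parameters *)
have near t : 0 < t -> t <= t1 -> (gdist p (act (c t) a1) <= t%:E)%E.
  move=> t0 tt; have [a ha] := lift t t0 tt.
  have c1 : (gdist (act (c t1) a1) (act (c t) a1) <= (t1 - t)%:E)%E.
    rewrite cact_isometry; apply: le_trans (clip _ _ (small _ t10 (lexx _)) (small _ t0 tt)) _.
    by rewrite lee_fin ler0_norm ?subr_le0// opprB.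
  have c2 : (gdist (act (c t) a1) (act p (a^-1 * a1)%g) <= t%:E)%E.
    have -> : act (c t) a1 = act (act (c t) a) (a^-1 * a1)%g.
      by rewrite -tactM mulKVg.
    by rewrite cact_isometry gdist_sym.
  have pa : act p (a^-1 * a1)%g = p.
    apply: h2; apply: (@le_lt_trans _ _ (t1 * 2)%:E); last by rewrite lte_fin; lra.
    by apply: (gdist_le_trans _ (gdist_le_trans (lexx _) ha1 c1) c2); lra.
  by rewrite pa gdist_sym in c2.
exists (act p a1^-1%g) => [|t it]; first by rewrite cact_proj.
have t0 := idom_gt0 nx it.
pose s := Num.min t t1.
have s0 : 0 < s by rewrite lt_min t0.
have [st s1] : s <= t /\ s <= t1 by rewrite !ge_min !lexx orbT.
have is_ := small s s0 s1.
apply: (gdist_le_trans (a := s) (b := t - s) (q := c s)); first by lra.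
  by rewrite -(cact_isometry a1) tactKV; exact: near.
by apply: le_trans (clip _ _ is_ it) _; rewrite lee_fin ger0_norm// subr_ge0.
Qed.
End Inner.

(** A lift of the open cell is found by patching, and it extends to the ends. *)
Lemma cell_lift_exists x : exists c, cell_lift x c.
Proof.
have [vx|nx] := boolP (is_vertex x).
  have [p pE] := cover_surj phi (par x 0); exists (fun=> p); split=> [t|s t].
    by move/(cdom_vertex _ vx) ->.
  by move=> /(cdom_vertex _ vx) -> /(cdom_vertex _ vx) ->; rewrite gdist_refl subrr normr0.
have [c gc] := inner_lift_exists nx; have clip := inner_lipschitz gc.
have cE t : idom x t -> proj (c t) = par x t by move=> /gc/germ_liftE.
have [p0 p0E hp0] := lift_end nx cE clip.
have [p1 p1E] : exists2 p1, is_edge_half x -> proj p1 = par x (len x) &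
    is_edge_half x -> forall t, idom x t -> (gdist p1 (c t) <= (len x - t)%:E)%E.
  have [ex|] := boolP (is_edge_half x); last by exists p0.
  have idf t : idom (flip_of x) t -> idom x (len x - t).
    by rewrite -(len_flip x) -{2}(flipK x); apply: idom_flip; rewrite is_edge_half_flip.
  have [|||p1 p1E hp1] := @lift_end (flip_of x) _ (fun t => c (len x - t)).
  - by rewrite is_vertex_flip.
  - move=> t it; rewrite cE; last exact: idf.
    rewrite -[in RHS](par_flip_closed (h := flip_of x)) ?is_edge_half_flip//.
    + by rewrite flipK len_flip.
    + exact: idom_cdom.
  - move=> s t /idf is_ /idf it; apply: le_trans (clip _ _ is_ it) _.
    by rewrite lee_fin distrC (_ : len x - s - _ = t - s)//; lra.
  exists p1 => _.
    by rewrite p1E -(par_flip_closed ex) ?subrr//; apply/cdom_edge; rewrite // lexx andbT ltW// len_gt0.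
  move=> t it; have := hp1 (len x - t); rewrite subKr; apply; exact: idom_flip.
move=> hp1.
pose g (t : R) := if t == 0 then p0 else if is_edge_half x && (t == len x) then p1 else c t.
have g0 : g 0 = p0 by rewrite /g eqxx.
have g1 : is_edge_half x -> g (len x) = p1.
  by move=> ex; rewrite /g ex eqxx gt_eqF// len_gt0.
have gi t : idom x t -> g t = c t.
  move=> it; rewrite /g gt_eqF ?(idom_gt0 nx it)//.
  case: ifP => // /andP[ex /eqP tE]; move: it; rewrite idom_edge// tE => /andP[_].
  by rewrite ltxx.
exists g; split=> [t ct|].
  case: (cdomP ct) => [it|[_ ->]|[ex ->]]; [by rewrite gi// cE | by rewrite g0 |].
  by rewrite g1// p1E.
have glip s t : cdom x s -> cdom x t -> s < t -> (gdist (g s) (g t) <= (t - s)%:E)%E.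
  move=> cs ct st; case: (cdomP cs) => [is_|[_ sE]|[ex sE]]; last first.
  - by move: ct; rewrite cdom_edge// => /andP[_]; rewrite -sE leNgt st.
  - case: (cdomP ct) => [it|[_ tE]|[ex tE]]; last 2 first.
    + by move: st; rewrite sE tE ltxx.
    + have ih : idom x (len x / 2).
        by apply/idom_edge => //; have := len_gt0 ex; move=> ?; apply/andP; split; lra.
      rewrite sE tE g0 g1//; apply: (gdist_le_trans (b := len x - len x / 2) _ (hp0 _ ih)).
        by lra.
      by rewrite gdist_sym; exact: hp1.
    + by rewrite sE g0 gi// subr0; exact: hp0.
  - case: (cdomP ct) => [it|[_ tE]|[ex tE]].
    + rewrite !gi//; apply: le_trans (clip _ _ is_ it) _.
      by rewrite lee_fin gtr0_norm ?subr_gt0.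
    + by move: st; rewrite tE ltNge ltW// (idom_gt0 nx is_).
    + by rewrite tE g1// gi// gdist_sym; exact: hp1.
move=> s t cs ct; have [st|ts|<-] := ltgtP s t.
- by rewrite gtr0_norm ?subr_gt0//; exact: glip.
- by rewrite gdist_sym distrC gtr0_norm ?subr_gt0//; exact: glip.
- by rewrite gdist_refl subrr normr0.
Qed.

End Lifts.

(** * Products in a commutative group *)

Section AbelianGroup.
Variable gT : finGroupType.
Hypothesis abel : abelian [set: gT]%SET.
Implicit Types a b c : gT.

Lemma abelC a b : (a * b = b * a)%g.
Proof. by apply: (centsP abel); rewrite inE. Qed.

Lemma abelCA a b c : (a * (b * c) = b * (a * c))%g.
Proof. by rewrite !mulgA (abelC a b). Qed.

Lemma eq_div1 a b : (a * b^-1 = 1 -> a = b)%g.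
Proof. by move/eqP; rewrite -eq_mulgV1 => /eqP. Qed.

Lemma mem_join_abelian (H K : {group gT}) a :
  (a \in H <*> K)%g <-> exists2 b, b \in H & exists2 c, c \in K & a = (b * c)%g.
Proof.
rewrite cent_joinEl; last first.
  by apply/fintype.subsetP => x _; apply/centP => y _; exact: abelC.
split=> [/mulsgP[b c bH cK ->]|[b bH [c cK ->]]]; last exact: mem_mulg.
by exists b => //; exists c.
Qed.
End AbelianGroup.

(** Proves equality of two products in a commutative group: divides one by the
    other, and cancels the head factor against its inverse, moved next to it,
    until 1 is left. *)
Ltac abelian_eq abel :=
  apply: eq_div1; rewrite ?invMg ?invgK ?invg1 ?mul1g ?mulg1 -?mulgA;
  repeat first
    [ rewrite mulKg | rewrite mulKVg | rewrite mulgV | rewrite mulVg | rewrite mul1g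
    | lazymatch goal with
      | |- (?a^-1 * ?r)%g = _ =>
          match r with
          | context [(?b * (a * ?c))%g] => rewrite [(b * (a * c))%g](abelCA abel)
          | context [(?b * a)%g] => rewrite [(b * a)%g](abelC abel)
          end
      | |- (?a * ?r)%g = _ =>
          match r with
          | context [(?b * (a^-1 * ?c))%g] => rewrite [(b * (a^-1 * c))%g](abelCA abel)
          | context [(?b * a^-1)%g] => rewrite [(b * a^-1)%g](abelC abel)
          end
      end ];
  try reflexivity.

(** * Framings of a cover *)

Section Framings.
Variables (R : realType) (gT : finGroupType) (Γ : curve R).
Hypothesis abel : abelian [set: gT]%SET.
Variables (D : Γ -> {group gT}) (M : modelOf Γ) (DG : M -> {group gT}).
Hypothesis D_par : forall x t, inner_dom (@len _ _ _ M) x t -> D (par x t) = DG x.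
Variable o : {set M}.
Hypothesis orientM : orientation o.
Local Notation cdom := (closed_dom (@len _ _ _ M)).
Local Notation idom := (inner_dom (@len _ _ _ M)).
Implicit Types (phi psi : harmonicCover gT Γ) (x h v : M).

Lemma D_root x : D (par (root_of x) 0) = DG (root_of x).
Proof. by apply: D_par; apply/idom_vertex => //; exact: vertex_root. Qed.

Lemma stab_eq phi (p : source phi) a b : has_dilation D phi ->
  cact phi p a = cact phi p b <-> (a * b^-1)%g \in D (cproj p).
Proof.
move=> dil; rewrite -(dil p); rewrite tactM.
by split=> [->|{2}<-]; rewrite ?tactK ?tactKV.
Qed.

Lemma idom_dense x t (e : R) : ~~ is_vertex x -> cdom x t -> 0 < e ->
  exists2 s, idom x s & `|s - t| < e.
Proof.
move=> nx ct e0; case: (cdomP ct) => [it|[_ ->]|[ex ->]].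
- by exists t; rewrite ?subrr ?normr0.
- case/nvertexE: nx => [ex|lx].
    have l0 := len_gt0 ex; exists (Num.min e (len x) / 2).
      apply/idom_edge => //; rewrite divr_gt0 ?lt_min ?e0//= ltr_pdivrMr//.
      by rewrite (@le_lt_trans _ _ (len x)) ?ge_min ?lexx ?orbT//; lra.
    rewrite subr0 gtr0_norm ?divr_gt0 ?lt_min ?e0// ltr_pdivrMr//.
    by rewrite (@le_lt_trans _ _ e) ?ge_min ?lexx//; lra.
  by exists (e / 2); [apply/idom_leg => //; lra | rewrite subr0 gtr0_norm; lra].
- have l0 := len_gt0 ex; have m0 : 0 < Num.min e (len x) by rewrite lt_min e0.
  have [me ml] : Num.min e (len x) <= e /\ Num.min e (len x) <= len x.
    by rewrite !ge_min !lexx orbT.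
  exists (len x - Num.min e (len x) / 2).
    by apply/idom_edge => //; apply/andP; split; lra.
  by rewrite addrC addKr normrN gtr0_norm; lra.
Qed.

(* Over the open cell this is uniqueness of sections; it passes to the ends by
   continuity. *)
Lemma lifts_translate phi x c c' : has_dilation D phi -> ~~ is_vertex x ->
  cell_lift x c -> cell_lift (phi := phi) x c' ->
  exists a, forall t, cdom x t -> c' t = cact phi (c t) a.
Proof.
move=> dil nx [cE clip] [cE' clip'].
have germ (d : R -> source phi) : (forall t, cdom x t -> cproj (d t) = par x t) ->
    (forall s t, cdom x s -> cdom x t -> (gdist (d s) (d t) <= `|t - s|%:E)%E) ->
    forall t, idom x t -> germ_lift x t d.
  move=> dE dlip t it; have [e e0 he] := idom_open nx it; exists e => // s /he is_.
  by split; [exact: dE (idom_cdom is_) | exact: dlip (idom_cdom it) (idom_cdom is_)].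
have [t0 it0 _] := idom_dense nx (cdom0 x) ltr01.
have [a aE] : exists a, cact phi (c t0) a = c' t0.
  by apply: cact_transitive; rewrite cE ?cE'//; exact: idom_cdom.
have inner t : idom x t -> c' t = cact phi (c t) a.
  move=> it; have [u [u' [iu iv tuv t0uv]]] : exists u u',
      [/\ idom x u, idom x u', u <= t <= u' & u <= t0 <= u'].
    case: (leP t t0) => [tt0|/ltW tt0]; [exists t, t0 | exists t0, t];
      split=> //; by rewrite lexx ?andbT.
  have := @section_unique _ _ _ (cact phi) (idom x) (germ_lift x) (DG x) _ _ _
    u u' c c' iu iv _ _ t0 t a t0uv tuv (esym aE); apply.
  - by move=> u1 v w; exact: idom_convex.
  - by move=> w d iw /germ_liftE dE b; rewrite -(D_par iw) -dE; exact: dil.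
  - exact: (germ_lift_torsor D_par dil nx).
  - by move=> w uwv; apply: germ => //; apply: idom_convex uwv.
  - by move=> w uwv; apply: germ => //; apply: idom_convex uwv.
exists a => t ct; apply: contrapT => /gdist_neq[e e0 ne].
have [s is_ st] := idom_dense nx ct (e := e / 2) (divr_gt0 e0 (ltr0n _ 2)).
have cs := idom_cdom is_.
have c1 := clip' _ _ ct cs; rewrite (inner s is_) in c1.
have c2 : (gdist (cact phi (c s) a) (cact phi (c t) a) <= `|t - s|%:E)%E.
  by rewrite cact_isometry; exact: clip.
have := le_trans ne (gdist_le_trans (lexx _) c1 c2).
by rewrite lee_fin (distrC t); lra.
Qed.

(** A framing records how a cover is glued: [lam] chooses the vertices [v0] and
    the lifts [e0] of the closed edges and legs, and [eta] gives the position of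
    the ends of the latter, so that [eta h] and [eta (flip_of h)] are the
    elements [a] and [b] of the assignment for [h] in the orientation. *)
Definition framing phi (lam : M -> R -> source phi) (eta : M -> gT) : Prop :=
  [/\ forall x, cell_lift x (lam x),
      forall h t, is_edge_half h -> cdom h t -> lam (flip_of h) (len h - t) = lam h t &
      forall x, ~~ is_vertex x -> lam x 0 = cact phi (lam (root_of x) 0) (eta x)].

Definition reversed h := is_edge_half h && (h \notin o).

(* On the half-edges outside the orientation the given lifts are replaced by
   the reverse of the lifts of the opposite half-edges. *)
Lemma framing_of_lifts phi (c : M -> R -> source phi) :
  (forall x, cell_lift x (c x)) ->
  exists lam eta, framing lam eta /\ forall x, ~~ reversed x -> lam x = c x.
Proof.
move=> cl.
pose lam x := if reversed x then fun t => c (flip_of x) (len x - t) else c x.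
have rev_flip h : is_edge_half h -> reversed (flip_of h) = ~~ reversed h.
  by move=> eh; rewrite /reversed is_edge_half_flip eh /= (edge_orient orientM eh) negbK.
have lam_lift x : cell_lift x (lam x).
  rewrite /lam; case: ifP => // /andP[ex _]; have [cE clip] := cl (flip_of x).
  split=> [t ct|s t cs ct]; first by rewrite cE ?par_flip_closed//; exact: cdom_flip.
  apply: le_trans (clip _ _ (cdom_flip ex cs) (cdom_flip ex ct)) _.
  by rewrite lee_fin distrC (_ : len x - s - _ = t - s)//; lra.
have [eta etaE] : {eta : M -> gT & forall x, cact phi (lam (root_of x) 0) (eta x) = lam x 0}.
  apply: (@choice _ _ (fun x a => cact phi (lam (root_of x) 0) a = lam x 0)) => x.
  apply: cact_transitive; rewrite (lam_lift _).1; last exact: cdom0.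
  by rewrite (lam_lift _).1 -?par_root//; exact: cdom0.
exists lam, eta; split; last by move=> x nr; rewrite /lam (negbTE nr).
split=> // h t eh ct; rewrite /lam rev_flip// len_flip flipK.
by case: (reversed h); rewrite //= subKr.
Qed.

Lemma framing_exists phi : has_dilation D phi -> exists lam eta, @framing phi lam eta.
Proof.
move=> dil.
have [c cl] : {c : M -> R -> source phi & forall x, cell_lift x (c x)}.
  by apply: (@choice _ _ (fun x c => cell_lift x c)) => x; exact: (cell_lift_exists D_par dil).
by have [lam [eta [fr _]]] := framing_of_lifts cl; exists lam, eta.
Qed.

Section OneFraming.
Variables (phi : harmonicCover gT Γ) (lam : M -> R -> source phi) (eta : M -> gT).
Hypothesis dphi : has_dilation D phi.
Hypothesis fr : framing lam eta.
Local Notation act := (cact phi).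

Lemma framing_proj x t a : cdom x t -> cproj (act (lam x t) a) = par x t.
Proof. by rewrite cact_proj => ct; case: fr => /(_ x)[+ _ _ _]; exact. Qed.

Lemma framing_end h : is_edge_half h ->
  lam h (len h) = act (lam (root_of (flip_of h)) 0) (eta (flip_of h)).
Proof.
case: fr => _ lf lr eh; rewrite -lr ?is_vertex_flip ?edge_nvertex//.
rewrite -(lf h (len h)) ?subrr//.
by apply/cdom_edge; rewrite // lexx andbT ltW// len_gt0.
Qed.

(** One element [a] brings both [p] and a given nearby point [q] onto the lift of
    one closed cell. *)
Lemma framing_local p : exists2 e : R, 0 < e & forall q, (gdist p q < e%:E)%E ->
  exists x s t a, [/\ cdom x s, cdom x t, p = act (lam x t) a, q = act (lam x s) a &
    gdist (cproj p) (cproj q) = `|s - t|%:E].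
Proof.
have [e1 e10 h1] := cover_separation p.
have [e2 e20 h2] := local_cell M (cproj p).
have m0 : 0 < Num.min e1 e2 by rewrite lt_min e10.
have [e3 e30 h3] := cover_near p dphi m0.
exists (Num.min e1 e3) => [|q pq]; first by rewrite lt_min e10.
have [pq1 pq3] : (gdist p q < e1%:E)%E /\ (gdist p q < e3%:E)%E.
  by split; apply: lt_le_trans pq _; rewrite lee_fin ge_min lexx ?orbT.
have := h3 _ pq3; set dd := gdist (cproj p) _ => dm.
have [dd1 dd2] : (dd < e1%:E)%E /\ (dd < e2%:E)%E.
  by split; apply: lt_le_trans dm _; rewrite lee_fin ge_min lexx ?orbT.
have [x [s [t [cs ct pE qE dE]]]] := h2 _ dd2.
have [a aE] : exists a, act (lam x t) a = p.
  by apply: cact_transitive; rewrite -[lam x t](tact1 act) framing_proj.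
have [||b pb qb] := h1 (act (lam x s) a) q _ pq1.
- rewrite -aE cact_isometry; case: fr => /(_ x)[_ lip] _ _.
  by apply: le_lt_trans (lip _ _ ct cs) _; move: dd1; rewrite /dd dE.
- by rewrite framing_proj.
exists x, s, t, (a * b)%g; split=> //.
  by rewrite tactM aE pb.
by rewrite tactM qb.
Qed.
End OneFraming.

(** The isomorphism sends [lam x t] to [lam' x t] and is extended equivariantly.
    It is well defined because the stabilizers agree, and at the ends of the
    cells because the gluing elements do; it is continuous because it carries
    the translates of [lam x] to those of [lam' x]. *)
Lemma framing_iso phi psi lam lam' eta : has_dilation D phi -> has_dilation D psi ->
  @framing phi lam eta -> @framing psi lam' eta -> cover_iso phi psi.
Proof.
move=> dphi dpsi fr fr'.
pose same (p : source phi) (q : source psi) := exists x t a,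
  [/\ idom x t, p = cact phi (lam x t) a & q = cact psi (lam' x t) a].
have same_vertex v a : is_vertex v -> same (cact phi (lam v 0) a) (cact psi (lam' v 0) a).
  by move=> vv; exists v, 0, a; split=> //; apply/idom_vertex.
have same_closed x t a : cdom x t -> same (cact phi (lam x t) a) (cact psi (lam' x t) a).
  move=> ct; case: (cdomP ct) => [it|[nx ->]|[ex ->]]; first by exists x, t, a.
    case: fr fr' => _ _ rt [_ _ rt']; rewrite rt// rt'// -!tactM.
    exact/same_vertex/vertex_root.
  rewrite (framing_end fr ex) (framing_end fr' ex) -!tactM.
  exact/same_vertex/vertex_root.
have same_fun p q q' : same p q -> same p q' -> q = q'.
  move=> [x [t [a [it -> ->]]]] [y [u [b [iu e ->]]]].
  have xy : lam x t = lam y u /\ lam' x t = lam' y u.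
    have : par x t = par y u.
      by rewrite -(framing_proj fr a (idom_cdom it)) e (framing_proj fr b (idom_cdom iu)).
    case/(par_inj it iu) => [[-> ->]//|[ex -> ->]].
    by case: fr fr' => _ lf _ [_ lf' _]; rewrite lf ?lf'//; exact: idom_cdom.
  case: xy e => -> -> /(stab_eq _ _ _ dphi) abD; apply/(stab_eq _ _ _ dpsi).
  by rewrite -(tact1 (cact psi) (lam' y u)) (framing_proj fr' _ (idom_cdom iu))
    -(framing_proj fr 1%g (idom_cdom iu)) tact1.
have same_total p : exists q, same p q.
  have [x [t [it pE]]] := par_surj M (cproj p).
  have [a aE] : exists a, cact phi (lam x t) a = p.
    by apply: cact_transitive; rewrite -pE -(framing_proj fr 1%g (idom_cdom it)) tact1.
  by exists (cact psi (lam' x t) a), x, t, a.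
have [F FE] := @choice _ _ same same_total.
have F_eq p q : same p q -> F p = q by move=> pq; exact: same_fun (FE p) pq.
apply: (equivariant_iso dphi dpsi (F := F)).
- move=> a p; apply: F_eq; have [x [t [b [it pE ->]]]] := FE p.
  by exists x, t, (b * a)%g; rewrite !tactM -pE.
- move=> p; have [x [t [b [it pE ->]]]] := FE p.
  by rewrite pE (framing_proj fr b (idom_cdom it)) (framing_proj fr' b (idom_cdom it)).
- move=> p e e0; have [e1 e10 loc] := framing_local dphi fr p.
  have [e2 e20 near] := cover_near p dphi e0.
  exists (Num.min e1 e2) => [|q pq]; first by rewrite lt_min e10.
  have [pq1 pq2] : (gdist p q < e1%:E)%E /\ (gdist p q < e2%:E)%E.
    by split; apply: lt_le_trans pq _; rewrite lee_fin ge_min lexx ?orbT.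
  have [x [s [t [a [cs ct pE qE dE]]]]] := loc _ pq1.
  have := near _ pq2; rewrite dE; apply: le_lt_trans.
  have <- : cact psi (lam' x t) a = F p by rewrite pE (F_eq _ _ (same_closed _ _ a ct)).
  have <- : cact psi (lam' x s) a = F q by rewrite qE (F_eq _ _ (same_closed _ _ a cs)).
  by rewrite cact_isometry; case: fr' => /(_ x)[_ lip] _ _; exact: lip.
Qed.

Lemma framing_transport phi psi lam eta : @framing phi lam eta ->
  cover_iso phi psi -> exists lam', @framing psi lam' eta.
Proof.
move=> [cl lf lr] [F [_ Fd Fa Fp]]; exists (fun x t => F (lam x t)); split.
- move=> x; have [cE clip] := cl x; split=> [t ct|s t cs ct]; first by rewrite Fp cE.
  by rewrite Fd; exact: clip.
- by move=> h t eh ct; rewrite lf.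
- by move=> x nx; rewrite lr// Fa.
Qed.

Definition edge_ratio (eta : M -> gT) h := (eta (flip_of h) * (eta h)^-1)%g.

(** The relation that the explicit description of the cohomology group imposes
    on tuples. *)
Definition tuple_equiv (g g' : M -> gT) := exists k : M -> gT, forall h, h \in o ->
  (g' h * (g h)^-1 * (k (root_of (flip_of h)) * (k (root_of h))^-1)^-1)%g \in codil D h.

Lemma codil_edge h a : is_edge_half h ->
  a \in codil D h <-> exists2 b, b \in DG (root_of h) &
    exists2 c, c \in DG (root_of (flip_of h)) & a = (b * c)%g.
Proof.
by move=> eh; rewrite /codil eh /root_dil !D_root; exact: mem_join_abelian.
Qed.

(** Let [k v] compare the two lifts of the vertex [v], and [m] the two lifts of
    the edge [h].  Comparing the starting points of the lifts of [h] and of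
    [flip_of h] gives two relations modulo the groups of the end vertices, and
    [m] cancels from their quotient. *)
Lemma framings_equiv phi lam lam' eta eta' : has_dilation D phi ->
  @framing phi lam eta -> @framing phi lam' eta' ->
  tuple_equiv (edge_ratio eta) (edge_ratio eta').
Proof.
move=> dil fr fr'.
have [k kE] : {k : M -> gT & forall v, cact phi (lam v 0) (k v) = lam' v 0}.
  apply: (@choice _ _ (fun v a => cact phi (lam v 0) a = lam' v 0)) => v.
  apply: cact_transitive; case: fr fr' => /(_ v)[cE _] _ _ [/(_ v)[cE' _] _ _].
  by rewrite cE ?cE'//; exact: cdom0.
exists (fun v => (k v)^-1)%g => h /(orient_edge orientM) eh.
have nh : ~~ is_vertex h by rewrite edge_nvertex.
have [m mE] : exists m, forall t, cdom h t -> lam' h t = cact phi (lam h t) m.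
  by case: fr fr' => cl _ _ [cl' _ _]; exact: lifts_translate.
have lD v a b : is_vertex v -> cact phi (lam v 0) a = cact phi (lam v 0) b ->
    (a * b^-1)%g \in DG v.
  move=> vv /(stab_eq _ _ _ dil); case: fr => /(_ v)[cE _] _ _.
  by rewrite cE ?(D_par (iffRL (idom_vertex _ vv) erefl))//; exact: cdom0.
have s1 : (eta h * m * (k (root_of h) * eta' h)^-1)%g \in DG (root_of h).
  apply: lD; first exact: vertex_root.
  have := mE 0 (cdom0 h); case: fr fr' => _ _ lr [_ _ lr'].
  by rewrite lr// lr'// -kE -!tactM => ->.
have s2 : (eta (flip_of h) * m * (k (root_of (flip_of h)) * eta' (flip_of h))^-1)%g
    \in DG (root_of (flip_of h)).
  apply: lD; first exact: vertex_root.
  have cl : cdom h (len h) by apply/cdom_edge; rewrite // lexx andbT ltW// len_gt0.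
  have := mE _ cl; rewrite (framing_end fr eh) (framing_end fr' eh).
  by rewrite -kE -!tactM => ->.
apply/codil_edge => //.
exists (eta h * m * (k (root_of h) * eta' h)^-1)%g => //.
exists (eta (flip_of h) * m * (k (root_of (flip_of h)) * eta' (flip_of h))^-1)^-1%g.
  by rewrite groupV.
rewrite /edge_ratio; abelian_eq abel.
Qed.

(** Given [k], the lifts of the vertices are translated by the inverse of [k],
    and that of an edge by [m h]: one condition on [m h] for each end, modulo
    the group of this end.  They can be met together because the obstruction is
    in the sum of both groups. *)
Lemma framing_change phi lam eta eta' : has_dilation D phi -> @framing phi lam eta ->
  tuple_equiv (edge_ratio eta) (edge_ratio eta') -> exists lam', @framing phi lam' eta'.
Proof.
move=> dil fr [k kE].
have [m mE] : {m : M -> gT & forall x, ~~ is_vertex x -> ~~ reversed x ->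
    (eta x * m x * ((k (root_of x))^-1 * eta' x)^-1)%g \in DG (root_of x) /\
    (x \in o -> (eta (flip_of x) * m x *
      ((k (root_of (flip_of x)))^-1 * eta' (flip_of x))^-1)%g \in DG (root_of (flip_of x)))}.
  apply: (@choice _ _ (fun x mx => ~~ is_vertex x -> ~~ reversed x ->
    (eta x * mx * ((k (root_of x))^-1 * eta' x)^-1)%g \in DG (root_of x) /\
    (x \in o -> (eta (flip_of x) * mx *
      ((k (root_of (flip_of x)))^-1 * eta' (flip_of x))^-1)%g
      \in DG (root_of (flip_of x))))) => x.
  have [xo|nxo] := boolP (x \in o); last first.
    exists ((k (root_of x))^-1 * eta' x * (eta x)^-1)%g => _ _; split=> //.
    set y := (X in X \in _); suff -> : y = 1%g by exact: group1.
    by rewrite /y; abelian_eq abel.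
  have ex := orient_edge orientM xo.
  have [b bD [c cD E]] := iffLR (codil_edge _ ex) (kE x xo).
  exists ((k (root_of x))^-1 * eta' x * (eta x)^-1 * b)%g => _ _; split=> [|_].
    set y := (X in X \in _); suff -> : y = b by [].
    by rewrite /y; abelian_eq abel.
  set y := (X in X \in _); suff -> : y = c^-1%g by rewrite groupV.
  have -> : c = (b^-1 * (b * c))%g by rewrite mulKg.
  by rewrite -E /y /edge_ratio; abelian_eq abel.
pose n x := if is_vertex x then (k x)^-1%g else
  if reversed x then m (flip_of x) else m x.
have [cl lf lr] := fr; exists (fun x t => cact phi (lam x t) (n x)); split.
- move=> x; have [cE clip] := cl x; split=> [t ct|s t cs ct].
    by rewrite cact_proj cE.
  by rewrite cact_isometry; exact: clip.
- move=> h t eh ct; rewrite lf// /n is_vertex_flip edge_nvertex// flipK.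
  have -> : reversed (flip_of h) = ~~ reversed h.
    by rewrite /reversed is_edge_half_flip eh /= (edge_orient orientM eh) negbK.
  by case: (reversed h).
move=> x nx; rewrite lr// -!tactM; apply/(stab_eq _ _ _ dil).
have [cE _] := cl (root_of x); rewrite cE; last exact: cdom0.
rewrite D_root {2}/n vertex_root /n (negbTE nx); case: ifP => [rx|/negbT rx].
  have /andP[ex] := rx; rewrite (edge_orient orientM)// negbK => fo.
  have nr : ~~ reversed (flip_of x) by rewrite /reversed fo andbF.
  have [|_ /(_ fo)] := mE (flip_of x) _ nr; first by rewrite is_vertex_flip.
  by rewrite flipK.
by have [] := mE x nx rx.
Qed.
End Framings.

(** * Transport of models, and the assignment *)

Lemma walk_map (R : realType) (G : graph) (len : G -> R) (T T' : Type)
    (par : G -> R -> T) (par' : G -> R -> T') (F : T -> T') :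
  (forall x t, closed_dom len x t -> F (par x t) = par' x t) ->
  forall p q L, walk len par p q L -> walk len par' (F p) (F q) L.
Proof.
move=> FE p q L; elim=> [|x s t {}L _ IH cs ct]; first exact: walk_nil.
by rewrite FE//; apply: walk_step; rewrite -?FE.
Qed.

Section TransportModel.
Variables (R : realType) (X Y : metricGraph R) (F : X -> Y) (G : Y -> X).
Hypotheses (FK : cancel F G) (GK : cancel G F).
Hypothesis F_iso : forall p q, gdist (F p) (F q) = gdist p q.
Variable M : modelOf X.
Let par' (x : M) (t : R) : Y := F (par x t).

Lemma transport_dist p q : gdist p q = path_dist (@len _ _ _ M) par' p q.
Proof.
rewrite -{1}(GK p) -{1}(GK q) F_iso (par_dist M) /path_dist; congr ereal_inf.
apply/seteqP; split=> _ [L w <-]; exists L => //=.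
  by rewrite -(GK p) -(GK q); apply: walk_map w.
by apply: walk_map w => x t _; exact: FK.
Qed.

Definition transport_model : modelOf Y.
Proof.
apply: (@Model _ _ _ M (@len _ _ _ M) par').
- exact: len_flip.
- exact: len_gt0.
- by move=> h; rewrite /par' par_root.
- by move=> h t eh ht; rewrite /par' par_flip.
- move=> p; have [x [t [it pE]]] := par_surj M (G p).
  by exists x, t; split=> //; rewrite /par' pE.
- move=> x t y u it iu /(can_inj FK); exact: par_inj.
- exact: transport_dist.
Defined.
End TransportModel.

Section Assigned.
Variables (R : realType) (gT : finGroupType) (Γ : curve R).
Variables (D : Γ -> {group gT}) (M : modelOf Γ) (DG : M -> {group gT}).
Hypothesis D_par : forall x t, inner_dom (@len _ _ _ M) x t -> D (par x t) = DG x.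
Variable o : {set M}.
Hypothesis orientM : orientation o.
Local Notation cdom := (closed_dom (@len _ _ _ M)).
Implicit Types (phi psi : harmonicCover gT Γ) (x h v : M) (g : M -> gT).

Lemma assigned_transport phi psi g : cover_iso phi psi ->
  assigned phi o g -> assigned psi o g.
Proof.
move=> [F [[G FK GK] Fd Fa Fp]] [M' [f [d [v0 [e0 [a [b]]]]]]].
move=> [[hf hlen hpar] fv fe ab gE].
exists (transport_model FK GK Fd M'), f, d, v0, e0, a, b; split=> //.
  by split=> // x t /hpar <-; rewrite /= Fp.
by move=> h /ab[aE bE]; rewrite /= -!Fa; split; congr F.
Qed.

Lemma morphism_lift phi (M' : modelOf (source phi)) (f : M' -> M) d (x : M') :
  morphism_model f d (@cproj _ _ _ phi) ->
  cell_lift (f x) (fun t => par x (t / (d x)%:R) : source phi).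
Proof.
move=> mm; split=> [t ct|s t cs ct]; first exact: mor_par_div mm _ _ ct.
have d0 := deg_gt0 mm x.
apply: le_trans (gd_cell (iffLR (mor_cdom mm x s) cs) (iffLR (mor_cdom mm x t) ct)) _.
rewrite lee_fin -mulrBl normrM normfV (gtr0_norm d0) ler_pdivrMr//.
by rewrite ler_peMr// ler1n -(ltr0n R).
Qed.

(** The choices [v0] and [e0] give the lifts of the vertices and edges.  Legs
    do not occur in the assignment and are lifted by [cell_lift_exists]. *)
Lemma assigned_framing phi g : has_dilation D phi -> assigned phi o g ->
  exists lam eta, @framing _ _ _ M phi lam eta /\ {in o, edge_ratio eta =1 g}.
Proof.
move=> dil [M' [f [d [v0 [e0 [a [b [mm fv fe ab gE]]]]]]]].
have [c0 cl0] : {c : M -> R -> source phi & forall x, cell_lift x (c x)}.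
  apply: (@choice _ _ (fun x c => cell_lift x c)) => x.
  exact: (cell_lift_exists D_par dil).
pose c x : R -> source phi := if x \in o then fun t => par (e0 x) (t / (d (e0 x))%:R)
  else if is_vertex x then fun=> par (v0 x) 0 else c0 x.
have cl x : cell_lift x (c x).
  rewrite /c; case: ifPn => [xo|_]; first by rewrite -{1}(fe x xo); exact: morphism_lift.
  case: ifPn => // vx; split=> [t /(cdom_vertex _ vx) ->|s t].
    by rewrite (mor_par mm (cdom0 _)) fv// mulr0.
  by move=> /(cdom_vertex _ vx) -> /(cdom_vertex _ vx) ->; rewrite gdist_refl subrr normr0.
have [lam [eta0 [[lcl lf lr] lamE]]] := framing_of_lifts orientM cl.
have lam_o h : h \in o -> lam h = c h by move=> ho; rewrite lamE// /reversed ho andbF.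
have lam_v v : is_vertex v -> lam v 0 = par (v0 v) 0.
  move=> vv; rewrite lamE ?/reversed ?/is_edge_half ?vv// /c vv ifN//.
  by apply/negP => /(orient_edge orientM); rewrite /is_edge_half vv.
pose eta x := if x \in o then a x else
  if is_edge_half x then b (flip_of x) else eta0 x.
exists lam, eta; split; last first.
  move=> h ho; have eh := orient_edge orientM ho.
  have fho : flip_of h \in o = false.
    by apply/negbTE; rewrite -(edge_orient orientM eh).
  by rewrite /edge_ratio /eta fho is_edge_half_flip eh flipK ho gE.
split=> // x nx; rewrite /eta (lam_v _ (vertex_root x)); case: ifPn => [xo|xno].
  by rewrite lam_o// /c xo mul0r (par_root (e0 x)) (ab x xo).1.
case: ifPn => [ex|_]; last by rewrite lr// (lam_v _ (vertex_root x)).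
have fo : flip_of x \in o by rewrite edge_orient ?flipK// is_edge_half_flip.
have efx : is_edge_half (flip_of x) by rewrite is_edge_half_flip.
have := lf _ (len (flip_of x)) efx.
rewrite flipK subrr => ->; last first.
  by apply/cdom_edge; rewrite // lexx andbT ltW// len_gt0.
have ee : is_edge_half (e0 (flip_of x)) by rewrite -(mor_edge mm) fe.
have le : len (flip_of x) = (d (e0 (flip_of x)))%:R * len (e0 (flip_of x)).
  by rewrite -(mor_len mm ee) fe.
rewrite lam_o// /c fo le (degK mm) par_end//.
by have [_ <-] := ab _ fo; rewrite flipK.
Qed.
End Assigned.

(** * The standard cover *)

(** The bundle over [B] whose fiber at [p] is the set of cosets of [S p].  It is
    used for the points and for the cells of a cover. *)
Section CosetBundle.
Variables (gT : finGroupType) (B : Type) (S : B -> {group gT}).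
Implicit Types (p : B) (a b c : gT).
Local Open Scope group_scope.

Definition bundle := {pc : B * {set gT} | pc.2 \in rcosets (S pc.1) [set: gT]%SET}.

Lemma bundle_point_subproof (p : B) c :
  (p, S p :* c).2 \in rcosets (S (p, S p :* c).1) [set: gT]%SET.
Proof. by apply/rcosetsP; exists c; rewrite ?inE. Qed.

Definition bpoint (p : B) c : bundle :=
  exist (fun pc => pc.2 \in rcosets (S pc.1) [set: gT]%SET) (p, S p :* c)
    (bundle_point_subproof p c).
Definition base (P : bundle) : B := (sval P).1.
Definition coord (P : bundle) : gT := repr (sval P).2.

Lemma bpoint_eq (p : B) c c' : bpoint p c = bpoint p c' <-> c * c'^-1 \in S p.
Proof.
split=> [[]/rcoset_eqP|cD]; first by rewrite mem_rcoset.
by apply: val_inj => /=; congr pair; apply/rcoset_eqP; rewrite mem_rcoset.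
Qed.

Lemma base_bpoint p c : base (bpoint p c) = p.
Proof. by []. Qed.

Lemma bpointK P : bpoint (base P) (coord P) = P.
Proof.
case: P => -[p C] CP; apply: val_inj => /=; rewrite /base /coord /=.
have /rcosetsP[c _ /= CE] := CP; rewrite {}CE {CP}; congr pair.
by apply/rcoset_eqP; exact: mem_repr_rcoset.
Qed.

Lemma coord_bpoint (p : B) c : coord (bpoint p c) * c^-1 \in S p.
Proof. by apply/bpoint_eq; exact: (bpointK (bpoint p c)). Qed.

Lemma bpointP (P : bundle) : exists p c, P = bpoint p c.
Proof. by exists (base P), (coord P); rewrite bpointK. Qed.

Definition bact (P : bundle) a : bundle := bpoint (base P) (coord P * a).

Lemma bact_bpoint (p : B) c a : bact (bpoint p c) a = bpoint p (c * a).
Proof.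
apply/bpoint_eq; rewrite /= invMg mulgA mulgK; exact: coord_bpoint.
Qed.

Lemma bact_is_action : is_action [set: gT]%SET bact.
Proof.
split=> [a P P'|P a b _ _].
  have [p [c ->]] := bpointP P; have [p' [c' ->]] := bpointP P'.
  rewrite !bact_bpoint => E; have pp : p = p' by have := congr1 base E.
  rewrite -pp in E *; move/bpoint_eq: E; rewrite invMg mulgA mulgK => cc.
  exact/bpoint_eq.
by have [p [c ->]] := bpointP P; rewrite !bact_bpoint mulgA.
Qed.

Definition baction : {action gT &-> bundle} := Action bact_is_action.
End CosetBundle.

(** The cover with gluing elements [eta].  Its underlying set, the bundle of
    cosets of the stabilizers, and the action do not depend on [eta], which only
    enters the parametrizations of the closed cells and hence the distance: the
    lift of [h] through the coset of [c] starts at the coset of [eta h * c]. *)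
Section StandardCover.
Variables (R : realType) (gT : finGroupType) (Γ : curve R).
Hypothesis abel : abelian [set: gT]%SET.
Variables (D : Γ -> {group gT}) (M : modelOf Γ) (DG : M -> {group gT}).
Hypothesis DG_datum : graph_dilation_datum DG.
Hypothesis D_par : forall x t, inner_dom (@len _ _ _ M) x t -> D (par x t) = DG x.
Variable eta : M -> gT.
Implicit Types (x h v : M) (p q : Γ) (a b c : gT) (s t : R).
Local Notation cdom := (closed_dom (@len _ _ _ M)).
Local Notation idom := (inner_dom (@len _ _ _ M)).

Local Notation space := (bundle D).
Local Notation scells := {xC : M * {set gT} | xC.2 \in rcosets (DG xC.1) [set: gT]%SET}.
Local Notation n x := (#|DG x|%:R : R).
Local Notation pt := (bpoint D).
Local Notation cell := (bpoint DG).

(* displacement at the ends of a cell *)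
Definition shift x s : gT :=
  if is_vertex x then 1%g else if s == 0 then eta x else
  if is_edge_half x && (s == len x) then eta (flip_of x) else 1%g.

Lemma shift_vertex x s : is_vertex x -> shift x s = 1%g.
Proof. by rewrite /shift => ->. Qed.

Lemma shift_inner x s : idom x s -> shift x s = 1%g.
Proof.
have [vx|nx] := boolP (is_vertex x); first by rewrite shift_vertex.
move=> ix; rewrite /shift (negbTE nx) gt_eqF ?(idom_gt0 nx ix)//.
case: ifP => // /andP[ex /eqP sE]; move: ix; rewrite idom_edge// sE ltxx andbF//.
Qed.

Lemma shift0 x : ~~ is_vertex x -> shift x 0 = eta x.
Proof. by rewrite /shift => /negbTE ->; rewrite eqxx. Qed.

Lemma shift_end x : is_edge_half x -> shift x (len x) = eta (flip_of x).
Proof. by move=> ex; rewrite /shift edge_nvertex// ex eqxx gt_eqF// len_gt0. Qed.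

Lemma shift_flip x s : is_edge_half x -> cdom x s ->
  shift (flip_of x) (len x - s) = shift x s.
Proof.
move=> ex cs; have efx : is_edge_half (flip_of x) by rewrite is_edge_half_flip.
case: (cdomP cs) => [ix|[_ ->]|[_ ->]].
- by rewrite !shift_inner//; exact: idom_flip.
- by rewrite subr0 -(len_flip x) shift_end// flipK shift0// edge_nvertex.
- by rewrite subrr shift0 ?shift_end// edge_nvertex.
Qed.

Lemma n_gt0 x : 0 < n x.
Proof. by rewrite ltr0n cardG_gt0. Qed.

Lemma DG_sub x s a : cdom x s -> a \in DG x -> a \in D (par x s).
Proof.
have DGr y : D (par (root_of y) 0) = DG (root_of y).
  by apply: D_par; apply/idom_vertex => //; exact: vertex_root.
have sub y : DG y \subset DG (root_of y) by case: DG_datum.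
move=> cs ax; case: (cdomP cs) => [/D_par ->//|[_ ->]|[ex ->]].
  by rewrite par_root DGr; exact: (fintype.subsetP (sub x)).
rewrite par_end// DGr; apply: (fintype.subsetP (sub _)).
by case: DG_datum => _ ->.
Qed.

Definition slam x s c : space := pt (par x s) (shift x s * c)%g.

Lemma slam_eq x s c c' : cdom x s -> (c * c'^-1)%g \in DG x -> slam x s c = slam x s c'.
Proof.
move=> cs cc; apply/bpoint_eq; apply: (DG_sub cs).
set y := (X in X \in _); suff -> : y = (c * c'^-1)%g by [].
by rewrite /y; abelian_eq abel.
Qed.

Definition sroot (X : scells) : scells :=
  cell (root_of (base X)) (shift (base X) 0 * coord X)%g.
Definition sflip (X : scells) : scells := cell (flip_of (base X)) (coord X).

Lemma sroot_cell x c : sroot (cell x c) = cell (root_of x) (shift x 0 * c)%g.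
Proof.
apply/bpoint_eq; set y := (X in X \in _).
have -> : y = (coord (cell x c) * c^-1)%g by rewrite /y base_bpoint; abelian_eq abel.
have [sub _] := DG_datum; apply: (fintype.subsetP (sub x)); exact: coord_bpoint.
Qed.

Lemma sflip_cell x c : sflip (cell x c) = cell (flip_of x) c.
Proof.
by apply/bpoint_eq; have [_ ->] := DG_datum; exact: coord_bpoint.
Qed.

Lemma srootK X : sroot (sroot X) = sroot X.
Proof.
have [x [c ->]] := bpointP X; rewrite !sroot_cell rootK shift_vertex ?mul1g//.
exact: vertex_root.
Qed.

Lemma sflipK : involutive sflip.
Proof. by move=> X; have [x [c ->]] := bpointP X; rewrite !sflip_cell flipK. Qed.

Lemma sflip_root X : sflip (sroot X) = sroot X.
Proof. by have [x [c ->]] := bpointP X; rewrite sroot_cell sflip_cell flip_root. Qed.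

Definition sgraph : graph := Graph srootK sflipK sflip_root.
Implicit Types X : sgraph.

Definition slen (X : sgraph) : R := len (base X) / n (base X).
Definition spar (X : sgraph) (t : R) : space :=
  slam (base X) (n (base X) * t) (coord X).

Lemma spar_cell x c t : cdom x (n x * t) -> spar (cell x c) t = slam x (n x * t) c.
Proof. by move=> ct; apply: slam_eq => //; exact: coord_bpoint. Qed.

Lemma svertex X : is_vertex X = is_vertex (base X).
Proof.
have [x [c ->]] := bpointP X; rewrite /is_vertex /= sroot_cell.
apply/eqP/eqP => [/(congr1 (@base _ _ _))//|xv].
by rewrite shift_vertex ?mul1g ?xv// /is_vertex xv.
Qed.

Lemma sflip_eq X : (sflip X == X) = (flip_of (base X) == base X).
Proof.
have [x [c ->]] := bpointP X; rewrite sflip_cell.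
by apply/eqP/eqP => [/(congr1 (@base _ _ _))//|xv]; rewrite xv.
Qed.

Lemma sedge X : is_edge_half X = is_edge_half (base X).
Proof. by rewrite /is_edge_half svertex /= sflip_eq. Qed.

Lemma sleg X : is_leg X = is_leg (base X).
Proof. by rewrite /is_leg svertex /= sflip_eq. Qed.

Lemma scdom X t : closed_dom slen X t <-> cdom (base X) (n (base X) * t).
Proof.
have n0 := n_gt0 (base X).
rewrite /closed_dom svertex sleg; case: ifP => _.
  split=> [->|/eqP]; first by rewrite mulr0.
  by rewrite mulf_eq0 (gt_eqF n0) => /eqP.
case: ifP => _; first by rewrite pmulr_rge0.
by rewrite pmulr_rge0// /slen ler_pdivlMr// mulrC.
Qed.

Lemma sidom X t : inner_dom slen X t <-> idom (base X) (n (base X) * t).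
Proof.
have n0 := n_gt0 (base X).
rewrite /inner_dom svertex sleg; case: ifP => _.
  split=> [->|/eqP]; first by rewrite mulr0.
  by rewrite mulf_eq0 (gt_eqF n0) => /eqP.
case: ifP => _; first by rewrite pmulr_rgt0.
by rewrite pmulr_rgt0// /slen ltr_pdivlMr// mulrC.
Qed.

Definition sdist : space -> space -> \bar R := path_dist slen spar.

Definition smodel : model sdist.
Proof.
apply: (@Model _ _ sdist sgraph slen spar) => //.
- by move=> X; rewrite /slen /base /= -/(base X) len_flip; have [_ ->] := DG_datum.
- by move=> X; rewrite sedge => eX; rewrite divr_gt0 ?len_gt0 ?n_gt0.
- move=> X; have [x [c ->]] := bpointP X; rewrite /= sroot_cell.
  rewrite !spar_cell ?mulr0; try exact: cdom0.
  by rewrite /slam par_root (shift_vertex _ (vertex_root x)) mul1g.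
- move=> X t; rewrite sedge => eX ht.
  have ct : closed_dom slen X t.
    by rewrite /closed_dom svertex sleg (edge_nvertex eX) (edge_nleg eX).
  have [x [c XE]] := bpointP X; rewrite XE /= in eX ct *.
  have nf : n (flip_of x) = n x by have [_ ->] := DG_datum.
  have lE : n (flip_of x) * (slen (cell x c) - t) = len x - n x * t.
    by rewrite nf /slen /= mulrBr mulrC divfK// gt_eqF// n_gt0.
  move/scdom: ct => /= ct.
  rewrite sflip_cell !spar_cell// lE; last exact: cdom_flip.
  by rewrite /slam par_flip_closed ?shift_flip.
- move=> P; have [p [c ->]] := bpointP P; have [x [t [it <-]]] := par_surj M p.
  exists (cell x c), (t / n x); have nE : n x * (t / n x) = t.
    by rewrite mulrC divfK// gt_eqF// n_gt0.
  split; first by apply/sidom; rewrite /= nE.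
  by rewrite spar_cell nE ?/slam ?(shift_inner it) ?mul1g//; exact: idom_cdom.
- move=> X t Y u; have [x [c ->]] := bpointP X; have [y [c' ->]] := bpointP Y.
  move=> /sidom + /sidom; rewrite !base_bpoint => it iu.
  rewrite !spar_cell; try exact: idom_cdom.
  rewrite /slam (shift_inner it) (shift_inner iu) !mul1g => E.
  have pE : par x (n x * t) = par y (n y * u) by have := congr1 (@base _ _ _) E.
  have cE : (c * c'^-1)%g \in DG x.
    by rewrite -(D_par it); apply/bpoint_eq; rewrite E pE.
  have n0 : n x != 0 by rewrite gt_eqF// n_gt0.
  case: (par_inj it iu pE) => [[xy tu]|[ex yE uE]].
    left; rewrite -xy in tu *; split; last exact: mulfI tu.
    by apply/bpoint_eq.
  have nf : n (flip_of x) = n x by have [_ ->] := DG_datum.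
  right; rewrite sedge /=; split=> //.
    rewrite sflip_cell yE; apply/bpoint_eq.
    by have [_ ->] := DG_datum; rewrite -groupV invMg invgK.
  by apply: (mulfI n0); rewrite -{1}nf -yE uE mulrBr /slen /= [_ * (len x / _)]mulrC divfK.
Defined.

Definition sspace : metricGraph R := MetricGraph (inhabits smodel).
Definition cover_model : modelOf sspace := smodel.

Definition saction : {action gT &-> sspace} := baction D.
Definition sproj : sspace -> Γ := @base _ _ D.

Lemma bact_slam x s c a : bact (slam x s c) a = slam x s (c * a)%g.
Proof. by rewrite /slam bact_bpoint mulgA. Qed.

Lemma saction_isometry a (P Q : sspace) : gdist (saction P a) (saction Q a) = gdist P Q.
Proof.
have le b P' Q' : (gdist (saction P' b) (saction Q' b) <= gdist P' Q' :> \bar R)%E.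
  apply: (gd_ge (M := cover_model)) => L w; apply: (gd_le (M := cover_model)).
  elim: w => [|X s t {}L _ IH cs ct]; first exact: walk_nil.
  have [x [c XE]] := bpointP X; rewrite XE in IH cs ct *.
  have /scdom /= cs' := cs; have /scdom /= ct' := ct.
  have tr u : closed_dom slen (cell x c : sgraph) u ->
      bact (spar (cell x c) u) b = spar (cell x (c * b)%g) u.
    by move=> /scdom /= cu; rewrite !spar_cell// bact_slam.
  move: IH; rewrite /= !tr// => IH.
  by apply: walk_step IH _ _; apply/scdom.
apply/eqP; rewrite eq_le le /=.
by rewrite -{1}(tactK saction a P) -{1}(tactK saction a Q); exact: le.
Qed.

Definition scellproj (X : cover_model) : M := base X.
Definition sdeg (X : cover_model) : nat := #|DG (base X)|.

(* A cell over [y] is a coset of [DG y], and its degree is the number of elements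
   of this coset. *)
Lemma sum_sdeg (y : M) (Pr : pred cover_model) (A : pred gT) :
  (forall X : cover_model, Pr X -> base X = y) -> (forall c, Pr (cell y c) = A c) ->
  (\sum_(X : cover_model | Pr X) sdeg X = #|A|)%N.
Proof.
move=> Py PA; rewrite -sum1_card (partition_big (fun c => cell y c : cover_model) Pr) /=.
  apply: eq_bigr => X PX; rewrite sum1_card.
  have XE : cell y (coord X) = X by rewrite -(Py X PX) bpointK.
  rewrite /sdeg (Py X PX) -(card_rcoset (DG y) (coord X)); apply: eq_card => c.
  rewrite mem_rcoset [RHS]unfold_in /=; apply/idP/andP => [cX|[_ /eqP cX]]; last first.
    by apply/bpoint_eq; rewrite XE.
  have cE : cell y c = X by rewrite -XE; apply/bpoint_eq.
  by split; [rewrite unfold_in -PA cE | apply/eqP].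
by move=> c Ac; rewrite PA.
Qed.

(** Harmonicity at [v]: the cosets of [DG h] that make up the lifts of [h] at a
    given vertex form a single coset of [DG v]. *)
Lemma smorphism : morphism_model (M' := cover_model) scellproj sdeg sproj.
Proof.
split.
- split=> //.
  + split=> //; first by move=> X; rewrite sedge.
    by move=> X; rewrite sleg.
  + by move=> X; exact: cardG_gt0.
  + by move=> X; rewrite /sdeg /base /= -/(base X); have [_ ->] := DG_datum.
  + move=> V h vV nh hr; have [v [c VE]] := bpointP V; rewrite VE in vV hr *.
    rewrite svertex /= in vV; rewrite /scellproj /= in hr.
    symmetry; rewrite (sum_sdeg (y := h) (A := [pred b | (eta h * b * c^-1)%g \in DG v])).
    * rewrite /sdeg /= -[RHS](card_lcoset _ (eta h)^-1%g).
      rewrite -[RHS](card_rcoset _ c); apply: eq_card => b.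
      by rewrite inE mem_rcoset mem_lcoset invgK mulgA.
    * by move=> X /and3P[_ _ /eqP].
    * move=> b; rewrite svertex /= nh sroot_cell shift0// hr eqxx andbT /=.
      by apply/eqP/idP => /bpoint_eq.
- move=> X; rewrite sedge => eX; rewrite /= /slen mulrC divfK//.
  by rewrite gt_eqF// n_gt0.
- by [].
Qed.

Lemma sglobal : global_degree (scellproj : cover_model -> M) sdeg #|gT|.
Proof.
move=> y; rewrite (sum_sdeg (y := y) (A := predT)) ?cardE//.
  by move=> X /eqP.
by move=> c; rewrite /= eqxx.
Qed.

(** The base lifts [v0] and [e0] of the assignment are the cosets of 1. *)
Lemma standard_cover : exists phi : harmonicCover gT Γ,
  has_dilation D phi /\ forall o : {set M}, orientation o ->
    assigned phi o (edge_ratio eta).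
Proof.
have harm : harmonic_of_degree #|gT| sproj.
  by exists cover_model, M, scellproj, sdeg; split; [exact: smorphism | exact: sglobal].
have act_proj a (P : sspace) : sproj (saction P a) = sproj P by [].
have act_trans (P Q : sspace) : sproj P = sproj Q -> exists a, saction P a = Q.
  have [p [c ->]] := bpointP P; have [q [c' ->]] := bpointP Q.
  rewrite /sproj !base_bpoint => pq.
  by exists (c^-1 * c')%g; rewrite /= bact_bpoint mulKVg pq.
have stab (P : sspace) a : saction P a = P <-> a \in D (sproj P).
  have [p [c ->]] := bpointP P; rewrite /= bact_bpoint; rewrite bpoint_eq.
  suff -> : (c * a * c^-1)%g = a by [].
  by abelian_eq abel.
have asg o : orientation o -> exists (f : cover_model -> M) (d : cover_model -> nat)
         (v0 e0 : M -> cover_model) (a b : M -> gT),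
    [/\ morphism_model f d sproj,
        forall v, is_vertex v -> f (v0 v) = v,
        forall h, h \in o -> f (e0 h) = h,
        forall h, h \in o ->
          saction (par (v0 (root_of h)) 0) (a h) = par (root_of (e0 h)) 0 /\
          saction (par (v0 (root_of (flip_of h))) 0) (b h) =
            par (root_of (flip_of (e0 h))) 0 &
        forall h, h \in o -> edge_ratio eta h = (b h * (a h)^-1)%g].
  move=> oo; exists scellproj, sdeg, (fun v => cell v 1%g), (fun h => cell h 1%g),
    eta, (fun h => eta (flip_of h)); split=> //; first exact: smorphism.
  have P0 v a : is_vertex v -> bact (spar (cell v 1%g) 0) a = spar (cell v a) 0.
    move=> vv; rewrite !spar_cell ?mulr0; try exact: cdom0.
    by rewrite bact_slam mul1g.
  move=> h ho; have eh : is_edge_half h by case: oo => + _; apply.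
  rewrite /= sflip_cell !sroot_cell !P0 ?vertex_root// !mulg1.
  by rewrite !shift0 ?is_vertex_flip ?edge_nvertex.
case E : (is_tropical Γ).
  have fin : finite_set [set p : sspace | (0 < (fun=> 0%N) p)%N].
    by apply: (sub_finite_set (B := set0)) => // p /=; rewrite ltnn.
  exists (@HarmonicCover R gT Γ (Tropical (TropicalCurve fin)) sproj saction
    (esym E) harm saction_isometry act_proj act_trans).
  by split=> [|o /asg]; [exact: stab | exists cover_model].
exists (@HarmonicCover R gT Γ (Defs.Metric sspace) sproj saction
  (esym E) harm saction_isometry act_proj act_trans).
by split=> [|o /asg]; [exact: stab | exists cover_model].
Qed.
End StandardCover.

(** * Cochains of the codilation sheaf *)

Section CosetCalculus.
Variable gT : finGroupType.
Hypothesis abel : abelian [set: gT]%SET.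
Local Open Scope group_scope.
Implicit Types (a b c : gT) (H : {group gT}) (A : {set gT}).

Lemma lcoset_rcoset_abelian A a : a *: A = A :* a.
Proof. by apply/setP => x; rewrite mem_lcoset mem_rcoset (abelC abel). Qed.

Lemma lcoset_mul H a b : (a *: H) * (b *: H) = (a * b) *: H.
Proof.
rewrite (lcoset_rcoset_abelian H b) !mulgA -[a *: H * H]mulgA mulGid.
by rewrite -mulgA -lcoset_rcoset_abelian mulgA mulg_set1.
Qed.

Lemma lcoset_inv H a : (a *: H)^-1 = a^-1 *: H.
Proof. by rewrite invg_lcoset lcoset_rcoset_abelian. Qed.

Lemma lcoset_act H a b : (a *: H) :* b = (a * b) *: H.
Proof. by rewrite -mulgA -lcoset_rcoset_abelian mulgA mulg_set1. Qed.

Lemma mem_congr A a b : b = a -> a \in A -> b \in A.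
Proof. by move=> ->. Qed.

Lemma lcoset_congr A a b : a = b -> a *: A = b *: A.
Proof. by move=> ->. Qed.

Lemma lcoset_eq H a b : a *: H = b *: H <-> a * b^-1 \in H.
Proof.
by split=> [/lcoset_eqP|?]; [|apply/lcoset_eqP]; rewrite mem_lcoset (abelC abel).
Qed.
End CosetCalculus.

(** For equations between products of cosets of one subgroup that hold for the
    representatives. *)
Ltac coset_eq abel :=
  repeat first [rewrite (lcoset_act abel) | rewrite (lcoset_inv abel) | rewrite (lcoset_mul abel)];
  first [reflexivity | apply: lcoset_congr; abelian_eq abel].

Section Cech.
Variables (R : realType) (gT : finGroupType) (Γ : curve R).
Hypothesis abel : abelian [set: gT]%SET.
Variables (M : modelOf Γ) (D : Γ -> {group gT}).
Local Notation cdom := (closed_dom (@len _ _ _ M)).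
Local Notation idom := (inner_dom (@len _ _ _ M)).
Local Notation C p := (codil D (cell_at M p)).
Local Notation sheaf := (codilation_sheaf M D).
Local Open Scope group_scope.
Implicit Types (h v : M) (p q : Γ) (a b c : gT) (z w : cochain gT Γ).

Lemma codil_flip (x : M) : codil D (flip_of x) = codil D x.
Proof.
have [vx|/nvertexE[ex|lx]] := boolP (is_vertex x); [by rewrite flip_vertex| |].
  rewrite /codil is_edge_half_flip ex flipK; apply: val_inj => /=.
  exact: joingC.
by rewrite is_leg_flip.
Qed.

Lemma cell_at_par (x : M) t : idom x t ->
  cell_at M (par x t) = x \/ is_edge_half x /\ cell_at M (par x t) = flip_of x.
Proof.
move=> ix; rewrite /cell_at; case: cid => y [u [iy yu]] /=.
case: (par_inj ix iy (esym yu)) => [[->]|[ex ->]]; first by left.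
by right.
Qed.

Lemma codil_par (x : M) t : idom x t -> C (par x t) = codil D x.
Proof. by case/cell_at_par => [->|[_ ->]]; rewrite ?codil_flip. Qed.

Lemma cell_atP p : exists t, idom (cell_at M p) t /\ p = par (cell_at M p) t.
Proof. by rewrite /cell_at; case: cid => y [u [iy yu]] /=; exists u. Qed.

Lemma vertex_at v : is_vertex v -> cell_at M (par v 0%R) = v.
Proof.
move=> vv; have [|//|[]] := @cell_at_par v 0%R; first exact/idom_vertex.
by rewrite /is_edge_half vv.
Qed.

Definition at_vertex v p :=
  root_of (cell_at M p) = v \/ root_of (flip_of (cell_at M p)) = v.

Lemma ball_open p (e : R) : metric_open [set q | (gdist p q < e%:E)%E].
Proof.
move=> q /= pq; have := gdist_ge0 p q.
case E : (gdist p q) pq => [d| |] //; rewrite lte_fin => de _.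
exists (e - d)%R; first by rewrite subr_gt0.
move=> r qr; apply: le_lt_trans (gdist_triangle p q r) _.
by rewrite E -lteBrDl// -EFinB.
Qed.

Lemma near_cell p : exists2 e : R, (0 < e)%R & forall q, (gdist p q < e%:E)%E ->
  if is_vertex (cell_at M p) then at_vertex (cell_at M p) q else
  cell_at M q = cell_at M p \/
    is_edge_half (cell_at M p) /\ cell_at M q = flip_of (cell_at M p).
Proof.
have [t [it pE]] := cell_atP p; move: it pE; set x := cell_at M p => it pE.
have [vx|nx] := boolP (is_vertex x).
  have t0 := iffLR (idom_vertex _ vx) it; rewrite t0 in pE.
  have [r r0 hr] := mesh M; exists r => // q; rewrite pE => vq.
  have [h [s [rh ch sr -> ds]]] := vertex_ball hr vx vq.
  rewrite /at_vertex; case: (cdomP ch) => [ih|[_ ->]|[eh sE]].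
  - by case: (cell_at_par ih) => [->|[_ ->]]; rewrite ?flipK; [left|right].
  - by left; rewrite par_root rh vertex_at// root_vertex.
  - by exfalso; move: sr; rewrite sE ltNge; have := hr _ eh; move=> ?; apply/negP; rewrite negbK; lra.
have [e e0 he] := idom_open nx it; exists e => // q; rewrite pE => pq.
by have [s [st -> _]] := inner_ball nx it he pq; exact: cell_at_par (he _ st).
Qed.

Lemma sheafP (U : set Γ) (s : Γ -> {set gT}) : sheaf U s <->
  forall p, U p -> exists a, exists2 e : R, (0 < e)%R &
    forall q, (gdist p q < e%:E)%E -> U q -> s q = a *: C q.
Proof.
split=> sh p Up.
  have [W [a [oW Wp sE]]] := sh p Up.
  by have [e e0 he] := oW p Wp; exists a, e => // q /he; exact: sE.
have [a [e e0 sE]] := sh p Up.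
exists [set q | (gdist p q < e%:E)%E], a; split=> //; first exact: ball_open.
by rewrite /= gdist_refl lte_fin.
Qed.

Lemma sheaf_coset U s p : sheaf U s -> U p -> exists a, s p = a *: C p.
Proof.
move=> /sheafP sh Up; have [a [e e0 sE]] := sh p Up; exists a.
by apply: sE => //; rewrite gdist_refl lte_fin.
Qed.

Lemma sheaf_mul U s s' : sheaf U s -> sheaf U s' -> sheaf U (fun p => s p * s' p).
Proof.
move=> /sheafP sh /sheafP sh'; apply/sheafP => p Up.
have [a [e e0 sE]] := sh p Up; have [a' [e' e'0 sE']] := sh' p Up.
exists (a * a'), (Num.min e e') => [|q pq Uq]; first by rewrite lt_min e0.
have [pq1 pq2] : (gdist p q < e%:E)%E /\ (gdist p q < e'%:E)%E.
  by split; apply: lt_le_trans pq _; rewrite lee_fin ge_min lexx ?orbT.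
by rewrite sE// sE'//; coset_eq abel.
Qed.

Lemma sheaf_inv U s : sheaf U s -> sheaf U (fun p => (s p)^-1).
Proof.
move=> /sheafP sh; apply/sheafP => p Up; have [a [e e0 sE]] := sh p Up.
by exists a^-1, e => // q pq Uq; rewrite sE//; coset_eq abel.
Qed.

Lemma sheaf_res (U V : set Γ) s : V `<=` U -> sheaf U s -> sheaf V s.
Proof.
move=> VU /sheafP sh; apply/sheafP => p Vp; have [a [e e0 sE]] := sh p (VU _ Vp).
by exists a, e => // q pq Vq; apply: sE => //; exact: VU.
Qed.

Lemma open_coverI (U V : Γ -> set Γ) : open_cover U -> open_cover V ->
  open_cover (fun x => U x `&` V x).
Proof.
move=> cU cV p; have [oU Up] := cU p; have [oV Vp] := cV p; split=> // q [Uq Vq].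
have [e e0 he] := oU q Uq; have [e' e'0 he'] := oV q Vq.
exists (Num.min e e') => [|r qr]; first by rewrite lt_min e0.
by split; [apply: he | apply: he']; apply: lt_le_trans qr _;
  rewrite lee_fin ge_min lexx ?orbT.
Qed.

Lemma cocycle_coset z x y p : cocycle sheaf z -> open_of z x p -> open_of z y p ->
  exists a, value z x y p = a *: C p.
Proof. by move=> [_ sh _] xp yp; apply: sheaf_coset (sh x y) _. Qed.

Lemma cohomologous_refl z : cocycle sheaf z -> cohomologous sheaf z z.
Proof.
move=> cz; have [cov _ _] := cz.
exists (open_of z), (fun _ p => 1 *: C p); split=> //.
- by move=> x; apply/sheafP => p _; exists 1, 1%R.
- move=> x y p xp yp; have [a ->] := cocycle_coset cz xp yp; coset_eq abel.
Qed.

Lemma cohomologous_sym z w : cocycle sheaf z -> cocycle sheaf w ->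
  cohomologous sheaf z w -> cohomologous sheaf w z.
Proof.
move=> cz cw [W [u [cW Wzw uF uE]]].
exists W, (fun x p => (u x p)^-1); split=> //.
- by move=> x p /Wzw[].
- by move=> x; exact: sheaf_inv.
- move=> x y p xp yp; rewrite uE//.
  have [a ->] := cocycle_coset cz (Wzw _ _ xp).1 (Wzw _ _ yp).1.
  have [b ->] := sheaf_coset (uF x) xp; have [c ->] := sheaf_coset (uF y) yp.
  coset_eq abel.
Qed.

Lemma cohomologous_trans z w t : cocycle sheaf z ->
  cohomologous sheaf z w -> cohomologous sheaf w t -> cohomologous sheaf z t.
Proof.
move=> cz [W [u [cW Wzw uF uE]]] [W' [u' [cW' Wwt uF' uE']]].
exists (fun x => W x `&` W' x), (fun x p => u x p * u' x p); split.
- exact: open_coverI.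
- by move=> x p [/Wzw[zp _] /Wwt[_ tp]].
- move=> x; apply: sheaf_mul; apply: sheaf_res (_ : _ `<=` _) _; [|exact: uF| |exact: uF'].
    by move=> p [].
  by move=> p [].
- move=> x y p [xp xp'] [yp yp']; rewrite uE'// uE//.
  have [a ->] := cocycle_coset cz (Wzw _ _ xp).1 (Wzw _ _ yp).1.
  have [b ->] := sheaf_coset (uF x) xp; have [c ->] := sheaf_coset (uF y) yp.
  have [b' ->] := sheaf_coset (uF' x) xp'; have [c' ->] := sheaf_coset (uF' y) yp'.
  coset_eq abel.
Qed.

Lemma cohomology_classP z w : cocycle sheaf z -> cocycle sheaf w ->
  cohomology_class sheaf z = cohomology_class sheaf w <-> cohomologous sheaf z w.
Proof.
move=> cz cw; split=> [E|zw].
  have : cohomology_class sheaf w w by split=> //; exact: cohomologous_refl.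
  by rewrite -E => -[].
apply/seteqP; split=> t [ct ht]; split=> //.
  by apply: cohomologous_trans (cohomologous_sym cz cw zw) ht.
by apply: cohomologous_trans zw ht.
Qed.

Section Tuples.
Hypothesis simpleM : simple_graph M.
Variable o : {set M}.
Hypothesis orientM : orientation o.
Implicit Types g : M -> gT.

Lemma open_star_index i p : is_vertex i || is_leg i -> open_star i p ->
  at_vertex (root_of i) p.
Proof.
rewrite /open_star /at_vertex /=; case: ifP => [vi _|vi /= li ->]; last by left.
by rewrite (root_vertex vi).
Qed.

Lemma star_indexP p : is_vertex (star_index M p) || is_leg (star_index M p).
Proof. by rewrite /star_index; case: ifP => [->|_]; rewrite ?orbT ?vertex_root. Qed.

(* The interior of a leg lies in the star of its root, and its codilation group
   is the one of the root, so only the stars of vertices are used below. *)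
Definition star_root p := root_of (star_index M p).

Lemma star_index_edge p q : open_star (star_index M p) q ->
  is_edge_half (cell_at M q) -> star_index M p = star_root p.
Proof.
rewrite /star_root; have /orP[vi|li] := star_indexP p; first by rewrite (root_vertex vi).
by rewrite /open_star /= leg_nvertex// => ->; rewrite leg_nedge.
Qed.

Lemma star_root_vertex v : is_vertex v -> star_root (par v 0%R) = v.
Proof.
move=> vv; rewrite /star_root /star_index vertex_at//.
by rewrite /is_leg vv /= !(root_vertex vv).
Qed.

(** On a single edge the cochain of a tuple is the coboundary of this function
    of the vertex [v], equal to 1 at the source and to [g e] at the target.
    This replaces the case distinctions in [tuple_value]. *)
Definition potential g v (x : M) : gT :=
  if is_edge_half x then
    let e := if x \in o then x else flip_of x in
    if root_of (flip_of e) == v then g e else 1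
  else 1.

Lemma potential_flip g v x : potential g v (flip_of x) = potential g v x.
Proof.
rewrite /potential is_edge_half_flip; case: ifP => // ex; rewrite flipK.
by rewrite (edge_orient orientM ex); case: (flip_of x \in o).
Qed.

Lemma potential_nedge g v (x : M) : ~~ is_edge_half x -> potential g v x = 1.
Proof. by rewrite /potential => /negbTE ->. Qed.

Lemma no_loop h : is_edge_half h -> root_of h <> root_of (flip_of h).
Proof. by case: simpleM => + _; apply. Qed.

Lemma tuple_value_potential g x y p :
  open_star (star_index M x) p -> open_star (star_index M y) p ->
  tuple_value o g (star_index M x) (star_index M y) (cell_at M p) =
    potential g (star_root y) (cell_at M p) * (potential g (star_root x) (cell_at M p))^-1.
Proof.
move=> xp yp; have [ep|np] := boolP (is_edge_half (cell_at M p)); last first.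
  by rewrite !potential_nedge// /tuple_value (negbTE np) invg1 mulg1.
have : at_vertex (star_root x) p := open_star_index (star_indexP x) xp.
have : at_vertex (star_root y) p := open_star_index (star_indexP y) yp.
rewrite /tuple_value /potential ep (star_index_edge xp ep) (star_index_edge yp ep).
rewrite /at_vertex /=.
set e : M := if cell_at M p \in o then cell_at M p else flip_of (cell_at M p).
have ee : is_edge_half e by rewrite /e; case: ifP; rewrite ?is_edge_half_flip.
have ends v : root_of (cell_at M p) = v \/ root_of (flip_of (cell_at M p)) = v ->
    root_of e = v \/ root_of (flip_of e) = v.
  by rewrite /e; case: ifP => _; rewrite ?flipK // => -[]; [right | left].
have /eqP/negbTE nl := no_loop ee.
move=> /ends[<-|<-] /ends[<-|<-]; rewrite ?eqxx ?nl 1?eq_sym ?nl /=;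
  rewrite ?(eq_sym (root_of (flip_of e))) ?nl ?mulgV ?invg1 ?mulg1 ?mul1g//.
Qed.

Lemma tuple_star_cover : open_cover (fun x => open_star (star_index M x)).
Proof.
move=> x; split=> [p xp|].
  have [e e0 he] := near_cell p; exists e => // q /he; move: xp.
  rewrite /open_star /=; case: ifP => vi.
    case: ifP => vp.
      have vE : root_of (cell_at M p) = cell_at M p by apply/eqP.
      by rewrite flip_vertex// vE => -[] <-.
    by move=> pi [->//|[_ ->]]; rewrite flipK; case: pi; [right|left].
  move=> pE; have li : is_leg (cell_at M p).
    by have := star_indexP x; rewrite vi pE.
  by rewrite leg_nvertex// leg_nedge// => -[->|[]].
rewrite /open_star /star_index /=.
case: (boolP (is_leg (cell_at M x))) => [lx|_]; first by rewrite leg_nvertex.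
by rewrite vertex_root; left.
Qed.

Lemma star_common_root x y p : ~~ is_edge_half (cell_at M p) ->
  open_star (star_index M x) p -> open_star (star_index M y) p ->
  star_root x = star_root y.
Proof.
rewrite /star_root => np.
suff rt i : open_star (star_index M i) p ->
    root_of (star_index M i) = root_of (cell_at M p).
  by move=> /rt -> /rt ->.
move=> /(open_star_index (star_indexP i)) [<-//|<-].
have [vp|/nvertexE[ep|lp]] := boolP (is_vertex (cell_at M p)).
- by rewrite flip_vertex.
- by rewrite ep in np.
- by rewrite is_leg_flip.
Qed.

(** The cocycle identity is that of a coboundary, by [tuple_value_potential]; near
    a vertex the cochain is trivial, as no other star contains the vertex. *)
Lemma tuple_cocycle g : cocycle sheaf (tuple_cochain D o g).
Proof.
split=> /=; first exact: tuple_star_cover.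
- move=> x y; apply/sheafP => p [xp yp].
  exists (tuple_value o g (star_index M x) (star_index M y) (cell_at M p)).
  have [e e0 he] := near_cell p; exists e => // q /he + [xq yq].
  rewrite !tuple_value_potential//; case: ifP => vp.
    by rewrite (star_common_root _ xp yp) /is_edge_half ?vp// !mulgV.
  by case=> [->|[_ ->]] //; rewrite !potential_flip.
- move=> x y t p xp yp tp; rewrite !tuple_value_potential//.
  coset_eq abel.
Qed.

Lemma edge_orientedP (x : M) : is_edge_half x ->
  exists2 e, e \in o & e = x \/ e = flip_of x.
Proof.
move=> ex; have [xo|xo] := boolP (x \in o); first by exists x => //; left.
by exists (flip_of x); [rewrite (edge_orient orientM) ?flipK ?is_edge_half_flip | right].
Qed.

Lemma star_ends x p e : e = cell_at M p \/ e = flip_of (cell_at M p) ->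
  open_star (star_index M x) p -> star_root x = root_of e \/ star_root x = root_of (flip_of e).
Proof.
rewrite /star_root => eE /(open_star_index (star_indexP x)); rewrite /at_vertex.
by case: eE => ->; rewrite ?flipK => -[<-|<-]; by [left | right].
Qed.

Lemma potential_source g e : e \in o -> potential g (root_of e) e = 1.
Proof.
move=> eo; have ee := orient_edge orientM eo; rewrite /potential ee eo.
by case: eqP => // /esym/(no_loop ee).
Qed.

Lemma potential_target g e : e \in o -> potential g (root_of (flip_of e)) e = g e.
Proof.
by move=> eo; rewrite /potential (orient_edge orientM eo) eo eqxx.
Qed.

Lemma codil_cell e p : e = cell_at M p \/ e = flip_of (cell_at M p) -> C p = codil D e.
Proof. by case=> ->; rewrite ?codil_flip. Qed.

Lemma potential_cell g v e p : e = cell_at M p \/ e = flip_of (cell_at M p) ->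
  potential g v (cell_at M p) = potential g v e.
Proof. by case=> ->; rewrite ?potential_flip. Qed.

(** The cochains differ by the coboundary of the function that is [k v] on the
    star of [v]. *)
Lemma tuple_equiv_cohomologous g g' : tuple_equiv D o g g' ->
  cohomologous sheaf (tuple_cochain D o g) (tuple_cochain D o g').
Proof.
move=> [k kE].
exists (fun x => open_star (star_index M x)), (fun x p => k (star_root x) *: C p).
split=> //=.
- exact: tuple_star_cover.
- by move=> x; apply/sheafP => p _; exists (k (star_root x)), 1%R.
move=> x y p xp yp; rewrite !tuple_value_potential// !(lcoset_inv abel) !(lcoset_mul abel).
apply/(lcoset_eq abel); have [ep|np] := boolP (is_edge_half (cell_at M p)); last first.
  rewrite !potential_nedge// (star_common_root np xp yp).
  set a := (X in X \in _); suff -> : a = 1 by exact: group1.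
  by rewrite /a; abelian_eq abel.
have [e eo eE] := edge_orientedP ep.
rewrite (codil_cell eE) !(potential_cell _ _ eE).
have rel := kE e eo; set a := (X in X \in _).
pose b := (g' e * (g e)^-1 * (k (root_of (flip_of e)) * (k (root_of e))^-1)^-1).
suff [->|[->|->]] : a = 1 \/ a = b \/ a = b^-1 by rewrite ?groupV.
rewrite /a /b; case: (star_ends eE xp) (star_ends eE yp) => -> [] ->;
  rewrite ?potential_source ?potential_target//.
- by left; abelian_eq abel.
- by right; left; abelian_eq abel.
- by right; right; abelian_eq abel.
- by left; abelian_eq abel.
Qed.

Lemma constant_on_cell h (f : R -> {set gT}) : (forall t, idom h t ->
    exists a, exists2 e : R, (0 < e)%R & forall s, `|s - t|%R < e -> idom h s -> f s = a *: codil D h) ->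
  forall s t, idom h s -> idom h t -> f s = f t.
Proof.
move=> loc; suff le s t : idom h s -> idom h t -> s <= t -> f s = f t.
  move=> s t is_ it; case: (leP s t) => [|/ltW]; first exact: le.
  by move/le => /(_ it is_).
move=> is_ it st; apply: (@interval_ind R (fun s t => f s = f t)) => //.
  by move=> ? ? ? _ _ _ _ ->.
move=> u sut; have iu := idom_convex is_ it sut; have [a [e e0 he]] := loc u iu.
exists e => // w swt wu; have iw := idom_convex is_ it swt.
by rewrite !he// ?subrr ?normr0.
Qed.

(** Conversely, let [u] be a coboundary relating the two cochains.  Dividing
    [u x] by the quotient of the potentials makes it independent of [x]; the
    result is constant on the open edges, and comparing it near the ends of an
    edge with the values of [u] at the end vertices gives the relation. *)
Lemma cohomologous_tuple_equiv g g' :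
  cohomologous sheaf (tuple_cochain D o g) (tuple_cochain D o g') ->
  tuple_equiv D o g g'.
Proof.
move=> [W [u [cW Wst uF uE]]] /=.
pose th v x := potential g' v x * (potential g v x)^-1.
pose s p := u p p * ((th (star_root p) (cell_at M p))^-1 *: C p).
have sE x p : W x p -> s p = u x p * ((th (star_root x) (cell_at M p))^-1 *: C p).
  move=> xp; have [_ pp] := cW p; have := uE x p p xp pp.
  have [xst _] := Wst _ _ xp; have [pst _] := Wst _ _ pp.
  rewrite /= !tuple_value_potential// /s /th.
  have [a ->] := sheaf_coset (uF x) xp; have [b ->] := sheaf_coset (uF p) pp.
  rewrite !(lcoset_inv abel) !(lcoset_mul abel) => /(lcoset_eq abel) H.
  apply/(lcoset_eq abel); rewrite -groupV.
  by apply: (mem_congr _ H); abelian_eq abel.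
have uk v : is_vertex v -> exists a, exists2 e : R, (0 < e)%R & forall q,
    (gdist (par v 0%R) q < e%:E)%E -> W (par v 0%R) q /\ u (par v 0%R) q = a *: C q.
  move=> vv; have [oW Wv] := cW (par v 0%R); have [e1 e10 h1] := oW _ Wv.
  have [a [e2 e20 h2]] := iffLR (sheafP _ _) (uF (par v 0%R)) _ Wv.
  exists a, (Num.min e1 e2) => [|q vq]; first by rewrite lt_min e10.
  have Wq : W (par v 0%R) q.
    by apply: h1; apply: lt_le_trans vq _; rewrite lee_fin ge_min lexx.
  split=> //; apply: h2 => //; apply: lt_le_trans vq _.
  by rewrite lee_fin ge_min lexx orbT.
have [k kE] : {k : M -> gT & forall v, is_vertex v -> exists2 e : R, (0 < e)%R & forall q,
    (gdist (par v 0%R) q < e%:E)%E -> W (par v 0%R) q /\ u (par v 0%R) q = k v *: C q}.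
  apply: (@choice _ _ (fun v a => is_vertex v -> exists2 e : R, (0 < e)%R & forall q,
    (gdist (par v 0%R) q < e%:E)%E -> W (par v 0%R) q /\ u (par v 0%R) q = a *: C q)) => v.
  have [vv|nv] := boolP (is_vertex v); last by exists 1.
  by have [a ha] := uk v vv; exists a.
exists k => e eo; have ee := orient_edge orientM eo.
(* used for both halves [h] of [e] *)
have s_near h : is_edge_half h -> exists2 t, idom h t &
    s (par h t) = (k (root_of h) * (th (root_of h) h)^-1) *: codil D h.
  move=> eh; have [r r0 hr] := kE _ (vertex_root h).
  have [t it tr] := idom_dense (negbT (edge_nvertex eh)) (cdom0 h) r0.
  have t0 := idom_gt0 (negbT (edge_nvertex eh)) it.
  exists t => //; have [|Wt ut] := hr (par h t).
    rewrite -par_root; apply: le_lt_trans (gd_cell (cdom0 h) (idom_cdom it)) _.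
    by rewrite lte_fin.
  have hE : h = cell_at M (par h t) \/ h = flip_of (cell_at M (par h t)).
    by case: (cell_at_par it) => [->|[_ ->]]; rewrite ?flipK; [left|right].
  rewrite (sE _ _ Wt) ut (codil_cell hE) (lcoset_mul abel) /th !(potential_cell _ _ hE).
  by rewrite star_root_vertex// vertex_root.
have s_const t t' : idom e t -> idom e t' -> s (par e t) = s (par e t').
  apply: (constant_on_cell (f := fun t => s (par e t))) => {t'}t it.
  have [oW Wp] := cW (par e t); have [e1 e10 h1] := oW _ Wp.
  have [a [e2 e20 h2]] := iffLR (sheafP _ _) (uF (par e t)) _ Wp.
  exists (a * (th (star_root (par e t)) e)^-1), (Num.min e1 e2) => [|r].
    by rewrite lt_min e10.
  rewrite lt_min => /andP[r1 r2] ir.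
  have le : (gdist (par e t) (par e r) <= `|r - t|%:E)%E.
    by apply: gd_cell; exact: idom_cdom.
  have Wr : W (par e t) (par e r).
    by apply: h1; apply: le_lt_trans le _; rewrite lte_fin.
  have hE : e = cell_at M (par e r) \/ e = flip_of (cell_at M (par e r)).
    by case: (cell_at_par ir) => [->|[_ ->]]; rewrite ?flipK; [left|right].
  rewrite (sE _ _ Wr) h2//; last by apply: le_lt_trans le _; rewrite lte_fin.
  by rewrite (codil_cell hE) (lcoset_mul abel) /th !(potential_cell _ _ hE).
have efe : is_edge_half (flip_of e) by rewrite is_edge_half_flip.
have [t1 it1 s1] := s_near e ee; have [t2 it2 s2] := s_near (flip_of e) efe.
have it2' : idom e (len e - t2) by have := idom_flip efe it2; rewrite flipK len_flip.
have := s_const _ _ it1 it2'.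
have -> : par e (len e - t2) = par (flip_of e) t2.
  by rewrite -(par_flip_closed efe (idom_cdom it2)) flipK len_flip.
rewrite s1 s2 codil_flip => /(lcoset_eq abel).
rewrite /th !potential_flip !potential_source// !potential_target// => H.
by apply: (mem_congr _ H); abelian_eq abel.
Qed.
End Tuples.
End Cech.

(** * Acyclicity of the stars *)

Section Acyclicity.
Variables (R : realType) (gT : finGroupType) (Γ : curve R).
Hypothesis abel : abelian [set: gT]%SET.
Variables (M : modelOf Γ) (D : Γ -> {group gT}).
Hypothesis simpleM : simple_graph M.
Variable o : {set M}.
Hypothesis orientM : orientation o.
Variable z : cochain gT Γ.
Hypothesis cz : cocycle (codilation_sheaf M D) z.
Local Notation cdom := (closed_dom (@len _ _ _ M)).
Local Notation idom := (inner_dom (@len _ _ _ M)).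
Local Notation C p := (codil D (cell_at M p)).
Local Notation sheaf := (codilation_sheaf M D).
Local Notation U := (open_of z).
Local Open Scope group_scope.
Implicit Types (h v : M) (p q : Γ) (a b c : gT).

Lemma translation_is_action : is_action [set: gT]%SET (fun (A : {set gT}) a => A :* a).
Proof.
split=> [a A B /(congr1 (fun A : {set gT} => A :* a^-1))|A a b _ _].
  by rewrite -!mulgA !mulg_set1 mulgV !mulg1.
by rewrite -mulgA mulg_set1.
Qed.

Definition translation : {action gT &-> {set gT}} := Action translation_is_action.

(** The cocycle [z] defines a torsor.  Its fiber at [q] is identified, through
    the open set of index [q], with the cosets of the codilation group at [q].
    In these terms [chart p q] is the value at [q] of the unit section over the
    open set of index [p]. *)
Local Notation chart p q := (value z p q q).

Lemma self_cover p : U p p.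
Proof. by have [cov _ _] := cz; have [] := cov p. Qed.

Lemma cover_ball p : exists2 e : R, (0 < e)%R & forall q, (gdist p q < e%:E)%E -> U p q.
Proof. by have [cov _ _] := cz; have [op pp] := cov p; exact: op. Qed.

Lemma chart_coset p q : U p q -> exists a, chart p q = a *: C q.
Proof. by move=> pq; apply: cocycle_coset cz pq (self_cover q). Qed.

Lemma chart_change p q : U p q -> exists a, exists2 e : R, (0 < e)%R &
  forall r, (gdist q r < e%:E)%E -> U p r -> U q r /\ chart p r = chart q r :* a.
Proof.
move=> pq; have [cov sh mul] := cz.
have [a [e1 e10 h1]] := iffLR (sheafP _ _ _ _) (sh p q) q (conj pq (self_cover q)).
have [e2 e20 h2] := cover_ball q.
exists a, (Num.min e1 e2) => [|r qr pr]; first by rewrite lt_min e10.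
have Uqr : U q r by apply: h2; apply: lt_le_trans qr _; rewrite lee_fin ge_min lexx orbT.
split=> //; rewrite -(mul p q r r pr Uqr (self_cover r)) h1//; last first.
  by apply: lt_le_trans qr _; rewrite lee_fin ge_min lexx.
have [b ->] := chart_coset Uqr; coset_eq abel.
Qed.

Section OnCell.
Variable h : M.
Hypothesis nh : ~~ is_vertex h.

(** Sections of the torsor near the point of parameter [t] of the cell [h]. *)
Definition cell_section (t : R) (f : R -> {set gT}) : Prop :=
  exists c, exists2 e : R, (0 < e)%R & forall s, (`|s - t| < e)%R -> 
    [/\ idom h s, U (par h t) (par h s) & f s = chart (par h t) (par h s) :* c].

Lemma cell_par_near t (e : R) : idom h t -> (0 < e)%R -> exists2 e' : R, (0 < e')%R &
  forall s, (`|s - t| < e')%R -> [/\ idom h s, (`|s - t| < e)%R,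
    (gdist (par h t) (par h s) < e%:E)%E & U (par h t) (par h s)].
Proof.
move=> it e0; have [e1 e10 h1] := cover_ball (par h t).
have [e2 e20 h2] := idom_open nh it.
exists (Num.min e (Num.min e1 e2)) => [|s]; first by rewrite !lt_min e0 e10.
rewrite !lt_min => /and3P[se se1 /h2 is_].
have le := gd_cell (idom_cdom it) (idom_cdom is_).
by split=> //; [|apply: h1]; apply: le_lt_trans le _; rewrite lte_fin.
Qed.

Lemma chart_section p (f : R -> {set gT}) t (e : R) : (0 < e)%R -> idom h t ->
  (forall s, (`|s - t| < e)%R -> idom h s -> U p (par h s) /\ f s = chart p (par h s)) ->
  cell_section t f.
Proof.
move=> e0 it fE.
have [pt _] : U p (par h t) /\ f t = chart p (par h t).
  by apply: fE => //; rewrite subrr normr0.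
have [a [e1 e10 h1]] := chart_change pt.
have m0 : (0 < Num.min e e1)%R by rewrite lt_min e0.
have [e2 e20 h2] := cell_par_near it m0.
exists a, e2 => // s /h2[is_]; rewrite lt_min => /andP[se _] d ts; split=> //.
have [ps ->] := fE s se is_.
have [||_ ->] := h1 (par h s) => //.
by apply: lt_le_trans d _; rewrite lee_fin ge_min lexx orbT.
Qed.

Lemma cell_section_stab t f : cell_section t f ->
  forall a, translation (f t) a = f t <-> a \in codil D h.
Proof.
move=> [c [e e0 /(_ t)]]; rewrite subrr normr0 => /(_ e0)[it Ut ->] a /=.
have [b ->] := chart_coset Ut; rewrite (codil_par D it) !(lcoset_act abel) (lcoset_eq abel).
have -> : b * c * a * (b * c)^-1 = a by abelian_eq abel.
by [].
Qed.

Lemma cell_section_torsor t f f' : cell_section t f -> cell_section t f' ->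
  exists c, exists2 e : R, (0 < e)%R & forall s, (`|s - t| < e)%R ->
    f' s = translation (f s) c.
Proof.
move=> [c [e e0 he]] [c' [e' e'0 he']].
exists (c^-1 * c'), (Num.min e e') => [|s]; first by rewrite lt_min e0.
rewrite lt_min => /andP[/he[_ _ ->] /he'[_ _ ->]] /=.
by rewrite -!mulgA !mulg_set1 mulKVg.
Qed.

Lemma cell_section_move t f f' c (e : R) : (0 < e)%R -> cell_section t f ->
  (forall s, (`|s - t| < e)%R -> f' s = translation (f s) c) -> cell_section t f'.
Proof.
move=> e0 [c0 [e1 e10 h1]] fE.
exists (c0 * c), (Num.min e e1) => [|s]; first by rewrite lt_min e0.
rewrite lt_min => /andP[/fE -> /h1[is_ ts ->]]; split=> //=.
by rewrite -mulgA mulg_set1.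
Qed.

Lemma cell_section_exists t : idom h t -> exists f, exists2 e : R, (0 < e)%R &
  forall s, (`|s - t| < e)%R -> cell_section s f.
Proof.
move=> it; have [e e0 he] := cell_par_near it ltr01.
exists (fun s => chart (par h t) (par h s)), e => // s st.
have [is_ _ _ _] := he s st.
apply: (@chart_section (par h t) _ s (e - `|s - t|)) => //; first by rewrite subr_gt0.
move=> r rs ir; split=> //; have [|//] := he r.
by have := ler_distD s r t; lra.
Qed.

(** The torsor has a section over the open cell by patching.  The chart of the
    root is another one near the root, and they agree there after a
    translation; this lets the sections on the cells at a vertex fit together
    to a section on its star. *)
Lemma cell_trivialization : exists f : R -> {set gT},
  (forall t, idom h t -> cell_section t f) /\
  exists2 e : R, (0 < e)%R & forall t, idom h t -> (t < e)%R ->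
    U (par (root_of h) 0%R) (par h t) /\ f t = chart (par (root_of h) 0%R) (par h t).
Proof.
have [t0 it0 _] := idom_dense nh (cdom0 h) (ltr01 : (0 < 1 :> R)%R).
have conv u u' w : idom h u -> idom h u' -> (u <= w <= u')%R -> idom h w.
  exact: idom_convex.
have stab t f : idom h t -> cell_section t f ->
    forall a, translation (f t) a = f t <-> a \in codil D h.
  by move=> _; exact: cell_section_stab.
have tors t f f' : idom h t -> cell_section t f -> cell_section t f' ->
    exists c, exists2 e : R, (0 < e)%R & forall s, (`|s - t| < e)%R ->
      f' s = translation (f s) c.
  by move=> _; exact: cell_section_torsor.
have [f fS] : exists f, forall t, idom h t -> cell_section t f.
  apply: (@global_section _ _ _ translation (idom h) cell_section (codil D h)) it0 => //.
  - by move=> u; exact: idom_open.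
  - by move=> t f f' c e _; exact: cell_section_move.
  - exact: cell_section_exists.
set v := par (root_of h) 0%R; have [e e0 he] := cover_ball v.
pose g t := chart v (par h t).
have vU t : idom h t -> (t < e)%R -> U v (par h t).
  move=> it te; apply: he; rewrite /v -par_root.
  apply: le_lt_trans (gd_cell (cdom0 h) (idom_cdom it)) _.
  by rewrite subr0 gtr0_norm ?(idom_gt0 nh it).
have gS t : idom h t -> (t < e)%R -> cell_section t g.
  move=> it te; apply: (@chart_section v g t (e - t)) => //; first by rewrite subr_gt0.
  move=> s st is_; split=> //; apply: vU => //.
  by move: st; rewrite ltr_norml => /andP[_ ?]; lra.
have [t1 it1 t1e] := idom_dense nh (cdom0 h) e0.
rewrite subr0 gtr0_norm ?(idom_gt0 nh it1)// in t1e.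
have [c [e1 e10 fg]] := tors t1 f g it1 (fS _ it1) (gS _ it1 t1e).
exists (fun t => f t :* c); split.
  move=> t it; apply: (@cell_section_move t f _ c 1%R) => //; exact: fS.
exists e => // t it te; split; first exact: vU.
have gt1 : g t1 = translation (f t1) c by apply: fg; rewrite subrr normr0.
have [le|/ltW le] := leP t t1.
  symmetry; apply: (@section_unique _ _ _ translation (idom h) cell_section (codil D h) conv
    stab tors t t1 f g it it1 _ _ t1 t c _ _ gt1); rewrite ?lexx ?le//.
    by move=> w wt; apply: fS; exact: conv wt.
  by move=> w /[dup] wt /andP[_ wt1]; apply: gS; [exact: conv wt | exact: le_lt_trans wt1 t1e].
symmetry; apply: (@section_unique _ _ _ translation (idom h) cell_section (codil D h) conv
    stab tors t1 t f g it1 it _ _ t1 t c _ _ gt1); rewrite ?lexx ?le//.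
  by move=> w wt; apply: fS; exact: conv wt.
by move=> w /[dup] wt /andP[_ wt1]; apply: gS; [exact: conv wt | exact: le_lt_trans wt1 te].
Qed.
End OnCell.

Definition cell_sec h : R -> {set gT} :=
  match pselect (~~ is_vertex h) with
  | left nh => projT1 (cid (cell_trivialization nh))
  | right _ => fun=> 1
  end.

Lemma cell_secP h : ~~ is_vertex h ->
  (forall t, idom h t -> cell_section h t (cell_sec h)) /\
  exists2 e : R, (0 < e)%R & forall t, idom h t -> (t < e)%R ->
    U (par (root_of h) 0%R) (par h t) /\
    cell_sec h t = chart (par (root_of h) 0%R) (par h t).
Proof.
by move=> nh; rewrite /cell_sec; case: pselect => // nh'; case: cid.
Qed.

Definition cell_coord p : R := projT1 (cid (cell_atP M p)).

Lemma cell_coordP p : idom (cell_at M p) (cell_coord p) /\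
  p = par (cell_at M p) (cell_coord p).
Proof. by rewrite /cell_coord; case: cid. Qed.

(** The section of the torsor over the star of [v].  An inner point of an edge is
    parametrized from the end [v] of the edge. *)
Definition star_sec v p : {set gT} :=
  if is_vertex (cell_at M p) then chart p p else
  if root_of (cell_at M p) == v then cell_sec (cell_at M p) (cell_coord p)
  else cell_sec (flip_of (cell_at M p)) (len (cell_at M p) - cell_coord p)%R.

Lemma star_sec_vertex v p : is_vertex (cell_at M p) -> star_sec v p = chart p p.
Proof. by rewrite /star_sec => ->. Qed.

Lemma star_sec_par h t : ~~ is_vertex h -> idom h t ->
  star_sec (root_of h) (par h t) = cell_sec h t.
Proof.
move=> nh it; rewrite /star_sec.
have [ic pE] := cell_coordP (par h t).
have [hE|[eh hE]] := cell_at_par it; rewrite hE in ic pE *.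
  rewrite (negbTE nh) eqxx; congr (cell_sec h _).
  by case: (par_inj it ic pE) => [[]//|[eh /(edge_flip_neq eh)]].
rewrite is_vertex_flip (negbTE nh) ifF; last first.
  by apply/eqP => /esym/(no_loop simpleM eh).
rewrite flipK; congr (cell_sec h _).
case: (par_inj it ic pE) => [[/(edge_flip_neq eh)//]|[_ _ ->]].
by rewrite len_flip; lra.
Qed.

Lemma at_vertex_par v p : at_vertex v p -> ~~ is_vertex (cell_at M p) ->
  exists h t, [/\ ~~ is_vertex h, idom h t, root_of h = v & p = par h t].
Proof.
have [it pE] := cell_coordP p; move=> av np; case: av => rv.
  by exists (cell_at M p), (cell_coord p).
case/nvertexE: (np) => [ep|lp]; last first.
  by exists (cell_at M p), (cell_coord p); split=> //; rewrite -(is_leg_flip lp).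
exists (flip_of (cell_at M p)), (len (cell_at M p) - cell_coord p)%R; split=> //.
- by rewrite is_vertex_flip.
- exact: idom_flip.
- by rewrite par_flip_closed//; exact: idom_cdom.
Qed.

(* the section property, which at [v] itself holds with the translation 1 *)
Lemma star_sec_local v p : at_vertex v p -> exists c, exists2 e : R, (0 < e)%R &
  forall q, (gdist p q < e%:E)%E -> U p q /\ star_sec v q = chart p q :* c.
Proof.
move=> av; have [vp|np] := boolP (is_vertex (cell_at M p)).
  have [it pE] := cell_coordP p; have t0 := iffLR (idom_vertex _ vp) it.
  have vE : cell_at M p = v.
    by case: av; rewrite ?(flip_vertex vp) (root_vertex vp).
  rewrite t0 vE in pE; rewrite vE in vp; clear it t0 vE.
  have [r r0 hr] := mesh M; have [e1 e10 h1] := cover_ball p.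
  have [e2 e20 h2] : exists2 e : R, (0 < e)%R & forall h, ~~ is_vertex h ->
      forall t, idom h t -> (t < e)%R ->
      cell_sec h t = chart (par (root_of h) 0%R) (par h t).
    apply: (@finite_radius R M (fun h e => ~~ is_vertex h ->
      forall t, idom h t -> (t < e)%R ->
      cell_sec h t = chart (par (root_of h) 0%R) (par h t))).
      by move=> h e e' _ ee he nh t it te; apply: he => //; exact: lt_le_trans te ee.
    move=> h; have [vh|nh] := boolP (is_vertex h); first by exists 1%R.
    by have [_ [e e0 he]] := cell_secP nh; exists e => // _ t it /(he t it)[].
  exists 1, (Num.min r (Num.min e1 e2)) => [|q pq]; first by rewrite !lt_min r0 e10.
  have [pqr pq1 pq2] : [/\ (gdist p q < r%:E)%E, (gdist p q < e1%:E)%E &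
      (gdist p q < e2%:E)%E].
    by split; apply: lt_le_trans pq _; rewrite lee_fin !ge_min lexx ?orbT.
  have Upq := h1 _ pq1; split=> //; rewrite mulg1.
  rewrite pE in pqr pq2 *; have [h [s [rh ch sr qE ds]]] := vertex_ball hr vp pqr.
  have [vq|nq] := boolP (is_vertex (cell_at M q)).
    rewrite star_sec_vertex//; case: (cdomP ch) => [ih|[_ s0]|[eh sE]].
    - have vh : is_vertex h.
        by move: vq; rewrite qE; case: (cell_at_par ih) => [->//|[_ ->]]; rewrite is_vertex_flip.
      by rewrite qE (iffLR (idom_vertex _ vh) ih) -rh (root_vertex vh).
    - by rewrite qE s0 par_root rh.
    - by exfalso; move: sr; rewrite sE ltNge; have := hr _ eh => ?; apply/negP; rewrite negbK; lra.
  case: (cdomP ch) => [ih|[_ s0]|[eh sE]].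
  - have nh : ~~ is_vertex h.
      by move: nq; rewrite qE; case: (cell_at_par ih) => [->//|[_ ->]]; rewrite is_vertex_flip.
    rewrite qE -rh star_sec_par// h2//.
    by move: pq2; rewrite ds lte_fin.
  - by move: nq; rewrite qE s0 par_root rh vertex_at// vp.
  - by exfalso; move: sr; rewrite sE ltNge; have := hr _ eh => ?; apply/negP; rewrite negbK; lra.
have [h [t [nh it <- ->]]] := at_vertex_par av np.
have [sec _] := cell_secP nh; have [c [e e0 he]] := sec t it.
have [e1 e10 h1] := idom_open nh it.
exists c, (Num.min e e1) => [|q]; first by rewrite lt_min e0.
move=> pq; have [|s [st -> _]] := inner_ball nh it (r := Num.min e e1) _ pq.
  by move=> s; rewrite lt_min => /andP[_ /h1].
move: st; rewrite lt_min => /andP[/he[is_ Us fE] _]; split=> //.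
by rewrite star_sec_par.
Qed.

Lemma star_sec_coset v p : at_vertex v p -> exists a, star_sec v p = a *: C p.
Proof.
move=> /star_sec_local[c [e e0 /(_ p)]].
rewrite gdist_refl lte_fin => /(_ e0)[pp ->]; have [a ->] := chart_coset pp.
by exists (a * c); coset_eq abel.
Qed.

Lemma edge_at_vertex e t : is_edge_half e -> idom e t ->
  at_vertex (root_of e) (par e t) /\ at_vertex (root_of (flip_of e)) (par e t).
Proof.
rewrite /at_vertex => ee it; case: (cell_at_par it) => [->|[_ ->]]; rewrite ?flipK.
  by split; [left | right].
by split; [right | left].
Qed.

Lemma star_sec_ratio e : is_edge_half e -> exists a, forall t, idom e t ->
  star_sec (root_of e) (par e t) * (star_sec (root_of (flip_of e)) (par e t))^-1 =
  a *: codil D e.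
Proof.
move=> ee; have ne := negbT (edge_nvertex ee).
set f := fun t => star_sec (root_of e) (par e t) * (star_sec (root_of (flip_of e)) (par e t))^-1.
have loc t : idom e t -> exists a, exists2 r : R, (0 < r)%R & forall s,
    (`|s - t|)%R < r -> idom e s -> f s = a *: codil D e.
  move=> it; have [as_ at_] := edge_at_vertex ee it.
  have [c [e1 e10 h1]] := star_sec_local as_; have [c' [e2 e20 h2]] := star_sec_local at_.
  exists (c * c'^-1), (Num.min e1 e2) => [|s]; first by rewrite lt_min e10.
  rewrite lt_min => /andP[s1 s2] is_.
  have le := gd_cell (idom_cdom it) (idom_cdom is_).
  have [|Us sE] := h1 (par e s); first by apply: le_lt_trans le _; rewrite lte_fin.
  have [|_ tE] := h2 (par e s); first by apply: le_lt_trans le _; rewrite lte_fin.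
  rewrite /f sE tE; have [b ->] := chart_coset Us; rewrite (codil_par D is_).
  coset_eq abel.
have [t0 it0 _] := idom_dense ne (cdom0 e) (ltr01 : (0 < 1 :> R)%R).
have [a [r r0 /(_ t0)]] := loc t0 it0; rewrite subrr normr0 => /(_ r0 it0) fE.
by exists a => t it; rewrite -fE; exact: (constant_on_cell loc).
Qed.

(** The tuple is the ratio of the sections over the two stars containing an
    edge, a constant along the edge.  The coboundary relating the two cocycles
    is, in the open set of index [x], the ratio of its unit section and of the
    section over the star. *)
Lemma cocycle_tuple : exists g, cohomologous sheaf z (tuple_cochain D o g).
Proof.
have [g gE] : {g : M -> gT & forall e, is_edge_half e -> forall t, idom e t ->
    star_sec (root_of e) (par e t) * (star_sec (root_of (flip_of e)) (par e t))^-1 =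
    g e *: codil D e}.
  apply: (@choice _ _ (fun e a => is_edge_half e -> forall t, idom e t ->
    star_sec (root_of e) (par e t) * (star_sec (root_of (flip_of e)) (par e t))^-1 =
    a *: codil D e)) => e.
  have [ee|_] := boolP (is_edge_half e); last by exists 1.
  by have [a aE] := star_sec_ratio ee; exists a.
exists g.
have at_star x p : open_star (star_index M x) p -> at_vertex (star_root M x) p.
  exact: (open_star_index (star_indexP M x)).
exists (fun x => U x `&` open_star (star_index M x)),
  (fun x p => chart x p * (star_sec (star_root M x) p)^-1); split.
- have [cov _ _] := cz; apply: open_coverI cov _; exact: tuple_star_cover.
- by move=> x p.
- move=> x; apply/sheafP => p [xp xs].
  have [a [e1 e10 h1]] := chart_change xp; have [c [e2 e20 h2]] := star_sec_local (at_star _ _ xs).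
  exists (a * c^-1), (Num.min e1 e2) => [|q pq [xq _]]; first by rewrite lt_min e10.
  have [|Upq ->] := h1 q _ xq; first by apply: lt_le_trans pq _; rewrite lee_fin ge_min lexx.
  have [|_ ->] := h2 q; first by apply: lt_le_trans pq _; rewrite lee_fin ge_min lexx orbT.
  by have [b ->] := chart_coset Upq; coset_eq abel.
move=> x y p [xp xs] [yp ys]; have [_ _ mul] := cz.
rewrite /= (tuple_value_potential simpleM)// -(mul x y p p xp yp (self_cover p)).
have [a ->] := cocycle_coset cz xp yp; have [b ->] := chart_coset yp.
have -> : (a *: C p) * ((b *: C p) * (star_sec (star_root M y) p)^-1 *
    ((a *: C p) * (b *: C p) * (star_sec (star_root M x) p)^-1)^-1) =
    star_sec (star_root M x) p * (star_sec (star_root M y) p)^-1.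
  have [c ->] := star_sec_coset (at_star _ _ xs).
  by have [d ->] := star_sec_coset (at_star _ _ ys); coset_eq abel.
have triv v : at_vertex v p -> star_sec v p * (star_sec v p)^-1 = 1 *: C p.
  by move=> /star_sec_coset[c ->]; coset_eq abel.
have [ep|np] := boolP (is_edge_half (cell_at M p)); last first.
  rewrite !potential_nedge// (star_common_root np xs ys) triv ?invg1 ?mulg1//.
  exact: at_star.
have [e eo eE] := edge_orientedP orientM ep; have ee := orient_edge orientM eo.
rewrite !(potential_cell orientM _ _ eE).
have [t [it pE]] : exists t, idom e t /\ p = par e t.
  have [ic pE] := cell_coordP p; case: eE => ->; first by exists (cell_coord p).
  exists (len (cell_at M p) - cell_coord p)%R; split; first exact: idom_flip.
  by rewrite par_flip_closed//; exact: idom_cdom.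
have gp := gE e ee t it; rewrite -pE -(codil_cell _ eE) in gp.
have [as_ at_] := edge_at_vertex ee it; rewrite -pE in as_ at_.
case: (star_ends eE xs) (star_ends eE ys) => -> [] ->;
  rewrite ?(potential_source simpleM orientM) ?(potential_target orientM)//.
- by rewrite triv// invg1 mulg1.
- by rewrite gp invg1 mulg1.
- rewrite mul1g -lcoset_inv// -gp.
  have [c ->] := star_sec_coset as_; have [d ->] := star_sec_coset at_; coset_eq abel.
- by rewrite triv// mulgV.
Qed.
End Acyclicity.

(** * The classification *)

Section Classification.
Variables (R : realType) (gT : finGroupType) (Γ : curve R).
Hypothesis abel : abelian [set: gT]%SET.
Variables (D : Γ -> {group gT}) (M : modelOf Γ) (DG : M -> {group gT}).
Hypothesis DG_datum : graph_dilation_datum DG.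
Hypothesis D_par : forall x t, inner_dom (@len _ _ _ M) x t -> D (par x t) = DG x.
Variable o : {set M}.
Hypothesis orientM : orientation o.
Implicit Types (phi psi : harmonicCover gT Γ) (g : M -> gT).

Lemma tuple_equiv_in g1 g2 g1' g2' : {in o, g1 =1 g1'} -> {in o, g2 =1 g2'} ->
  tuple_equiv D o g1 g2 -> tuple_equiv D o g1' g2'.
Proof. by move=> e1 e2 [k kE]; exists k => h ho; rewrite -e1// -e2// kE. Qed.

Lemma tuple_equiv_refl g : tuple_equiv D o g g.
Proof.
exists (fun=> 1%g) => h _; set a := (X in X \in _).
by suff -> : a = 1%g by []; rewrite /a; abelian_eq abel.
Qed.

(** Through framings: equivalent tuples can be realized by framings with the same
    gluing elements, and an isomorphism carries framings to framings. *)
Lemma assigned_iso phi psi g g' : has_dilation D phi -> has_dilation D psi ->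
  assigned phi o g -> assigned psi o g' -> (tuple_equiv D o g g' <-> cover_iso phi psi).
Proof.
move=> dphi dpsi /(assigned_framing D_par orientM dphi)[lam [eta [fr etaE]]].
move=> /(assigned_framing D_par orientM dpsi)[lam' [eta' [fr' etaE']]].
split=> [eqv|iso].
  have [|lam2 fr2] := framing_change abel D_par orientM dphi fr (eta' := eta').
    by apply: tuple_equiv_in eqv => h ho; rewrite ?etaE ?etaE'.
  exact: framing_iso dphi dpsi fr2 fr'.
have [lam2 fr2] := framing_transport fr iso.
by apply: (tuple_equiv_in etaE etaE'); exact: (framings_equiv abel D_par orientM dpsi fr2 fr').
Qed.

(** The definition of a cover only provides a model over some model of the base.
    A model over [M] is obtained from the standard cover with the gluing
    elements of a framing, to which the cover is isomorphic. *)
Lemma assigned_exists phi : has_dilation D phi -> exists g, assigned phi o g.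
Proof.
move=> dphi; have [lam [eta fr]] := framing_exists D_par orientM dphi.
have [psi [dpsi /(_ o orientM) apsi]] := standard_cover abel DG_datum D_par eta.
have [lam' [eta' [fr' etaE']]] := assigned_framing D_par orientM dpsi apsi.
exists (edge_ratio eta); apply: assigned_transport apsi.
have [|lam2 fr2] := framing_change abel D_par orientM dpsi fr' (eta' := eta).
  by apply: tuple_equiv_in (tuple_equiv_refl (edge_ratio eta)) => h ho; rewrite ?etaE'.
exact: framing_iso dpsi dphi fr2 fr.
Qed.

(** The gluing elements are 1 at the sources and [g] at the targets. *)
Lemma realize_tuple g : exists phi, has_dilation D phi /\ assigned phi o g.
Proof.
pose eta x := if x \in o then 1%g else g (flip_of x).
have [phi [dphi /(_ o orientM) aphi]] := standard_cover abel DG_datum D_par eta.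
exists phi; split=> //; move: aphi => [M' [f [d [v0 [e0 [a [b [mm fv fe ab gE]]]]]]]].
exists M', f, d, v0, e0, a, b; split=> // h ho; rewrite -gE//.
have fho : flip_of h \in o = false.
  by apply/negbTE; rewrite -(edge_orient orientM)// (orient_edge orientM).
by rewrite /edge_ratio /eta ho fho flipK invg1 mulg1.
Qed.
End Classification.

Theorem theorem0p1 (R : realType) (gT : finGroupType)
    (abel : abelian [set: gT]%SET) (Γ : curve R) (D : dilationDatum gT Γ)
    (M : modelOf Γ) (o : {set M})
    (modelM : curve_model M) (simpleM : simple_graph M) (orientM : orientation o)
    (definedM : defined_on M D) :
  exists Theta : harmonicCover gT Γ -> set (cochain gT Γ),
    bijective_on_classes D (cech_H1 (codilation_sheaf M D)) Theta /\
    forall phi : harmonicCover gT Γ, has_dilation D phi ->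
      (exists g, assigned phi o g) /\
      (forall g, assigned phi o g ->
         Theta phi = tuple_class D o g).
Proof.
have [DG DG_datum D_par] := definedM.
have cocycleT := tuple_cocycle abel D simpleM orientM.
have classP g g' : tuple_class D o g = tuple_class D o g' <-> tuple_equiv D o g g'.
  rewrite /tuple_class (cohomology_classP abel (cocycleT g) (cocycleT g')).
  split; [exact: cohomologous_tuple_equiv | exact: tuple_equiv_cohomologous].
have D_par' x t : inner_dom (@len _ _ _ M) x t -> D (par x t) = DG x by exact: D_par.
pose Theta (phi : harmonicCover gT Γ) :=
  if pselect (exists g, assigned phi o g) is left ex
  then tuple_class D o (projT1 (cid ex)) else set0.
have isoP := assigned_iso abel D_par' orientM.
have ThetaE phi g : has_dilation D phi -> assigned phi o g -> Theta phi = tuple_class D o g.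
  move=> dphi ag; rewrite /Theta; case: pselect => [ex|[]]; last by exists g.
  case: cid => g' ag' /=; apply/classP; apply/(isoP _ _ _ _ dphi dphi ag' ag).
  by exists id; split=> //; exists id.
have exP := assigned_exists abel DG_datum D_par' orientM.
exists Theta; split; last first.
  by move=> phi dphi; split=> [|g]; [exact: exP | exact: ThetaE].
split.
- move=> phi dphi; have [g ag] := exP _ dphi; rewrite (ThetaE _ _ dphi ag).
  by exists (tuple_cochain D o g).
- move=> phi psi dphi dpsi; have [g ag] := exP _ dphi; have [g' ag'] := exP _ dpsi.
  rewrite (ThetaE _ _ dphi ag) (ThetaE _ _ dpsi ag').
  by apply: (iff_trans (classP g g')); exact: isoP.
- move=> K [z cz ->].
  have [g zg] := cocycle_tuple abel simpleM orientM cz.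
  have [phi [dphi ag]] := realize_tuple abel DG_datum D_par' orientM g.
  exists phi => //; rewrite (ThetaE _ _ dphi ag); symmetry.
  exact/(cohomology_classP abel cz (cocycleT g)).
Qed.
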